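(* The satisfiability problem of the fragment $\mathcal{F}$ of first-order logic is $\textsc{NP}$-complete.
   Context: The vocabulary contains only relation symbols (countably infinitely many of each arity $k\ge0$), with no constant or function symbols; models have nonempty domains. $Free(\varphi)$ denotes the set of free variables of $\varphi$. The fragment $\mathcal{F}$ of first-order logic (with equality) is defined as follows. 1. $R(x_1,\dots,x_n)\in\mathcal{F}$ and $x_1=x_2\in\mathcal{F}$ for all relation symbols $R$ and all variables $x_1,\dots,x_n$. 2. If $\varphi,\psi\in\mathcal{F}$ and $Free(\varphi)\cap Free(\psi)=\varnothing$, then $(\varphi\wedge\psi)\in\mathcal{F}$. 3. If $\varphi\in\mathcal{F}$, then $\neg\varphi\in\mathcal{F}$. 4. If $\varphi\in\mathcal{F}$, then $\exists x\,\varphi\in\mathcal{F}$ for any variable $x$. The satisfiability problem asks, given $\varphi\in\mathcal{F}$, whether there is a model and an assignment of its free variables satisfying $\varphi$. *)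

(* Defs.v *)
From HB Require Import structures.
From mathcomp Require Import all_boot all_order all_algebra.

Set Implicit Arguments.
Unset Strict Implicit.
Unset Printing Implicit Defensive.

(** * Syntax and semantics of first-order logic *)

(** Symbols are named by bit strings: this fixes a countably infinite supply of
    variables and of relation symbols of each arity, and gives every symbol a
    length when formulas are presented to a machine.  The same bit string used
    at two arities names two different relation symbols. *)
Definition var : Type := seq bool.
Definition relsym (n : nat) : Type := seq bool.

Inductive formula : Type :=
| Rel (n : nat) (R : relsym n) (xs : n.-tuple var)
| Equ (x y : var)
| And (phi psi : formula)
| Not (phi : formula)
| Ex (x : var) (phi : formula).

Fixpoint Free (phi : formula) : seq var :=
  match phi with
  | Rel _ _ xs => xs
  | Equ x y => [:: x; y]
  | And phi psi => Free phi ++ Free psi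
  | Not phi => Free phi
  | Ex x phi => [seq y <- Free phi | y != x]
  end.

Record model : Type := Model {
  dom : Type;
  dom_nonempty : inhabited dom;
  interp : forall n : nat, relsym n -> n.-tuple dom -> Prop }.

Definition update (D : Type) (s : var -> D) (x : var) (d : D) : var -> D :=
  fun y => if y == x then d else s y.

Fixpoint sat (M : model) (s : var -> dom M) (phi : formula) : Prop :=
  match phi with
  | Rel _ R xs => interp R (map_tuple s xs)
  | Equ x y => s x = s y
  | And phi psi => sat s phi /\ sat s psi
  | Not phi => ~ sat s phi
  | Ex x phi => exists d : dom M, sat (update s x d) phi
  end.

Definition satisfiable (phi : formula) : Prop :=
  exists (M : model) (s : var -> dom M), sat s phi.

(** ** The fragment F *)

Inductive fragF : formula -> Prop :=
| F_Rel n (R : relsym n) (xs : n.-tuple var) : fragF (Rel R xs)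
| F_Equ x y : fragF (Equ x y)
| F_And phi psi : fragF phi -> fragF psi ->
    (forall x, ~ (x \in Free phi /\ x \in Free psi)) -> fragF (And phi psi)
| F_Not phi : fragF phi -> fragF (Not phi)
| F_Ex x phi : fragF phi -> fragF (Ex x phi).

(** * Turing machines and polynomial time *)

Inductive move : Type := MoveLeft | Stay | MoveRight.

(** Deterministic multi-tape machines, with input alphabet [A] and output
    alphabet [B].  A cell is blank ([None]) or holds an input symbol, an output
    symbol or an auxiliary symbol.  There are [ntapes.+1] tapes, infinite in
    both directions; the first carries the input and the last the output (they
    coincide for single-tape machines). *)
Record TM (A B : finType) : Type := MkTM {
  ntapes : nat;
  state : finType;
  work : finType;
  start : state;
  halting : pred state;
  delta : state -> {ffun 'I_ntapes.+1 -> option (A + B + work)} ->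
          state * {ffun 'I_ntapes.+1 -> option (A + B + work) * move} }.

Section Execution.
Variables (A B : finType) (M : TM A B).

Definition cell : Type := option (A + B + work M).

Definition in_cell (a : A) : cell := Some (inl (inl a)).
Definition out_cell (b : B) : cell := Some (inl (inr b)).

Record config : Type := Config {
  cstate : state M;
  chead : 'I_(ntapes M).+1 -> int;
  ctape : 'I_(ntapes M).+1 -> int -> cell }.

Definition word_tape (s : seq cell) (i : int) : cell :=
  if i is Posz j then nth None s j else None.

Definition init (w : seq A) : config :=
  Config (start M) (fun=> 0%R)
    (fun t => word_tape (if t == ord0 then map in_cell w else [::])).

Definition move_head (m : move) (i : int) : int :=
  match m with
  | MoveLeft => (i - 1)%R
  | Stay => i
  | MoveRight => (i + 1)%R
  end.

Definition step (c : config) : config :=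
  if halting (cstate c) then c else
  let: (q, act) := delta (cstate c) [ffun t => ctape c t (chead c t)] in
  Config q
    (fun t => move_head (act t).2 (chead c t))
    (fun t i => if i == chead c t then (act t).1 else ctape c t i).

Definition computes_in_time (f : seq A -> seq B) (T : nat -> nat) : Prop :=
  forall w : seq A,
    let c := iter (T (size w)) step (init w) in
    halting (cstate c) /\ ctape c ord_max =1 word_tape (map out_cell (f w)).

End Execution.

Definition polytime_computable (A B : finType) (f : seq A -> seq B) : Prop :=
  exists (M : TM A B) (p : {poly nat}),
    computes_in_time M f (fun n => p.[n])%R.

Definition polytime_decidable (A : finType) (L : pred (seq A)) : Prop :=
  polytime_computable (fun w => [:: L w]).

(** * NP-completeness *)

(** The input [x] and the certificate [u] are presented to the verifier as one
    word over the disjoint union of their alphabets. *)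
Definition in_NP (A : finType) (L : seq A -> Prop) : Prop :=
  exists (p : {poly nat}) (V : pred (seq (A + bool))),
    polytime_decidable V /\
    forall x : seq A,
      L x <-> exists u : seq bool,
                size u <= p.[size x]%R /\ V (map inl x ++ map inr u).

Definition polytime_reducible (A B : finType)
    (L : seq A -> Prop) (L' : seq B -> Prop) : Prop :=
  exists f : seq A -> seq B,
    polytime_computable f /\ forall x, L x <-> L' (f x).

Definition NP_hard (B : finType) (L : seq B -> Prop) : Prop :=
  forall (A : finType) (L' : seq A -> Prop),
    in_NP L' -> polytime_reducible L' L.

Definition NP_complete (B : finType) (L : seq B -> Prop) : Prop :=
  in_NP L /\ NP_hard L.

(** * The satisfiability problem of F as a language *)

Inductive token : Type := TRel | TVar | TEqu | TAnd | TNot | TEx | TBit of bool.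

Definition token_code (t : token) : 'I_6 + bool :=
  match t with
  | TRel => inl (inord 0) | TVar => inl (inord 1) | TEqu => inl (inord 2)
  | TAnd => inl (inord 3) | TNot => inl (inord 4) | TEx => inl (inord 5)
  | TBit b => inr b
  end.

Definition token_decode (c : 'I_6 + bool) : token :=
  match c with
  | inl i => nth TRel [:: TRel; TVar; TEqu; TAnd; TNot; TEx] i
  | inr b => TBit b
  end.

Lemma token_codeK : cancel token_code token_decode.
Proof. by case=> //=; rewrite inordK. Qed.

HB.instance Definition _ := Finite.copy token (can_type token_codeK).

Definition encode_var (x : var) : seq token := TVar :: map TBit x.

(** Prefix notation; the arity of a relation symbol is the number of variables
    that follow its name. *)
Fixpoint encode (phi : formula) : seq token :=
  match phi with
  | Rel _ R xs => TRel :: map TBit R ++ flatten (map encode_var xs)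
  | Equ x y => TEqu :: encode_var x ++ encode_var y
  | And phi psi => TAnd :: encode phi ++ encode psi
  | Not phi => TNot :: encode phi
  | Ex x phi => TEx :: encode_var x ++ encode phi
  end.

Definition symbol_head (w : seq token) : bool :=
  if w is (TVar | TBit _) :: _ then false else true.

Lemma encode_head phi u : symbol_head (encode phi ++ u).
Proof. by case: phi. Qed.

Definition nonbit_head (w : seq token) : bool :=
  if w is TBit _ :: _ then false else true.

Lemma symbol_nonbit w : symbol_head w -> nonbit_head w.
Proof. by case: w => [|[]]. Qed.

Lemma bits_cat_inj (a b : seq bool) u v : nonbit_head u -> nonbit_head v ->
  map TBit a ++ u = map TBit b ++ v -> a = b /\ u = v.
Proof.
move=> hu hv; elim: a b => [|x a IH] [|y b] //=.
- by move=> e; rewrite e in hu.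
- by move=> e; rewrite -e in hv.
- by case=> -> /IH [-> ->].
Qed.

Lemma vars_cat_nonbit (s : seq var) u : symbol_head u ->
  nonbit_head (flatten (map encode_var s) ++ u).
Proof. by case: s => //= /symbol_nonbit. Qed.

Lemma vars_cat_inj (s t : seq var) u v : symbol_head u -> symbol_head v ->
  flatten (map encode_var s) ++ u = flatten (map encode_var t) ++ v ->
  s = t /\ u = v.
Proof.
move=> hu hv; elim: s t => [|x s IH] [|y t] //=.
- by move=> e; rewrite e in hu.
- by move=> e; rewrite -e in hv.
- case; rewrite -!catA => /bits_cat_inj [] //; try exact: vars_cat_nonbit.
  by move=> -> /IH [-> ->].
Qed.

Lemma encode_cat_inj phi psi u v : symbol_head u -> symbol_head v ->
  encode phi ++ u = encode psi ++ v -> phi = psi /\ u = v.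
Proof.
elim: phi psi u v => [n R xs|x y|p IHp q IHq|p IHp|x p IHp];
  case=> [m S ys|x' y'|p' q'|p'|x' p'] u v hu hv //= [];
  rewrite -?catA ?cat_cons.
- move=> /bits_cat_inj [||->]; try exact: vars_cat_nonbit.
  move=> /vars_cat_inj [||e ->] //; split=> //.
  have en : n = m by rewrite -(size_tuple xs) e size_tuple.
  by subst m; rewrite (val_inj e : xs = ys).
- move=> /bits_cat_inj [||->] // [].
  by move=> /bits_cat_inj [||-> ->] //; apply: symbol_nonbit.
- move=> /IHp [||-> /IHq [||-> ->]] //; exact: encode_head.
- by move=> /IHp [||-> ->].
- move=> /bits_cat_inj [||->]; try exact/symbol_nonbit/encode_head.
  by move=> /IHp [||-> ->].
Qed.

Lemma encode_inj : injective encode.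
Proof.
by move=> phi psi e; have [] := @encode_cat_inj phi psi [::] [::]; rewrite ?e.
Qed.

Definition F_SAT (w : seq token) : Prop :=
  exists phi : formula, [/\ w = encode phi, fragF phi & satisfiable phi].

(* Main.v *)
Require Import Defs.
From mathcomp Require Import all_boot all_order all_algebra.
From mathcomp Require Import zify boolp.

(** Membership: conjuncts share no free variable, so a quantifier may be moved to
    the one atom below it that has its variable free.  A formula thus becomes a
    Boolean combination of atoms, each under a quantifier prefix of its own and
    with no free variable in common.  After guessing the truth values of these
    prefixed atoms, only the consistency of the resulting set of literals
    matters.  A set of literals holds in a model with one element iff no relation
    symbol occurs with both values and every equation is true.  It holds in some
    larger model iff every equation has the value dictated by its prefix and no
    two literals with the same symbol and opposite values have Skolemized forms
    that unify, which a Herbrand model shows.  Their arguments are universal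
    variables or Skolem functions of universal variables, so that unification
    fails exactly when a class of arguments forced to be equal contains two
    Skolem functions or a strict subterm step lies on a cycle: a matter of
    reachability in a graph.

    Hardness: relation symbols of arity 0 have no free variables, so all of
    propositional logic lies in F, and the tableau of a nondeterministic
    computation can be written down in polynomial time.

    Polynomial time bounds come from a calculus of functions on trees, whose
    prefix codes are processed by structured programs on stacks; such programs
    compile to Turing machines. *)

Set Implicit Arguments.
Unset Strict Implicit.
Unset Printing Implicit Defensive.

(** * Stack machines *)

(** After Skolemization every guessed literal is a unit clause with variables of its own. An
    inconsistent set of unit clauses already contains two that conflict, which is why testing pairs
    suffices. Moving a quantifier through negations is harmless because a Boolean combination is
    monotone or antitone in each atom, according to polarity: a witness has to serve only the one
    atom that has the variable free. Equality would spoil the Herbrand argument, but over two or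
    more elements a quantified equation between distinct variables has a fixed value, and an
    unquantified one has private free variables, whose values can be chosen to realize the guess. In
    a one-element model every equation is true, so such models get a test of their own; the first
    bit of the certificate selects the test. On the machine side the obstacle is growth: iterating a
    polynomial-time function need not stay polynomial, so every loop comes with a bound on its
    intermediate results. For the reader of formulas this needs a separate potential, as one
    quantifier can lengthen the prefixes of many atoms. *)

Section StackMachine.
Variables (I S : finType).

Inductive action := Nop | Pop | Push of S.

Definition act_on (a : action) (s : seq S) : seq S :=
  match a with Nop => s | Pop => behead s | Push x => x :: s end.

Record prog := Prog {
  pstate : finType;
  pstart : pstate;
  ptrans : pstate -> {ffun I -> option S} -> option pstate * (I -> action) }.

Definition stacks := {ffun I -> seq S}.
Implicit Types (p q : prog) (i : I) (h : option S -> bool) (st : stacks).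

Definition tops (st : stacks) : {ffun I -> option S} := [ffun i => ohead (st i)].

Definition apply_acts (a : I -> action) (st : stacks) : stacks :=
  [ffun i => act_on (a i) (st i)].

(* [None] is the exit: a program that has exited no longer moves. *)
Definition pstep (p : prog) (c : option (pstate p) * stacks) :=
  if c.1 is Some q then
    let r := ptrans q (tops c.2) in (r.1, apply_acts r.2 c.2)
  else c.

(** An exited program stays put, so [n] is only an upper bound on the number of steps and may be
    rounded up by [runs_leq]. *)
Definition runs (p : prog) (n : nat) (st st' : stacks) : Prop :=
  iter n (@pstep p) (Some (pstart p), st) = (None, st').

Lemma pstep_some p (q : pstate p) st : @pstep p (Some q, st) =
  ((ptrans q (tops st)).1, apply_acts (ptrans q (tops st)).2 st).
Proof. by []. Qed.

Lemma iter_exit p n st : iter n (@pstep p) (None, st) = (None, st).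
Proof. by elim: n => //= n ->. Qed.

Lemma iterD_exit p n m c st :
  iter n (@pstep p) c = (None, st) -> iter (n + m) (@pstep p) c = (None, st).
Proof. by move=> h; rewrite addnC iterD h iter_exit. Qed.

Lemma runs_leq p n m st st' : n <= m -> runs p n st st' -> runs p m st st'.
Proof. by move=> /subnKC <-; exact: iterD_exit. Qed.

Lemma runs_from p n st0 st st' : runs p n st0 st' -> st0 = st -> runs p n st st'.
Proof. by move=> h <-. Qed.

Definition upd (st : stacks) (i : I) (s : seq S) : stacks :=
  [ffun j => if j == i then s else st j].

Lemma updE (st : stacks) i s j : upd st i s j = if j == i then s else st j.
Proof. by rewrite ffunE. Qed.

Definition pact (i : I) (a : action) : prog :=
  @Prog unit tt (fun _ _ => (None, fun j => if j == i then a else Nop)).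

Lemma runs_act i a (st : stacks) : runs (pact i a) 1 st (upd st i (act_on a (st i))).
Proof.
rewrite /runs /= /pstep /=; congr pair; apply/ffunP=> j; rewrite !ffunE.
by case: eqP => [->|].
Qed.

Definition nowhere : I -> action := fun=> Nop.

Lemma apply_nowhere st : apply_acts nowhere st = st.
Proof. by apply/ffunP=> j; rewrite ffunE. Qed.

Definition pseq (p q : prog) : prog :=
  @Prog (pstate p + pstate q)%type (inl (pstart p))
    (fun s r => match s with
     | inl s => let (o, a) := ptrans s r in
                (Some (if o is Some s' then inl s' else inr (pstart q)), a)
     | inr s => let (o, a) := ptrans s r in (omap inr o, a)
     end).

Lemma runs_seq p q n m st st1 st2 :
  runs p n st st1 -> runs q m st1 st2 -> runs (pseq p q) (n + m) st st2.
Proof.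
move=> hp hq.
(* Inside the second program the composite imitates it step for step. In the first one ([left]
   below) the exit becomes the jump to the start of [q], at no extra step; only [j <= k] is claimed,
   as [p] may exit early. *)
have right k s t : iter k (@pstep (pseq p q)) (omap inr s, t) =
    let c := iter k (@pstep q) (s, t) in (omap inr c.1, c.2).
  elim: k s t => // k IH s t; rewrite !iterS IH /=.
  case: (iter k _ _) => [[s'|] t'] //=.
  by rewrite /pstep /=; case: (ptrans s' _) => o a.
have left k s t : iter k (@pstep p) (Some s, t) = (None, st1) ->
    exists2 j, j <= k &
      iter j (@pstep (pseq p q)) (Some (inl s), t) = (Some (inr (pstart q)), st1).
  elim: k s t => // k IH s t; rewrite iterSr pstep_some; case E: (ptrans s (tops t)) => [[s'|] a] /=.
    case/IH => j hj e; exists j.+1 => //.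
    by rewrite iterSr pstep_some /= E.
  rewrite iter_exit => -[<-]; exists 1 => //=.
  by rewrite /pstep /= E.
have [j hj e] := left _ _ _ hp.
apply: (@runs_leq _ (j + m)); first by rewrite leq_add2r.
rewrite /runs addnC iterD e.
by rewrite (right m (Some (pstart q)) st1) hq.
Qed.

Definition pif (i : I) (h : option S -> bool) (p q : prog) : prog :=
  @Prog (option (pstate p + pstate q)) None
    (fun s r => match s with
     | None => (Some (Some (if h (r i) then inl (pstart p) else inr (pstart q))),
                nowhere)
     | Some (inl s) => let (o, a) := ptrans s r in (omap (Some \o inl) o, a)
     | Some (inr s) => let (o, a) := ptrans s r in (omap (Some \o inr) o, a)
     end).

Lemma runs_if i h p q n (st : stacks) st' :
  runs (if h (ohead (st i)) then p else q) n st st' ->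
  runs (pif i h p q) n.+1 st st'.
Proof.
have leftE k s t : iter k (@pstep (pif i h p q)) (omap (Some \o inl) s, t) =
    let c := iter k (@pstep p) (s, t) in (omap (Some \o inl) c.1, c.2).
  elim: k s t => // k IH s t; rewrite !iterS IH /=.
  case: (iter k _ _) => [[s'|] t'] //=.
  by rewrite /pstep /=; case: (ptrans s' _) => o a.
have rightE k s t : iter k (@pstep (pif i h p q)) (omap (Some \o inr) s, t) =
    let c := iter k (@pstep q) (s, t) in (omap (Some \o inr) c.1, c.2).
  elim: k s t => // k IH s t; rewrite !iterS IH /=.
  case: (iter k _ _) => [[s'|] t'] //=.
  by rewrite /pstep /=; case: (ptrans s' _) => o a.
rewrite /runs iterSr pstep_some /= apply_nowhere ffunE; case: (h _) => e.
  by rewrite (leftE n (Some (pstart p)) st) e.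
by rewrite (rightE n (Some (pstart q)) st) e.
Qed.

Definition pwhile (i : I) (h : option S -> bool) (p : prog) : prog :=
  @Prog (option (pstate p)) None
    (fun s r => match s with
     | None => (if h (r i) then Some (Some (pstart p)) else None, nowhere)
     | Some s => let (o, a) := ptrans s r in (Some o, a)
     end).

Lemma runs_while_stop i h p (st : stacks) :
  ~~ h (ohead (st i)) -> runs (pwhile i h p) 1 st st.
Proof. by rewrite /runs /= pstep_some /= ffunE apply_nowhere; case: (h _). Qed.

Lemma runs_while_step i h p n m (st st1 st2 : stacks) :
  h (ohead (st i)) -> runs p n st st1 -> runs (pwhile i h p) m st1 st2 ->
  runs (pwhile i h p) (n + m).+1 st st2.
Proof.
move=> hi hp hw.
have body k s t : iter k (@pstep p) (Some s, t) = (None, st1) ->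
    exists2 j, j <= k &
      iter j (@pstep (pwhile i h p)) (Some (Some s), t) = (Some None, st1).
  elim: k s t => // k IH s t; rewrite iterSr pstep_some; case E: (ptrans s (tops t)) => [[s'|] a] /=.
    case/IH => j hj e; exists j.+1 => //.
    by rewrite iterSr pstep_some /= E.
  rewrite iter_exit => -[<-]; exists 1 => //=.
  by rewrite /pstep /= E.
have [j hj e] := body _ _ _ hp.
apply: (@runs_leq _ (j + m).+1); first by rewrite ltnS leq_add2r.
by rewrite /runs iterSr pstep_some /= ffunE hi apply_nowhere addnC iterD e.
Qed.

Lemma size_act_on a s : size (act_on a s) <= (size s).+1.
Proof. by case: a => //=; rewrite ?size_behead; lia. Qed.

Lemma runs_size p n (st st' : stacks) i : runs p n st st' -> size (st' i) <= size (st i) + n.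
Proof.
suff h c : size ((iter n (@pstep p) c).2 i) <= size (c.2 i) + n.
  by move=> e; have := h (Some (pstart p), st); rewrite e.
elim: n c => [|n IH] c /=; first by rewrite addn0.
apply: leq_trans (_ : (size ((iter n (@pstep p) c).2 i)).+1 <= _); last first.
  by rewrite addnS ltnS.
case: (iter n _ c) => [[q|] st1]; rewrite /pstep //= ffunE.
exact: size_act_on.
Qed.

End StackMachine.
Arguments Nop {S}.
Arguments Pop {S}.

(** * From stack machines to Turing machines *)

Section Compile.
Variables (A B W : finType) (k : nat).
Local Notation S := (A + B + W : finType)%type.
Local Notation I := 'I_k.+1.
Variable p : prog I S.

(* Every stack grows to the right on its tape, with its bottom in cell 0 and the
   head on its top.  Hence a machine first scans its input.  One step of the
   stack machine takes two steps, as a push must move before it writes: the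
   second component of the state holds the symbols still to be written. *)
Definition tm_state : Type :=
  option (option (pstate p) * option {ffun I -> option S}).

Definition tm_delta (s : tm_state) (r : {ffun I -> option S}) :
    tm_state * {ffun I -> option S * move} :=
  match s with
  | None =>
      if r ord0 is Some _ then
        (None, [ffun t => (r t, if t == ord0 then MoveRight else Stay)])
      else (Some (Some (pstart p), None), [ffun t => (r t, MoveLeft)])
  | Some (o, v) =>
      match v, o with
      | Some v, _ =>
          (Some (o, None), [ffun t => (if v t is Some x then Some x else r t, Stay)])
      | None, Some q =>
          let a := (ptrans q r).2 in
          (Some ((ptrans q r).1,
                 Some [ffun t => if a t is Push x then Some x else None]),
           [ffun t => match a t with
                      | Nop => (r t, Stay)
                      | Pop => (None, if r t is Some _ then MoveLeft else Stay)
                      | Push _ => (r t, MoveRight)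
                      end])
      | None, None => (s, [ffun t => (r t, Stay)])
      end
  end.

Definition tm_of : TM A B :=
  @MkTM A B k (option (option (pstate p) * option {ffun I -> option S}) : finType)
    W None (fun s => s == Some (None, None)) tm_delta.

Definition stack_tape (s : seq S) : int -> option S :=
  @word_tape A B tm_of (map Some (rev s)).

(** An empty stack puts the head on cell -1, which is blank, so that the cell read agrees with
    [ohead] in this case too. *)
Lemma stack_tape_top s : stack_tape s (Posz (size s) - 1)%R = ohead s.
Proof.
case: s => [|x s] //.
have -> : (Posz (size (x :: s)) - 1)%R = size s by rewrite /=; lia.
by rewrite /stack_tape /= rev_cons map_rcons nth_rcons size_map size_rev ltnn eqxx.
Qed.

Lemma stack_tape_push x s i :
  stack_tape (x :: s) i = if i == size s then Some x else stack_tape s i.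
Proof.
rewrite /stack_tape; case: i => [j|j] //=.
rewrite rev_cons map_rcons nth_rcons size_map size_rev.
have -> : (Posz j == Posz (size s)) = (j == size s) by [].
case: ltngtP => // h; by rewrite [in RHS]nth_default // size_map size_rev ltnW.
Qed.

(** The bottom of a stack is cell 0, so the input appears reversed: its last letter is on top. *)
Definition init_stacks (w : seq A) : stacks I S :=
  [ffun i => if i == ord0 then rev (map (inl \o inl) w) else [::]].

Definition simulates (c : config tm_of) (s : tm_state) (st : stacks I S) : Prop :=
  cstate c = s /\ forall t, chead c t = (Posz (size (st t)) - 1)%R /\
                            ctape c t =1 stack_tape (st t).

Lemma step_running (s : tm_state) hd tp : s != Some (None, None) ->
  let r := tm_delta s [ffun t => tp t (hd t)] in
  step (@Config _ _ tm_of s hd tp) =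
  @Config _ _ tm_of r.1 (fun t => move_head (r.2 t).2 (hd t))
    (fun t i => if i == hd t then (r.2 t).1 else tp t i).
Proof. by rewrite /step /= => /negPf ->; case: tm_delta. Qed.

Lemma step_simulates c o st :
  simulates c (Some (o, None)) st ->
  simulates (step (step c)) (Some ((pstep (o, st)).1, None)) (pstep (o, st)).2.
Proof.
case: c => s hd tp [/= -> h]; case: o => [q|]; last by rewrite /step /=.
rewrite step_running //.
have -> : [ffun t => tp t (hd t)] = tops st :> {ffun I -> option S}.
  by apply/ffunP=> t; rewrite !ffunE (proj1 (h t)) (proj2 (h t)) stack_tape_top.
rewrite step_running; last by apply/eqP.
split=> //= t; have [eh et] := h t.
rewrite !ffunE eh; case: ((ptrans q (tops st)).2 t) => [||x] /=.
- split=> // i; rewrite !eqxx et.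
  by case: (i =P _) => [->|_]; rewrite ?stack_tape_top // if_same.
- case E: (st t) => [|x s'] /=; split=> //.
  + move=> i; rewrite !et E; case: (i =P _) => [->|_] //.
  + by lia.
  + move=> i; rewrite !et !E !stack_tape_push /=.
    have -> : (Posz (size s').+1 - 1)%R = size s' by lia.
    have nt : ((Posz (size s') - 1)%R == Posz (size s')) = false by lia.
    rewrite nt; case: (i =P _) => [->|ni]; first by [].
    case: (i =P _) => [->|_] //.
    by rewrite /stack_tape /= nth_default // size_map size_rev.
- split=> [|i]; first by lia.
  rewrite !stack_tape_push.
  have -> : (Posz (size (st t)) - 1 + 1)%R = size (st t) by lia.
  by case: eqP => // _; rewrite et; case: eqP => // ->; rewrite stack_tape_top.
Qed.

Lemma iter_simulates n c o st :
  simulates c (Some (o, None)) st ->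
  simulates (iter (2 * n) (@step _ _ _) c)
    (Some ((iter n (@pstep _ _ p) (o, st)).1, None))
    (iter n (@pstep _ _ p) (o, st)).2.
Proof.
elim: n c o st => [|n IH] c o st h //.
rewrite mulnS addnC iterD [iter 2 _ _]/= iterSr.
case E: (pstep (o, st)) (step_simulates h) => [o' st'].
exact: IH.
Qed.

Lemma scan_input (w : seq A) j : j <= size w ->
  let c := iter j (@step _ _ _) (init tm_of w) in
  [/\ cstate c = None, forall t, chead c t = (if t == ord0 then Posz j else 0%R)
    & forall t, ctape c t =1 stack_tape (init_stacks w t)].
Proof.
elim: j => [|j IH] hj /=.
  split=> // t; first by rewrite if_same.
  move=> i; rewrite /stack_tape ffunE; case: (t == ord0) => //.
  by rewrite revK -map_comp.
have := IH (ltnW hj); case: (iter j _ _) => s hd tp [/= -> h1 h2].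
have [x r0] : exists x, tp ord0 (Posz j) = Some x.
  have a0 : A by case: (w) hj.
  exists (inl (inl (nth a0 w j))); rewrite h2 /stack_tape ffunE eqxx revK /=.
  by rewrite (nth_map (inl (inl a0))) ?size_map // (nth_map a0).
rewrite step_running //= ffunE h1 eqxx r0; split=> //= t.
  by rewrite ffunE h1; case: eqP => //= _; lia.
move=> i; rewrite -h2 !ffunE; by case: eqP => //= ->.
Qed.

Lemma start_simulates (w : seq A) :
  simulates (iter (size w).+1 (@step _ _ _) (init tm_of w))
    (Some (Some (pstart p), None)) (init_stacks w).
Proof.
have := scan_input (leqnn (size w)); rewrite iterS.
case: (iter _ _ _) => s hd tp [/= -> h1 h2].
have r0 : tp ord0 (Posz (size w)) = None.
  by rewrite h2 /stack_tape ffunE /= revK nth_default // !size_map.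
rewrite step_running //= ffunE h1 eqxx r0; split=> //= t.
split; last by move=> i; rewrite -h2 !ffunE; case: eqP => //= ->.
rewrite !ffunE h1; case: eqP => //= _; rewrite size_rev size_map; lia.
Qed.

Lemma tm_of_correct (w : seq A) n st :
  runs p n (init_stacks w) st ->
  let c := iter ((size w).+1 + 2 * n) (@step _ _ _) (init tm_of w) in
  halting (cstate c) /\ forall t, ctape c t =1 stack_tape (st t).
Proof.
move=> h; rewrite addnC iterD.
have := iter_simulates n (start_simulates w); rewrite h => -[e hc].
by split=> [|t]; [rewrite /= e | case: (hc t)].
Qed.

End Compile.

(** * Polynomial bounds *)

(** The base is at least 2, so that raising the exponent absorbs constants and sums as well as
    products. *)
Definition polyb (b : nat -> nat) : Prop := exists k, forall n, b n <= (n + 2) ^ k.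

Lemma polyb_leq b b' : (forall n, b n <= b' n) -> polyb b' -> polyb b.
Proof. by move=> h [k hk]; exists k => n; apply: leq_trans (h n) (hk n). Qed.

Lemma polyb_const c : polyb (fun=> c).
Proof.
exists c => n; apply: leq_trans (ltnW (ltn_expl c (ltnSn 1))) _.
by case: c => // c; rewrite leq_exp2r // leq_addl.
Qed.

Lemma polyb_id : polyb id.
Proof. by exists 1 => n; rewrite expn1 leq_addr. Qed.

Lemma polyb_mul b1 b2 : polyb b1 -> polyb b2 -> polyb (fun n => b1 n * b2 n).
Proof. by case=> [k h] [l h']; exists (k + l) => n; rewrite expnD leq_mul. Qed.

Lemma polyb_add b1 b2 : polyb b1 -> polyb b2 -> polyb (fun n => b1 n + b2 n).
Proof.
move=> h1 h2; apply: (@polyb_leq _ (fun n => (b1 n + 1) * (b2 n + 1))) => [n|].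
  by nia.
have h b : polyb b -> polyb (fun n => b n + 1).
  case=> k hk; exists k.+1 => n; rewrite expnS.
  have : 0 < (n + 2) ^ k by rewrite expn_gt0 addn2.
  by have := hk n; nia.
by apply: polyb_mul; apply: h.
Qed.

Lemma polyb_exp b k : polyb b -> polyb (fun n => b n ^ k).
Proof.
move=> h; elim: k => [|k IH]; first exact: (polyb_const 1).
by apply: polyb_leq (polyb_mul h IH) => n; rewrite expnS.
Qed.

Lemma polyb_pow b k : polyb b -> polyb (fun n => (b n + 2) ^ k).
Proof. by move=> h; apply/polyb_exp/polyb_add/polyb_const. Qed.

Lemma polyb_S b : polyb b -> polyb (fun n => (b n).+1).
Proof.
by move=> h; apply: polyb_leq (polyb_add h (polyb_const 1)) => n; rewrite addn1.
Qed.

Ltac polyb := repeat (first [ assumption | exact: polyb_id | exact: polyb_const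
  | apply: polyb_add | apply: polyb_mul | apply: polyb_pow | apply: polyb_exp
  | apply: polyb_S ]).

(** * Trees as prefix codes on stacks *)

Inductive tree := Leaf | Node (l r : tree).

Fixpoint enc (t : tree) : seq bool :=
  if t is Node l r then true :: enc l ++ enc r else [:: false].

Definition tsize (t : tree) : nat := size (enc t).

Section Forth.
Variables A B : finType.
Definition sym : finType := (A + B + option bool : finType)%type.
Local Notation prog := (prog 'I_6 sym).

Definition bit (b : bool) : sym := inr (Some b).
Definition mark : sym := inr None.

(** The main stack [iM] carries arguments and results; trees are parked on [iA] and [iB], and [iC]
    counts subtrees. The first and the last stack are fixed by the convention for input and output
    tapes. *)
Definition iIn : 'I_6 := ord0.
Definition iM : 'I_6 := @Ordinal 6 1 isT.
Definition iA : 'I_6 := @Ordinal 6 2 isT.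
Definition iB : 'I_6 := @Ordinal 6 3 isT.
Definition iC : 'I_6 := @Ordinal 6 4 isT.
Definition iOut : 'I_6 := ord_max.

Definition T (t : tree) : seq sym := map bit (enc t).

Lemma T_node l r : T (Node l r) = bit true :: T l ++ T r.
Proof. by rewrite /T /= map_cat. Qed.
Lemma size_T t : size (T t) = tsize t.
Proof. by rewrite size_map. Qed.

Definition is_bit (b : bool) (o : option sym) : bool := o == Some (bit b).
Definition not_mark (o : option sym) : bool := o != Some mark.

Definition pmove (i j : 'I_6) : prog :=
  @Prog _ _ unit tt (fun _ r => (None, fun l =>
    if l == i then Pop else
    if l == j then (if r i is Some x then Push x else Nop) else Nop)).

Lemma runs_move i j (st : stacks 'I_6 sym) x r : i != j -> st i = x :: r ->
  runs (pmove i j) 1 st (upd (upd st i r) j (x :: st j)).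
Proof.
move=> nij e; rewrite /runs /= pstep_some /=; congr pair.
apply/ffunP=> l; rewrite !ffunE e /=.
case: (l =P i) => [->|_]; first by rewrite (negPf nij) e.
by case: eqP => [->|].
Qed.

Definition pxfer (i j : 'I_6) : prog := pwhile i not_mark (pmove i j).

Lemma runs_xfer i j (st : stacks 'I_6 sym) s r : i != j ->
  st i = map bit s ++ mark :: r ->
  runs (pxfer i j) (2 * size s).+1 st
    (upd (upd st i (mark :: r)) j (rev (map bit s) ++ st j)).
Proof.
move=> nij; elim: s st => [|x s IH] st e.
  have -> : upd (upd st i (mark :: r)) j (rev (map bit [::]) ++ st j) = st.
    apply/ffunP=> l; rewrite !ffunE /=.
    by case: (l =P j) => [->|_] //; case: (l =P i) => [->|].
  by apply: runs_while_stop; rewrite e.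
have -> : (2 * size (x :: s)).+1 = (1 + (2 * size s).+1).+1 by rewrite /=; lia.
apply: runs_while_step; [by rewrite e | exact: runs_move e |].
have e1 : upd (upd st i (map bit s ++ mark :: r)) j (bit x :: st j) i =
          map bit s ++ mark :: r by rewrite !ffunE (negPf nij) eqxx.
suff -> : upd (upd st i (mark :: r)) j (rev (map bit (x :: s)) ++ st j) =
    upd (upd (upd (upd st i (map bit s ++ mark :: r)) j (bit x :: st j)) i
         (mark :: r)) j
      (rev (map bit s) ++ (upd (upd st i (map bit s ++ mark :: r)) j
                            (bit x :: st j)) j) by exact: IH.
apply/ffunP=> l; rewrite !ffunE eqxx /= rev_cons cat_rcons.
by case: (l =P j) => // _; case: (l =P i).
Qed.

(* The counter stack holds one [bit true] per subtree still to be moved. *)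
Definition pmtree_loop (i j : 'I_6) : prog :=
  pwhile iC (is_bit true)
    (pseq (pif i (is_bit true) (pact iC (Push (bit true))) (pact iC Pop))
          (pmove i j)).

Definition moved (i j : 'I_6) (ri rc : seq sym) (w : seq sym)
    (st st1 : stacks 'I_6 sym) : Prop :=
  [/\ st1 i = ri, st1 iC = rc, st1 j = w ++ st j
    & forall l, l != i -> l != iC -> l != j -> st1 l = st l].

Lemma moved_uniq i j ri rc w st st1 st2 :
  moved i j ri rc w st st1 -> moved i j ri rc w st st2 -> st1 = st2.
Proof.
case=> a1 a2 a3 a4 [b1 b2 b3 b4]; apply/ffunP=> l.
have [->|ni] := eqVneq l i; first by rewrite a1 b1.
have [->|nc] := eqVneq l iC; first by rewrite a2 b2.
have [->|nj] := eqVneq l j; first by rewrite a3 b3.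
by rewrite a4 // b4.
Qed.

Lemma moved_upd i j ri rc w st : i != j -> i != iC -> j != iC ->
  moved i j ri rc w st (upd (upd (upd st i ri) iC rc) j (w ++ st j)).
Proof.
move=> nij nic njc; split=> [|||l ni nc nj]; rewrite !updE.
- by rewrite (negPf nij) (negPf nic) eqxx.
- by rewrite eq_sym (negPf njc) eqxx.
- by rewrite eqxx.
- by rewrite (negPf ni) (negPf nc) (negPf nj).
Qed.

Lemma moved_trans i j ri rc w w' ri' rc' st st1 st2 :
  moved i j ri rc w st st1 -> moved i j ri' rc' w' st1 st2 ->
  moved i j ri' rc' (w' ++ w) st st2.
Proof.
case=> a1 a2 a3 a4 [b1 b2 b3 b4]; split=> // [|l ni nc nj].
  by rewrite b3 a3 catA.
by rewrite b4 ?a4.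
Qed.

Lemma runs_mtree_loop i j t (st st1 st' : stacks 'I_6 sym) n r c :
  i != j -> i != iC -> j != iC ->
  st i = T t ++ r -> st iC = bit true :: c ->
  moved i j r c (rev (T t)) st st1 ->
  runs (pmtree_loop i j) n st1 st' ->
  runs (pmtree_loop i j) (n + 4 * tsize t) st st'.
Proof.
move=> nij nic njc.
have body b r0 c0 c1 (st0 : stacks 'I_6 sym) : st0 i = bit b :: r0 ->
    st0 iC = bit true :: c0 -> c1 = (if b then [:: bit true, bit true & c0] else c0) ->
    exists2 st2, moved i j r0 c1 [:: bit b] st0 st2 &
    forall m st3, runs (pmtree_loop i j) m st2 st3 ->
      runs (pmtree_loop i j) (m + 4) st0 st3.
  move=> ei ec ec1; eexists; first exact: moved_upd.
  move=> m st3 h; rewrite [m + _](_ : _ = ((1 + 1).+1 + m).+1); last by lia.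
  apply: runs_while_step; [by rewrite ec | | exact: h].
  apply: (@runs_from _ _ _ _ st0) => //.
  apply: (@runs_seq _ _ _ _ (1.+1) 1 _ (upd st0 iC c1)).
    apply: runs_if; rewrite ei {}ec1; case: (b).
      by have := runs_act iC (Push (bit true)) st0; rewrite ec.
    by have := runs_act iC Pop st0; rewrite ec.
  have -> : upd (upd (upd st0 i r0) iC c1) j ([:: bit b] ++ st0 j) =
      upd (upd (upd st0 iC c1) i r0) j (bit b :: (upd st0 iC c1) j).
    apply/ffunP=> l; rewrite !updE (negPf njc).
    by case: (l =P j) => // _; case: (l =P i) => [->|] //; rewrite (negPf nic).
  by apply: runs_move; rewrite // updE (negPf nic).
elim: t st st1 st' n r c => [|t1 IH1 t2 IH2] st st1 st' n r c ei ec mv h.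
  have [st2 mv2] := body false _ _ _ _ ei ec erefl.
  by apply; rewrite (moved_uniq mv2 mv).
rewrite T_node /= -catA in ei.
have [st2 mv2 run2] := body true _ _ _ _ ei ec erefl.
rewrite [n + _](_ : _ = n + 4 * tsize t2 + 4 * tsize t1 + 4); last first.
  by rewrite /tsize /= size_cat; lia.
apply: run2; have [e1 e2 _ _] := mv2.
have mv3 := moved_upd (T t2 ++ r) (bit true :: c) (rev (T t1)) st2 nij nic njc.
apply: (IH1 _ _ _ _ _ _ e1 e2 mv3); move: (upd _ _ _) mv3 => st3 mv3.
have [e3 e4 _ _] := mv3.
have mv4 := moved_upd r c (rev (T t2)) st3 nij nic njc.
apply: (IH2 _ _ _ _ _ _ e3 e4 mv4); move: (upd _ _ _) mv4 => st4 mv4.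
suff -> : st4 = st1 by [].
apply: moved_uniq mv; have := moved_trans mv2 (moved_trans mv3 mv4).
by rewrite T_node rev_cons rev_cat -cats1 -!catA.
Qed.

Definition mk (i m a b c o : seq sym) : stacks 'I_6 sym :=
  [ffun j : 'I_6 => nth [::] [:: i; m; a; b; c; o] j].

Lemma mk_upd i m a b c o x :
  (upd (mk i m a b c o) iIn x = mk x m a b c o) *
  (upd (mk i m a b c o) iM x = mk i x a b c o) *
  (upd (mk i m a b c o) iA x = mk i m x b c o) *
  (upd (mk i m a b c o) iB x = mk i m a x c o) *
  (upd (mk i m a b c o) iC x = mk i m a b x o) *
  (upd (mk i m a b c o) iOut x = mk i m a b c x).
Proof.
by do !split; apply/ffunP=> -[l hl]; rewrite !ffunE; do 6?[case: l hl => [|l] hl //].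
Qed.

Lemma mk_get i m a b c o :
  (mk i m a b c o iIn = i) * (mk i m a b c o iM = m) * (mk i m a b c o iA = a) *
  (mk i m a b c o iB = b) * (mk i m a b c o iC = c) * (mk i m a b c o iOut = o).
Proof. by do !split; rewrite ffunE. Qed.

(** The mark on stack [j] tells [prest] where the saved tree ends; the mark on [iC] stops the
    counting loop above whatever lies below it. *)
Definition psave (j : 'I_6) : prog :=
  pseq (pact j (Push mark))
 (pseq (pact iC (Push mark))
 (pseq (pact iC (Push (bit true)))
 (pseq (pmtree_loop iM j) (pact iC Pop)))).

Definition prest (j : 'I_6) : prog := pseq (pxfer j iM) (pact j Pop).

Lemma runs_act_mk i m a b c o (x : action sym) :
  runs (pact iM x) 1 (mk i m a b c o) (mk i (act_on x m) a b c o) /\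
  runs (pact iA x) 1 (mk i m a b c o) (mk i m (act_on x a) b c o) /\
  runs (pact iB x) 1 (mk i m a b c o) (mk i m a (act_on x b) c o) /\
  runs (pact iC x) 1 (mk i m a b c o) (mk i m a b (act_on x c) o) /\
  runs (pact iIn x) 1 (mk i m a b c o) (mk (act_on x i) m a b c o) /\
  runs (pact iOut x) 1 (mk i m a b c o) (mk i m a b c (act_on x o)).
Proof.
do !split.
- by have := runs_act iM x (mk i m a b c o); rewrite mk_upd mk_get.
- by have := runs_act iA x (mk i m a b c o); rewrite mk_upd mk_get.
- by have := runs_act iB x (mk i m a b c o); rewrite mk_upd mk_get.
- by have := runs_act iC x (mk i m a b c o); rewrite mk_upd mk_get.
- by have := runs_act iIn x (mk i m a b c o); rewrite mk_upd mk_get.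
- by have := runs_act iOut x (mk i m a b c o); rewrite mk_upd mk_get.
Qed.

Lemma actM i m a b c o (x : action sym) :
  runs (pact iM x) 1 (mk i m a b c o) (mk i (act_on x m) a b c o).
Proof. by case: (runs_act_mk i m a b c o x). Qed.
Lemma actA i m a b c o (x : action sym) :
  runs (pact iA x) 1 (mk i m a b c o) (mk i m (act_on x a) b c o).
Proof. by case: (runs_act_mk i m a b c o x) => ? []. Qed.
Lemma actB i m a b c o (x : action sym) :
  runs (pact iB x) 1 (mk i m a b c o) (mk i m a (act_on x b) c o).
Proof. by case: (runs_act_mk i m a b c o x) => ? [? []]. Qed.
Lemma actC i m a b c o (x : action sym) :
  runs (pact iC x) 1 (mk i m a b c o) (mk i m a b (act_on x c) o).
Proof. by case: (runs_act_mk i m a b c o x) => ? [? [? []]]. Qed.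
Lemma actIn i m a b c o (x : action sym) :
  runs (pact iIn x) 1 (mk i m a b c o) (mk (act_on x i) m a b c o).
Proof. by case: (runs_act_mk i m a b c o x) => ? [? [? [? []]]]. Qed.
Lemma actOut i m a b c o (x : action sym) :
  runs (pact iOut x) 1 (mk i m a b c o) (mk i m a b c (act_on x o)).
Proof. by case: (runs_act_mk i m a b c o x) => ? [? [? [? []]]]. Qed.

Lemma runs_saveA t i m a b c o : runs (psave iA) (4 * tsize t + 5)
  (mk i (T t ++ m) a b c o) (mk i m (rev (T t) ++ mark :: a) b c o).
Proof.
rewrite [_ + 5](_ : _ = 1 + (1 + (1 + (1 + 4 * tsize t + 1)))); last by lia.
apply: runs_seq (actA _ _ _ _ _ _ _) _; apply: runs_seq (actC _ _ _ _ _ _ _) _.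
apply: runs_seq (actC _ _ _ _ _ _ _) _; rewrite [act_on _ c]/= /act_on.
apply: (@runs_seq _ _ _ _ _ _ _ (mk i m (rev (T t) ++ mark :: a) b (mark :: c) o)); last exact: actC.
apply: (@runs_mtree_loop iM iA t _ (mk i m (rev (T t) ++ mark :: a) b (mark :: c) o)
  _ _ m (mark :: c)) => //; rewrite ?mk_get //.
  by split; rewrite ?mk_get // => -[l hl]; rewrite !ffunE; do 6?[case: l hl => [|l] hl //].
by apply: runs_while_stop; rewrite mk_get.
Qed.

Lemma runs_saveB t i m a b c o : runs (psave iB) (4 * tsize t + 5)
  (mk i (T t ++ m) a b c o) (mk i m a (rev (T t) ++ mark :: b) c o).
Proof.
rewrite [_ + 5](_ : _ = 1 + (1 + (1 + (1 + 4 * tsize t + 1)))); last by lia.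
apply: runs_seq (actB _ _ _ _ _ _ _) _; apply: runs_seq (actC _ _ _ _ _ _ _) _.
apply: runs_seq (actC _ _ _ _ _ _ _) _; rewrite [act_on _ c]/= /act_on.
apply: (@runs_seq _ _ _ _ _ _ _ (mk i m a (rev (T t) ++ mark :: b) (mark :: c) o)); last exact: actC.
apply: (@runs_mtree_loop iM iB t _ (mk i m a (rev (T t) ++ mark :: b) (mark :: c) o)
  _ _ m (mark :: c)) => //; rewrite ?mk_get //.
  by split; rewrite ?mk_get // => -[l hl]; rewrite !ffunE; do 6?[case: l hl => [|l] hl //].
by apply: runs_while_stop; rewrite mk_get.
Qed.

Lemma runs_restA t i m a b c o : runs (prest iA) (2 * tsize t + 2)
  (mk i m (rev (T t) ++ mark :: a) b c o) (mk i (T t ++ m) a b c o).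
Proof.
rewrite [_ + 2](_ : _ = (2 * size (rev (enc t))).+1 + 1); last by rewrite size_rev /tsize; lia.
apply: runs_seq; last exact: (actA _ _ (mark :: a) _ _ _ Pop).
have := @runs_xfer iA iM (mk i m (rev (T t) ++ mark :: a) b c o) (rev (enc t)) a isT.
by rewrite !mk_upd !mk_get map_rev revK; apply.
Qed.

Lemma runs_restB t i m a b c o : runs (prest iB) (2 * tsize t + 2)
  (mk i m a (rev (T t) ++ mark :: b) c o) (mk i (T t ++ m) a b c o).
Proof.
rewrite [_ + 2](_ : _ = (2 * size (rev (enc t))).+1 + 1); last by rewrite size_rev /tsize; lia.
apply: runs_seq; last exact: (actB _ _ _ (mark :: b) _ _ Pop).
have := @runs_xfer iB iM (mk i m a (rev (T t) ++ mark :: b) c o) (rev (enc t)) b isT.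
by rewrite !mk_upd !mk_get map_rev revK; apply.
Qed.

(* [p] turns the top part [x] of the main stack into [y] and leaves everything
   else as it was. *)
Definition CR (p : prog) (n : nat) (x y : seq sym) : Prop :=
  forall i m a b c o, runs p n (mk i (x ++ m) a b c o) (mk i (y ++ m) a b c o).

Lemma CR_leq p n n' x y : n <= n' -> CR p n x y -> CR p n' x y.
Proof. by move=> h hp i m a b c o; apply: runs_leq h _. Qed.

Lemma CR_seq p q n n' x y z : CR p n x y -> CR q n' y z -> CR (pseq p q) (n + n') x z.
Proof. by move=> hp hq i m a b c o; apply: runs_seq (hp _ _ _ _ _ _) (hq _ _ _ _ _ _). Qed.

Lemma CR_frame p n x y u : CR p n x y -> CR p n (x ++ u) (y ++ u).
Proof. by move=> h i m a b c o; rewrite -!catA. Qed.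

Lemma CR_push b : CR (pact iM (Push (bit b))) 1 [::] [:: bit b].
Proof. by move=> i m a b' c o; apply: actM. Qed.

Lemma CR_pop b : CR (pact iM Pop) 1 [:: bit b] [::].
Proof. by move=> i m a b' c o; apply: (actM _ (bit b :: m)). Qed.

(** The [dip] combinator of concatenative languages: [p] acts below the top tree. *)
Definition pdip (p : prog) : prog := pseq (psave iA) (pseq p (prest iA)).

Lemma CR_dip p n t x y : CR p n x y ->
  CR (pdip p) (n + 7 * (tsize t + 1)) (T t ++ x) (T t ++ y).
Proof.
move=> h; apply: (@CR_leq _ ((4 * tsize t + 5) + (n + (2 * tsize t + 2)))); first by lia.
move=> i m a b c o; rewrite -!catA; apply: runs_seq (runs_saveA _ _ _ _ _ _ _) _.
exact: runs_seq (h _ _ _ _ _ _) (runs_restA _ _ _ _ _ _ _).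
Qed.

Definition pswap : prog :=
  pseq (psave iA) (pseq (psave iB) (pseq (prest iA) (prest iB))).

Lemma CR_swap t u : CR pswap (14 * (tsize t + tsize u + 1)) (T t ++ T u) (T u ++ T t).
Proof.
apply: (@CR_leq _ ((4 * tsize t + 5) + ((4 * tsize u + 5) + ((2 * tsize t + 2) + (2 * tsize u + 2)))));
  first by lia.
move=> i m a b c o; rewrite -!catA; apply: runs_seq (runs_saveA _ _ _ _ _ _ _) _.
apply: runs_seq (runs_saveB _ _ _ _ _ _ _) _.
exact: runs_seq (runs_restA _ _ _ _ _ _ _) (runs_restB _ _ _ _ _ _ _).
Qed.

Definition pdrop : prog :=
  pseq (psave iA) (pseq (pwhile iA not_mark (pact iA Pop)) (pact iA Pop)).

Lemma CR_drop t : CR pdrop (7 * (tsize t + 1)) (T t) [::].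
Proof.
apply: (@CR_leq _ ((4 * tsize t + 5) + ((2 * size (rev (enc t))).+1 + 1))).
  by rewrite size_rev -/(tsize t); lia.
move=> i m a b c o; apply: runs_seq (runs_saveA _ _ _ _ _ _ _) _.
apply: runs_seq; last exact: (actA _ _ (mark :: a) _ _ _ Pop).
rewrite /T -map_rev; elim: (rev _) => [|x s IH].
  by apply: runs_while_stop; rewrite mk_get.
rewrite [(2 * _).+1](_ : _ = (1 + (2 * size s).+1).+1); last by rewrite /=; lia.
apply: runs_while_step IH; first by rewrite mk_get.
exact: (actA _ _ (bit x :: map bit s ++ mark :: a)).
Qed.

Definition pcopy : prog :=
  @Prog _ _ unit tt (fun _ r => (None, fun l =>
    if l == iA then Pop else
    if (l == iM) || (l == iB) then (if r iA is Some x then Push x else Nop)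
    else Nop)).

Definition pdup : prog :=
  pseq (psave iA)
 (pseq (pact iB (Push mark))
 (pseq (pwhile iA not_mark pcopy)
 (pseq (pact iA Pop)
 (pseq (pact iA (Push mark))
 (pseq (pxfer iB iA) (pseq (pact iB Pop) (prest iA))))))).

Lemma CR_dup t : CR pdup (14 * (tsize t + 1)) (T t) (T t ++ T t).
Proof.
apply: (@CR_leq _ ((4 * tsize t + 5) + (1 + ((2 * size (rev (enc t))).+1 + (1 + (1 +
   ((2 * size (enc t)).+1 + (1 + (2 * tsize t + 2))))))))).
  by rewrite size_rev -/(tsize t); lia.
move=> i m a b c o; apply: runs_seq (runs_saveA _ _ _ _ _ _ _) _.
apply: runs_seq (actB _ _ _ _ _ _ _) _.
apply: (@runs_seq _ _ _ _ _ _ _ (mk i (T t ++ m) (mark :: a) (T t ++ mark :: b) c o)).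
  suff h s m' b' : runs (pwhile iA not_mark pcopy) (2 * size s).+1
      (mk i m' (map bit s ++ mark :: a) b' c o)
      (mk i (rev (map bit s) ++ m') (mark :: a) (rev (map bit s) ++ b') c o).
    by have := h (rev (enc t)) m (mark :: b); rewrite map_rev revK.
  elim: s m' b' => [|x s IH] m' b'; first by apply: runs_while_stop; rewrite mk_get.
  rewrite [(2 * _).+1](_ : _ = (1 + (2 * size s).+1).+1); last by rewrite /=; lia.
  rewrite /= rev_cons !cat_rcons.
  apply: runs_while_step (IH (bit x :: m') (bit x :: b')); first by rewrite mk_get.
  rewrite /runs /= pstep_some /=; congr pair.
  by apply/ffunP=> -[l hl]; rewrite !ffunE; do 6?[case: l hl => [|l] hl //].
apply: runs_seq (actA _ _ (mark :: a) _ _ _ Pop) _.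
apply: runs_seq (actA _ _ a _ _ _ (Push mark)) _.
apply: (@runs_seq _ _ _ _ _ _ _ (mk i (T t ++ m) (rev (T t) ++ mark :: a) (mark :: b) c o)).
  have := @runs_xfer iB iA (mk i (T t ++ m) (mark :: a) (T t ++ mark :: b) c o) (enc t) b isT.
  by rewrite !mk_upd !mk_get; apply.
apply: runs_seq (actB _ _ _ (mark :: b) _ _ Pop) _.
by rewrite -catA; exact: runs_restA.
Qed.

Lemma CR_if p q n bt x y : CR (if bt then p else q) n (bit bt :: x) y ->
  CR (pif iM (is_bit true) p q) n.+1 (bit bt :: x) y.
Proof.
move=> h i m a b c o; apply: runs_if; rewrite mk_get.
by have := h i m a b c o; case: bt h.
Qed.

Lemma CR_while_stop p x : CR (pwhile iM (is_bit true) p) 1 (bit false :: x) (bit false :: x).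
Proof. by move=> i m a b c o; apply: runs_while_stop; rewrite mk_get. Qed.

Lemma CR_while_step p n n' x y z : CR p n (bit true :: x) y ->
  CR (pwhile iM (is_bit true) p) n' y z ->
  CR (pwhile iM (is_bit true) p) (n + n').+1 (bit true :: x) z.
Proof.
move=> h hw i m a b c o.
by apply: runs_while_step (h _ _ _ _ _ _) (hw _ _ _ _ _ _); rewrite mk_get.
Qed.

(** A step pushes at most one symbol on a stack, so a time bound is also a bound on the size of the
    result. This is what makes compositions polynomial. *)
Lemma CR_size p n x y : CR p n x y -> size y <= size x + n.
Proof.
move=> h; have := runs_size iM (h [::] [::] [::] [::] [::] [::]).
by rewrite !mk_get !cats0.
Qed.

End Forth.

(** * Functions computable in polynomial time *)

Lemma leq_expl m n e : m <= n -> m ^ e <= n ^ e.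
Proof. by case: e => // e h; rewrite leq_exp2r. Qed.

Lemma tsize_node l r : tsize (Node l r) = (tsize l + tsize r).+1.
Proof. by rewrite /tsize /= size_cat. Qed.

Lemma tsize_gt0 t : 0 < tsize t.
Proof. by case: t. Qed.

Class codable (X : Type) := code : X -> tree.
Arguments code {X _} x.

(** The codes coincide wherever possible: [x :: s] is coded as the pair [(x, s)], [Some x] as
    [[:: x]], a number as a list of units, and [true] as [1]. Many operations are then mere
    recodings, at no cost ([pt_recode]). *)
#[export] Instance code_unit : codable unit := fun=> Leaf.
#[export] Instance code_bool : codable bool :=
  fun b => if b then Node Leaf Leaf else Leaf.
#[export] Instance code_nat : codable nat := fun n => iter n (Node Leaf) Leaf.
#[export] Instance code_prod X Y {cX : codable X} {cY : codable Y} :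
  codable (X * Y) := fun p => Node (code p.1) (code p.2).
#[export] Instance code_seq X {cX : codable X} : codable (seq X) :=
  foldr (fun x t => Node (code x) t) Leaf.
#[export] Instance code_option X {cX : codable X} : codable (option X) :=
  fun o => if o is Some x then Node (code x) Leaf else Leaf.

Notation csize x := (tsize (code x)).

Section CodeSize.
Context {X Y : Type} {cX : codable X} {cY : codable Y}.

Lemma csize_pair (x : X) (y : Y) : csize (x, y) = (csize x + csize y).+1.
Proof. exact: tsize_node. Qed.

Lemma csize_cons (x : X) s : csize (x :: s) = (csize x + csize s).+1.
Proof. exact: tsize_node. Qed.

Lemma csize_nil : csize (@nil X) = 1. Proof. by []. Qed.

Lemma csize_cat (s t : seq X) : csize (s ++ t) + 1 = csize s + csize t.
Proof.
elim: s => [|x s IH]; first by rewrite csize_nil addnC.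
by rewrite cat_cons !csize_cons; lia.
Qed.

Lemma size_csize (s : seq X) : size s < csize s.
Proof.
by elim: s => //= x s; rewrite csize_cons; have := tsize_gt0 (code x); lia.
Qed.

Lemma csize_drop (s : seq X) i : csize (drop i s) <= csize s.
Proof.
elim: s i => [|y s IH] [|i] //=; rewrite csize_cons.
by have := IH i; lia.
Qed.

End CodeSize.

Lemma csize_nat (n : nat) : csize n = (2 * n).+1.
Proof.
elim: n => // n IH; rewrite -[code n.+1]/(Node Leaf (code n)) tsize_node IH.
by rewrite (_ : tsize Leaf = 1) //; lia.
Qed.

Section PT.
Variables A B : finType.
Local Notation CR := (@CR A B).

Definition PT {X Y} {cX : codable X} {cY : codable Y} (f : X -> Y) : Prop :=
  exists p k, forall x, CR p ((csize x + 2) ^ k) (T A B (code x)) (T A B (code (f x))).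

Section Closure.
Context {X Y Z : Type} {cX : codable X} {cY : codable Y} {cZ : codable Z}.

Lemma pt_intro (f : X -> Y) p b : polyb b ->
  (forall x, CR p (b (csize x)) (T A B (code x)) (T A B (code (f x)))) -> PT f.
Proof.
case=> k hk h; exists p, k => x; apply: CR_leq (hk _) _; exact: h.
Qed.

Lemma pt_size (f : X -> Y) : PT f ->
  exists2 b, polyb b & forall x, csize (f x) <= b (csize x).
Proof.
case=> p [k h]; exists (fun n => n + (n + 2) ^ k); first by polyb.
by move=> x; have := CR_size (h x); rewrite !size_T.
Qed.

Lemma pt_id : PT (@id X).
Proof.
exists (pact iM Nop), 0 => x i m a b c o; exact: (actM _ _ _ _ _ _ Nop).
Qed.

Lemma pt_recode (f : X -> Y) (g : X -> Z) :
  (forall x, code (f x) = code (g x)) -> PT f -> PT g.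
Proof. by move=> e [p [k h]]; exists p, k => x; rewrite -e. Qed.

Lemma pt_ext (f g : X -> Y) : f =1 g -> PT f -> PT g.
Proof. by move=> e [p [k h]]; exists p, k => x; rewrite -e. Qed.

End Closure.

Lemma pt_comp X Y Z {cX : codable X} {cY : codable Y} {cZ : codable Z}
    (g : Y -> Z) (f : X -> Y) : PT g -> PT f -> PT (fun x => g (f x)).
Proof.
move=> [q [l hq]] hf; have [b pb hb] := pt_size hf; case: hf => p [k hp].
apply: (@pt_intro _ _ _ _ _ (pseq p q) (fun n => (n + 2) ^ k + (b n + 2) ^ l)).
  by polyb.
move=> x; apply: CR_seq; first exact: (hp x).
apply: CR_leq (hq _).
by apply: leq_expl; rewrite leq_add2r.
Qed.

Fixpoint ppush (w : seq bool) : prog 'I_6 (sym A B) :=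
  if w is b :: w' then pseq (ppush w') (pact iM (Push (bit A B b)))
  else pact iM Nop.

Lemma CR_ppush w : CR (ppush w) (size w).+1 [::] (map (bit A B) w).
Proof.
elim: w => [|b w IH]; first by move=> i m a b c o; exact: (actM _ _ _ _ _ _ Nop).
rewrite -[(size (b :: w)).+1]addn1; apply: CR_seq IH _ => i m a c d o.
exact: actM.
Qed.

Section Closure2.
Context {X Y Z : Type} {cX : codable X} {cY : codable Y} {cZ : codable Z}.

Lemma pt_const (y : Y) : PT (fun _ : X => y).
Proof.
apply: (@pt_intro _ _ _ _ _ (pseq (pdrop A B) (ppush (enc (code y))))
         (fun n => 7 * (n + 1) + (csize y).+1)); first by polyb.
by move=> x; apply: CR_seq; [exact: (CR_drop _) | exact: CR_ppush].
Qed.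

Lemma pt_pair (f : X -> Y) (g : X -> Z) : PT f -> PT g -> PT (fun x => (f x, g x)).
Proof.
move=> [p [k hp]] hg; have [b pb hb] := pt_size hg; case: hg => q [l hq].
apply: (@pt_intro _ _ _ _ _ (pseq (pdup A B) (pseq q (pseq (pswap A B) (pseq p
         (pact iM (Push (bit A B true)))))))
  (fun n => 14 * (n + 1) + ((n + 2) ^ l + (14 * (n + b n + 1) + ((n + 2) ^ k + 1))))).
  by polyb.
move=> x; apply: CR_seq; first exact: (CR_dup (code x)).
apply: CR_seq; first exact: (CR_frame (T A B (code x)) (hq x)).
apply: CR_seq.
  apply: CR_leq (CR_swap (code (g x)) (code x)).
  by have := hb x; lia.
apply: CR_seq; first exact: (CR_frame (T A B (code (g x))) (hp x)).
rewrite T_node; exact: CR_frame (CR_push _).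
Qed.

Lemma pt_fst : PT (@fst X Y).
Proof.
apply: (@pt_intro _ _ _ _ _ (pseq (pact iM Pop) (pdip (pdrop A B)))
   (fun n => 1 + (7 * (n + 1) + 7 * (n + 1)))); first by polyb.
case=> x y; rewrite [code (x, y)]/(code _) /= T_node.
apply: CR_seq; first exact: (CR_frame _ (CR_pop true)).
have := CR_dip (@code _ cX x) (CR_drop (A := A) (B := B) (@code _ cY y)).
rewrite cats0.
by apply: CR_leq; rewrite tsize_node /=; lia.
Qed.

Lemma pt_snd : PT (@snd X Y).
Proof.
apply: (@pt_intro _ _ _ _ _ (pseq (pact iM Pop) (pdrop A B))
   (fun n => 1 + 7 * (n + 1))); first by polyb.
case=> x y; rewrite [code (x, y)]/(code _) /= T_node.
apply: CR_seq; first exact: (CR_frame _ (CR_pop true)).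
apply: CR_leq (CR_frame (T A B (code y)) (CR_drop (code x))).
by rewrite tsize_node /=; lia.
Qed.

(** The first bit of the code of a list tells whether it is empty. Otherwise that code is already
    the code of the pair [(e, l)], and swapping it with [x] and pushing one node symbol gives the
    argument of [g]. *)
Lemma pt_case_seq (s : X -> seq Y) (f : X -> Z) (g : X -> Y -> seq Y -> Z) :
  PT s -> PT f -> PT (fun p : X * (Y * seq Y) => g p.1 p.2.1 p.2.2) ->
  PT (fun x => if s x is e :: l then g x e l else f x).
Proof.
move=> hs [p [k hp]] [q [l hq]]; have [b pb hb] := pt_size hs; case: hs => r [j hr].
pose push1 := pact iM (Push (bit A B true)).
apply: (@pt_intro _ _ _ _ _ (pseq (pdup A B) (pseq r (pif iM (is_bit (A := A) (B := B) true)
    (pseq (pswap A B) (pseq push1 q)) (pseq (pact iM Pop) p))))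
  (fun n => 14 * (n + 1) + ((n + 2) ^ j + (14 * (n + b n + 1) + 2 + (n + b n + 1 + 2) ^ l
                             + (n + 2) ^ k).+1))).
  by polyb.
move=> x; apply: CR_seq; first exact: (CR_dup (code x)).
apply: CR_seq; first exact: (CR_frame (T A B (code x)) (hr x)).
have := hb x; case: (s x) => [|e t] hx.
  apply: CR_if; apply: (@CR_leq _ _ _ (1 + (csize x + 2) ^ k)); first by lia.
  apply: CR_seq; last exact: (hp x).
  exact: (CR_frame _ (CR_pop false)).
have e1 : T A B (code (e :: t)) = bit A B true :: T A B (code e) ++ T A B (code t).
  by rewrite -T_node.
rewrite e1; apply: CR_if; rewrite -cat_cons -e1.
apply: (@CR_leq _ _ _ (14 * (csize (e :: t) + csize x + 1) + (1 + (csize (x, (e, t)) + 2) ^ l))).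
  have : (csize (x, (e, t)) + 2) ^ l <= (csize x + b (csize x) + 1 + 2) ^ l.
    apply: leq_expl; rewrite csize_pair (_ : code (e, t) = code (e :: t)) //.
    by lia.
  by lia.
apply: CR_seq; first exact: (CR_swap (code (e :: t)) (code x)).
apply: CR_seq; last exact: (hq (x, (e, t))).
have -> : T A B (code (x, (e, t))) = bit A B true :: T A B (code x) ++ T A B (code (e :: t)).
  exact: (T_node A B (code x) (code (e :: t))).
exact: (CR_frame _ (CR_push _)).
Qed.

(* One round of the loop for [foldl]: the main stack holds the list, the
   partial result and the parameter. *)
Definition pfold_body (q : prog 'I_6 (sym A B)) : prog 'I_6 (sym A B) :=
  let push1 := pact iM (Push (bit A B true)) in
  pseq (pact iM Pop) (pseq (pdip (pswap A B)) (pseq (pswap A B) (pseq push1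
    (pseq (pdip (pswap A B)) (pseq (pdip (pdup A B)) (pseq (pswap A B) (pseq push1
    (pseq q (pseq (pdip (pswap A B)) (pswap A B)))))))))).

(** [N] bounds all the trees that are shuffled; every copy, swap or deletion is linear in their
    sizes, and 500 is a generous total of the constants. *)
Lemma CR_fold_body q n h l a x a' N :
  tsize h <= N -> tsize l <= N -> tsize a <= N -> tsize x <= N -> tsize a' <= N ->
  CR q n (T A B (Node x (Node a h))) (T A B a') ->
  CR (pfold_body q) (n + 500 * (N + 1)) (bit A B true :: (T A B h ++ T A B l) ++ T A B a ++ T A B x)
    (T A B l ++ T A B a' ++ T A B x).
Proof.
move=> hh hl ha hx ha' hq.
have push1 u : CR (pact iM (Push (bit A B true))) 1 u (bit A B true :: u).
  exact: (CR_frame u (CR_push true)).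
have sw t u v : CR (pswap A B) (14 * (tsize t + tsize u + 1))
    (T A B t ++ T A B u ++ v) (T A B u ++ T A B t ++ v).
  by rewrite !catA; exact: CR_frame (CR_swap t u).
have dsw s t u v : CR (pdip (pswap A B)) (14 * (tsize t + tsize u + 1) + 7 * (tsize s + 1))
    (T A B s ++ T A B t ++ T A B u ++ v) (T A B s ++ T A B u ++ T A B t ++ v).
  exact: CR_dip (sw t u v).
apply: CR_leq; last first.
  apply: CR_seq; first exact: (CR_frame _ (CR_pop true)).
  rewrite cat0s -!catA; apply: CR_seq; first exact: dsw.
  apply: CR_seq; first exact: sw.
  apply: CR_seq; first exact: push1.
  rewrite catA -cat_cons -T_node.
  apply: CR_seq.
    by have := dsw (Node a h) l x [::]; rewrite !cats0; apply.
  apply: CR_seq; first exact: (CR_dip (Node a h) (CR_frame (T A B l) (CR_dup x))).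
  rewrite -catA; apply: CR_seq; first exact: sw.
  apply: CR_seq; first exact: push1.
  rewrite catA -cat_cons -T_node.
  apply: CR_seq; first exact: (CR_frame _ hq).
  apply: CR_seq.
    by have := dsw a' x l [::]; rewrite !cats0; apply.
  exact: sw.
by rewrite !tsize_node; lia.
Qed.

(** Iteration may blow up sizes even if [g] is cheap. Therefore the hypothesis bounds the partial
    result after any number of rounds, which yields one bound [R] for the cost of every round. *)
Lemma pt_foldl (l : X -> seq Y) (a : X -> Z) (g : X -> Z -> Y -> Z) b :
  polyb b ->
  (forall x i, csize (foldl (g x) (a x) (take i (l x))) <= b (csize x)) ->
  PT l -> PT a -> PT (fun p : X * (Z * Y) => g p.1 p.2.1 p.2.2) ->
  PT (fun x => foldl (g x) (a x) (l x)).
Proof.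
move=> pb hb hl [pa [ka hpa]] [q [k hq]].
have [bl pbl hbl] := pt_size hl; case: hl => pl [kl hpl].
pose N n := n + bl n + b n.
have pN : polyb N by rewrite /N; polyb.
pose R n := (3 * N n + 2) ^ k + 500 * (N n + 1) + 1.
have pR : polyb R.
  apply: polyb_add; last exact: polyb_const; apply: polyb_add; first by polyb.
  by apply: polyb_mul; [exact: polyb_const | polyb].
apply: (@pt_intro _ _ _ _ _
  (pseq (pdup A B) (pseq (pdup A B) (pseq pa (pseq (pswap A B) (pseq pl
  (pseq (pwhile iM (is_bit (A := A) (B := B) true) (pfold_body q))
  (pseq (pact iM Pop) (pdip (pdrop A B)))))))))
  (fun n => 14 * (n + 1) + (14 * (n + 1) + ((n + 2) ^ ka + (14 * (n + b n + 1) +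
    ((n + 2) ^ kl + ((bl n * R n + 1) + (1 + (7 * (n + 1) + 7 * (b n + 1)))))))))).
  by polyb.
move=> x; set n := csize x.
have ax : csize (a x) <= b n by have := hb x 0; rewrite take0.
have lx : csize (l x) <= bl n by exact: hbl.
apply: CR_seq; first exact: (CR_dup (code x)).
apply: CR_seq; first exact: (CR_frame _ (CR_dup (code x))).
rewrite -catA; apply: CR_seq; first exact: (CR_frame _ (hpa x)).
apply: CR_seq.
  rewrite catA; apply: CR_leq; last exact: (CR_frame _ (CR_swap (code (a x)) (code x))).
  by rewrite -/n; lia.
rewrite -catA; apply: CR_seq; first exact: (CR_frame _ (hpl x)).
set r := foldl _ _ _.
apply: (@CR_seq _ _ _ _ _ _ _ (bit A B false :: (T A B (code r) ++ T A B (code x)))); last first.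
  apply: CR_seq; first exact: (CR_frame _ (CR_pop false)).
  have h := CR_dip (@code _ cZ r) (CR_drop (A := A) (B := B) (@code _ cX x)).
  rewrite cats0 in h; apply: CR_leq h.
  by have := hb x (size (l x)); rewrite take_size -/r -/n; lia.
apply: (@CR_leq _ _ _ (size (l x) * R n + 1)).
  by rewrite leq_add2r leq_mul // (leq_trans _ lx) // ltnW // size_csize.
(* Generalized to a loop in progress: [s1] has been processed and [s2] is still on the stack. *)
enough (H : forall s1 s2, l x = s1 ++ s2 ->
    CR (pwhile iM (is_bit (A := A) (B := B) true) (pfold_body q)) (size s2 * R n + 1)
      (T A B (code s2) ++ T A B (code (foldl (g x) (a x) s1)) ++ T A B (code x))
      (bit A B false :: T A B (code r) ++ T A B (code x)))
  by exact: (H [::] (l x) erefl).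
move=> s1 s2; elim: s2 s1 => [|e s2 IH] s1 els.
  by rewrite cats0 in els; rewrite -els -/r; exact: CR_while_stop.
have el : l x = rcons s1 e ++ s2 by rewrite cat_rcons.
have ts1 : csize (foldl (g x) (a x) s1) <= b n.
  by have := hb x (size s1); rewrite els take_size_cat.
have ts2 : csize (g x (foldl (g x) (a x) s1) e) <= b n.
  by have := hb x (size (rcons s1 e)); rewrite el take_size_cat // foldl_rcons.
have sl : csize e + csize s2 <= csize (l x).
  by have := csize_cat (cX := cY) s1 (e :: s2); rewrite -els csize_cons;
    have := size_csize (cX := cY) s1; lia.
have := IH _ el; rewrite foldl_rcons => loop.
have -> : T A B (code (e :: s2)) = bit A B true :: T A B (code e) ++ T A B (code s2).
  exact: (T_node A B (code e) (code s2)).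
rewrite cat_cons.
apply: (@CR_leq _ _ _ (((csize (x, (foldl (g x) (a x) s1, e)) + 2) ^ k + 500 * (N n + 1))
                       + (size s2 * R n + 1)).+1).
  have : (csize (x, (foldl (g x) (a x) s1, e)) + 2) ^ k <= (3 * N n + 2) ^ k.
    apply: leq_expl; rewrite leq_add2r !csize_pair -/n /N.
    have := tsize_gt0 (@code _ cX x); have := size_csize (cX := cY) s2; rewrite -/n; lia.
  have eR : R n = (3 * N n + 2) ^ k + 500 * (N n + 1) + 1 by [].
  move=> h; rewrite [size (_ :: _)]/= (mulSn (size s2) (R n)).
  by move: (size s2 * R n) => w; rewrite eR; lia.
apply: CR_while_step loop.
by apply: CR_fold_body (hq (x, (foldl (g x) (a x) s1, e))); rewrite -?/n /N /=; lia.
Qed.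

End Closure2.
End PT.

(** * Reading input words, writing output words, and passing from [PT] to Turing machines *)

Definition code_fin (F : finType) : codable F := fun a => code (index a (enum F)).
Arguments code_fin : clear implicits.

Lemma horner_pow (k n : nat) : ((('X + 2%:R%:P) ^+ k : {poly nat}).[n])%R = (n + 2) ^ k.
Proof.
elim: k => [|k IH]; first by rewrite GRing.expr0 hornerC.
by rewrite GRing.exprS hornerM IH hornerD hornerX hornerC expnS.
Qed.

Lemma iter_halted (A B : finType) (M : TM A B) n (c : config M) :
  halting (cstate c) -> iter n (@step _ _ M) c = c.
Proof. by move=> h; elim: n => //= n ->; rewrite /step h. Qed.

Section InputOutput.
Variables A B : finType.
Local Notation runs := (@runs 'I_6 (sym A B)).
Local Notation prog := (prog 'I_6 (sym A B)).
Local Notation mk := (@mk A B).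
Local Notation bits w := (map (bit A B) w).
Local Notation cA := (code_fin A).
Local Notation cB := (code_fin B).

Definition read_letter (a : A) : sym A B := inl (inl a).
Definition written_letter (b : B) : sym A B := inl (inr b).

Lemma csize_fin (F : finType) (a : F) : tsize (@code _ (code_fin F) a) <= 2 * #|F|.
Proof.
rewrite -[@code _ _ a]/(code (index a (enum F))) csize_nat.
have : index a (enum F) < #|F| by rewrite cardE index_mem mem_enum.
by move: (index _ _) #|F| => i n; lia.
Qed.

Definition pread (s : seq A) : prog :=
  foldr (fun a p => pif iIn (fun o => o == Some (read_letter a))
                       (ppush A B (true :: enc (@code _ cA a))) p)
        (pact iM Nop) s.

Lemma runs_read x s i m a b c o : x \in s ->
  runs (pread s) (size s + 2 * #|A| + 2) (mk (read_letter x :: i) m a b c o)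
    (mk (read_letter x :: i) (bits (true :: enc (@code _ cA x)) ++ m) a b c o).
Proof.
elim: s => //= y s IH; rewrite inE; case: (x =P y) => [<- _|nxy /= hx].
  apply: (@runs_leq _ _ _ (size (true :: enc (@code _ cA x))).+2).
    by have := csize_fin x; rewrite /tsize /=; lia.
  apply: runs_if; rewrite mk_get /= eqxx.
  by have := @CR_ppush A B (true :: enc (@code _ cA x)) (read_letter x :: i) m a b c o.
rewrite addSn addSn; apply: runs_if; rewrite mk_get /=.
case: eqP => [[e]|_]; last exact: IH.
by case: nxy.
Qed.

(** Letters are popped from the last to the first, so consing them in this order onto the empty
    list, whose code is the bit pushed at the start, rebuilds the word itself. *)
Definition pinput : prog :=
  pseq (pact iM (Push (bit A B false)))
    (pwhile iIn isSome (pseq (pread (enum A)) (pact iIn Pop))).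

Lemma runs_input (w : seq A) : runs pinput (size w * (3 * #|A| + 4) + 2)
  (init_stacks B (option bool) 5 w)
  (mk [::] (bits (enc (@code _ (@code_seq _ cA) w))) [::] [::] [::] [::]).
Proof.
have -> : init_stacks B (option bool) 5 w = mk (map read_letter (rev w)) [::] [::] [::] [::] [::].
  by rewrite map_rev; apply/ffunP=> -[l hl]; rewrite !ffunE; do 6?[case: l hl => [|l] hl //].
rewrite [_ + 2](_ : _ = 1 + (size w * (3 * #|A| + 4) + 1)); last by lia.
apply: runs_seq; first exact: actM; rewrite [act_on _ _]/=.
suff h : forall v u, runs (pwhile iIn isSome (pseq (pread (enum A)) (pact iIn Pop)))
   (size v * (3 * #|A| + 4) + 1)
   (mk (map read_letter v) (bits (enc (@code _ (@code_seq _ cA) u))) [::] [::] [::] [::])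
   (mk [::] (bits (enc (@code _ (@code_seq _ cA) (catrev v u)))) [::] [::] [::] [::]).
  by have := h (rev w) [::]; rewrite catrevE revK cats0 size_rev.
elim=> [|x v IH] u; first by apply: runs_while_stop; rewrite mk_get.
apply: (@runs_leq _ _ _ ((size (enum A) + 2 * #|A| + 2) + 1 + (size v * (3 * #|A| + 4) + 1)).+1).
  by rewrite /= -cardE; lia.
apply: runs_while_step; [by rewrite mk_get | | exact: (IH (x :: u))].
apply: runs_seq; first by apply: runs_read; rewrite mem_enum.
have e : bits (enc (@code _ (@code_seq _ cA) (x :: u))) =
  bits (true :: enc (@code _ cA x)) ++ bits (enc (@code _ (@code_seq _ cA) u)).
  by rewrite -map_cat.
by rewrite e; exact: (actIn (read_letter x :: map read_letter v) _ _ _ _ _ Pop).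
Qed.

(** A letter is coded by its index in unary, where a unit is the two bits of [Node Leaf]. Hence two
    pops per letter of [s] that is skipped. *)
Fixpoint pwrite (s : seq B) : prog :=
  if s is b :: s' then
    pif iM (is_bit true)
      (pseq (pact iM Pop) (pseq (pact iM Pop) (pwrite s')))
      (pseq (pact iM Pop) (pact iOut (Push (written_letter b))))
  else pact iM Nop.

Lemma runs_write x s i m a b c o : x \in s ->
  runs (pwrite s) (3 * size s)
    (mk i (bits (enc (code (index x s))) ++ m) a b c o)
    (mk i m a b c (written_letter x :: o)).
Proof.
elim: s => // y s IH; rewrite inE [index _ _]/= [size _]/= eq_sym.
have [-> _|nxy /= hx] := eqVneq y x.
  apply: (@runs_leq _ _ _ (1 + 1).+1); first by lia.
  apply: runs_if; rewrite mk_get.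
  by apply: runs_seq; [exact: (actM _ (bit A B false :: m)) | exact: actOut].
rewrite (_ : 3 * (size s).+1 = (1 + (1 + (3 * size s))).+1); last by lia.
apply: runs_if; rewrite mk_get.
apply: runs_seq; first exact: (actM _ (bit A B true :: _)).
apply: runs_seq; first exact: (actM _ (bit A B false :: _)).
exact: IH.
Qed.

Definition poutput : prog :=
  pwhile iM (is_bit true) (pseq (pact iM Pop) (pwrite (enum B))).

Lemma runs_output (u : seq B) o : runs poutput (size u * (3 * #|B| + 2) + 1)
  (mk [::] (bits (enc (@code _ (@code_seq _ cB) u))) [::] [::] [::] o)
  (mk [::] [:: bit A B false] [::] [::] [::] (catrev (map written_letter u) o)).
Proof.
elim: u o => [|x u IH] o; first by apply: runs_while_stop; rewrite mk_get.
apply: (@runs_leq _ _ _ (1 + 3 * size (enum B) + (size u * (3 * #|B| + 2) + 1)).+1).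
  by rewrite /= -cardE; lia.
have -> : bits (enc (@code _ (@code_seq _ cB) (x :: u))) = bit A B true ::
  bits (enc (code (index x (enum B)))) ++ bits (enc (@code _ (@code_seq _ cB) u)).
  by rewrite -map_cat.
apply: runs_while_step (IH (written_letter x :: o)); first by rewrite mk_get.
apply: runs_seq; first exact: (actM _ (bit A B true :: _)).
by apply: runs_write; rewrite mem_enum.
Qed.

Lemma pt_polytime (f : seq A -> seq B) :
  @PT A B _ _ (@code_seq _ cA) (@code_seq _ cB) f -> polytime_computable f.
Proof.
move=> hf; have [b pb hb] := pt_size hf; case: hf => p [k hp].
pose tin n := n * (3 * #|A| + 4) + 2.
pose sz n := n * (2 * #|A| + 1) + 1.
pose tot n := (n.+1 + 2 * (tin n + ((sz n + 2) ^ k + ((sz n + (sz n + 2) ^ k) * (3 * #|B| + 2) + 1)))).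
have [K hK] : polyb tot by rewrite /tot /tin /sz; polyb.
exists (tm_of (pseq pinput (pseq p poutput))), (('X + 2%:R%:P) ^+ K)%R => w /=.
have hs : tsize (@code _ (@code_seq _ cA) w) <= sz (size w).
  elim: w => //= x w IH; rewrite (@csize_cons _ cA).
  by have := csize_fin x; move: IH; rewrite /sz /=; lia.
have hps : ((tsize (@code _ (@code_seq _ cA) w) + 2) ^ k) <= (sz (size w) + 2) ^ k.
  by apply: leq_expl; rewrite leq_add2r.
have hfs : size (f w) <= sz (size w) + (sz (size w) + 2) ^ k.
  apply: leq_trans (ltnW (@size_csize _ cB _)) _.
  by have := CR_size (hp w); rewrite !size_T; lia.
have run : runs (pseq pinput (pseq p poutput))
    (tin (size w) + ((sz (size w) + 2) ^ k + (size (f w) * (3 * #|B| + 2) + 1)))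
    (init_stacks B (option bool) 5 w)
    (mk [::] [:: bit A B false] [::] [::] [::] (rev (map written_letter (f w)))).
  apply: runs_seq; first exact: runs_input.
  apply: runs_seq; last exact: runs_output.
  by apply: runs_leq hps _; have := hp w [::] [::] [::] [::] [::] [::]; rewrite !cats0.
have hle : (size w).+1 + 2 * (tin (size w) +
    ((sz (size w) + 2) ^ k + (size (f w) * (3 * #|B| + 2) + 1)))
    <= (size w + 2) ^ K.
  apply: leq_trans (hK _); rewrite /tot leq_add2l leq_pmul2l // leq_add2l leq_add2l.
  by rewrite leq_add2r leq_mul2r hfs orbT.
have [h1 h2] := tm_of_correct run.
(* A halted machine no longer changes, so the exact running time may be replaced by the value of a
   polynomial above it. *)
rewrite horner_pow -(subnK hle) iterD.
rewrite (iter_halted _ h1).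
split=> // i; rewrite h2 /stack_tape mk_get revK -map_comp //.
Qed.

End InputOutput.

(** * Closure properties of the polynomial-time functions *)

Section Library.
Variables A B : finType.
Local Notation PT := (@PT A B _ _ _ _).

Section Basic.
Context {X Y Z W : Type} {cX : codable X} {cY : codable Y} {cZ : codable Z} {cW : codable W}.

Lemma pt_size_pow (f : X -> Y) : PT f ->
  exists k, forall x, csize (f x) <= (csize x + 2) ^ k.
Proof. by case/pt_size=> b [k hk] h; exists k => x; apply: leq_trans (h x) (hk _). Qed.

Lemma pt_proj1 (f : X -> Y * Z) : PT f -> PT (fun x => (f x).1).
Proof. exact: pt_comp (pt_fst _ _). Qed.

Lemma pt_proj2 (f : X -> Y * Z) : PT f -> PT (fun x => (f x).2).
Proof. exact: pt_comp (pt_snd _ _). Qed.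

Lemma pt_comp2 (f : Y -> Z -> W) (a : X -> Y) (b : X -> Z) :
  PT (fun p : Y * Z => f p.1 p.2) -> PT a -> PT b -> PT (fun x => f (a x) (b x)).
Proof. by move=> hf ha hb; exact: (pt_comp hf (pt_pair ha hb)). Qed.

Lemma pt_cons (f : X -> Y) (g : X -> seq Y) : PT f -> PT g -> PT (fun x => f x :: g x).
Proof. by move=> hf hg; apply: pt_recode (pt_pair hf hg). Qed.

(** A Boolean has the code of a list of at most one unit, so the case distinction on lists
    applies. *)
Lemma pt_if (b : X -> bool) (f g : X -> Y) : PT b -> PT f -> PT g ->
  PT (fun x => if b x then f x else g x).
Proof.
move=> hb hf hg.
have hs : PT (fun x => if b x then [:: tt] else [::]).
  by apply: pt_recode hb => x; case: (b x).
have := pt_case_seq (g := fun x _ _ => f x) hs hg.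
move/(_ (pt_comp hf (pt_fst _ _))); apply: pt_ext => x.
by case: (b x).
Qed.

Lemma pt_some (f : X -> Y) : PT f -> PT (fun x => Some (f x)).
Proof.
move=> hf; apply: pt_recode (pt_pair hf (pt_const _ _ (@nil unit))).
by move=> x.
Qed.

Lemma pt_case_option (o : X -> option Y) (f : X -> Z) (g : X -> Y -> Z) :
  PT o -> PT f -> PT (fun p : X * Y => g p.1 p.2) ->
  PT (fun x => if o x is Some y then g x y else f x).
Proof.
move=> ho hf hg.
have hs : PT (fun x => if o x is Some y then [:: y] else [::]).
  by apply: pt_recode ho => x; case: (o x).
have := pt_case_seq (g := fun x y _ => g x y) hs hf.
have h : PT (fun p : X * (Y * seq Y) => (p.1, p.2.1)).
  by apply: pt_pair; [exact: pt_fst | exact: pt_comp (pt_fst _ _) (pt_snd _ _)].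
move/(_ (pt_comp hg h)); apply: pt_ext => x; by case: (o x).
Qed.

Lemma pt_succ (n : X -> nat) : PT n -> PT (fun x => (n x).+1).
Proof. by move=> hn; apply: pt_recode (pt_pair (pt_const _ _ tt) hn). Qed.

Lemma code_nseq n : code (nseq n tt) = code n.
Proof. by elim: n => // n IH; rewrite -[RHS]/(Node Leaf (code n)) -IH. Qed.

Lemma pt_case_nat (n : X -> nat) (f : X -> Z) (g : X -> nat -> Z) :
  PT n -> PT f -> PT (fun p : X * nat => g p.1 p.2) ->
  PT (fun x => if n x is m.+1 then g x m else f x).
Proof.
move=> hn hf hg.
have hs : PT (fun x => nseq (n x) tt).
  by apply: pt_recode hn => x; rewrite code_nseq.
have := pt_case_seq (g := fun x _ l => g x (size l)) hs hf.
have h : PT (fun p : X * (unit * seq unit) => (p.1, size p.2.2)).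
  apply: pt_pair; first exact: pt_fst.
  apply: pt_recode (pt_comp (pt_snd _ _) (pt_snd _ _)) => -[x [u l]] /=.
  by rewrite -code_nseq; congr code; elim: l => //= -[] l <-.
move/(_ (pt_comp hg h)); apply: pt_ext => x; case: (n x) => //= m.
by rewrite size_nseq.
Qed.

End Basic.

Lemma pt_andb X {cX : codable X} (a b : X -> bool) :
  PT a -> PT b -> PT (fun x => a x && b x).
Proof. by move=> ha hb; apply: pt_if => //; apply: pt_const. Qed.

Lemma pt_orb X {cX : codable X} (a b : X -> bool) :
  PT a -> PT b -> PT (fun x => a x || b x).
Proof. by move=> ha hb; apply: pt_if => //; apply: pt_const. Qed.

Lemma pt_negb X {cX : codable X} (a : X -> bool) : PT a -> PT (fun x => ~~ a x).
Proof. by move=> ha; apply: pt_if => //; apply: pt_const. Qed.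

Lemma pt_implyb X {cX : codable X} (a b : X -> bool) :
  PT a -> PT b -> PT (fun x => a x ==> b x).
Proof. by move=> ha hb; apply: pt_if => //; apply: pt_const. Qed.

Lemma pt_eqbool X {cX : codable X} (a b : X -> bool) :
  PT a -> PT b -> PT (fun x => a x == b x).
Proof.
move=> ha hb; apply: (@pt_ext _ _ _ _ _ _ (fun x => if a x then b x else ~~ b x)).
  by move=> x; case: (a x) (b x) => [] [].
by apply: pt_if => //; apply: pt_negb.
Qed.

(* The additive growth of the partial result is what keeps a loop
   polynomial. *)
Lemma pt_foldl_add X Y Z {cX : codable X} {cY : codable Y} {cZ : codable Z}
    (l : X -> seq Y) (a : X -> Z) (g : X -> Z -> Y -> Z) b :
  polyb b ->
  (forall x z y, csize y <= csize (l x) -> csize (g x z y) <= csize z + b (csize x)) ->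
  PT l -> PT a -> PT (fun p : X * (Z * Y) => g p.1 p.2.1 p.2.2) ->
  PT (fun x => foldl (g x) (a x) (l x)).
Proof.
move=> pb hg hl ha; have [bl pbl hbl] := pt_size hl; have [ba pba hba] := pt_size ha.
apply: (@pt_foldl _ _ _ _ _ _ _ _ _ _ _ (fun n => ba n + bl n * b n)) => //.
  by polyb.
move=> x i; set s := take i (l x).
have hs : forall n, csize (drop n s) <= csize (l x).
  move=> n; apply: leq_trans (csize_drop _ _) _.
  by have := csize_cat (cX := cY) (take i (l x)) (drop i (l x));
    have := size_csize (cX := cY) (drop i (l x)); rewrite cat_take_drop -/s; lia.
have : size s <= bl (csize x).
  apply: leq_trans (hbl x); apply: leq_trans (hs 0); rewrite drop0.
  by apply: ltnW; exact: size_csize.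
move: (hba x) hs => /=; move: (a x) (ba (csize x)) (bl (csize x)) => z B0 N.
elim: s z B0 N => [|y s IH] z B0 N hz hs hN /=.
  by apply: leq_trans hz _; exact: leq_addr.
case: N hN => // N hN; rewrite mulSn addnA.
apply: IH => //; last by move=> n; exact: (hs n.+1).
apply: leq_trans (hg _ _ _ _) _; last by rewrite leq_add2r.
by have := hs 0; rewrite drop0 csize_cons; lia.
Qed.

Section Lists.
Context {X Y Z W : Type} {cX : codable X} {cY : codable Y} {cZ : codable Z}.

Lemma pt_rev (l : X -> seq Y) : PT l -> PT (fun x => rev (l x)).
Proof.
move=> hl; have [b pb hb] := pt_size hl.
apply: (@pt_ext _ _ _ _ _ _ (fun x => foldl (fun s y => y :: s) [::] (l x))).
  by move=> x; rewrite /rev; elim: (l x) [::] => //=.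
apply: (@pt_foldl_add _ _ _ _ _ _ _ _ (fun _ s y => y :: s) (fun n => (b n).+1)) => //.
- by polyb.
- by move=> x z y hy; rewrite csize_cons; have := hb x; lia.
- exact: pt_const.
apply: pt_cons; first exact: pt_comp (pt_snd _ _) (pt_snd _ _).
exact: pt_comp (pt_fst _ _) (pt_snd _ _).
Qed.
End Lists.

Lemma csize_rev Y {cY : codable Y} (s : seq Y) : csize (rev s) = csize s.
Proof.
elim: s => // y s IH; rewrite rev_cons -cats1.
have := csize_cat (cX := cY) (rev s) [:: y].
by rewrite IH !csize_cons csize_nil; lia.
Qed.

Lemma pt_swap3 X Y Z {cX : codable X} {cY : codable Y} {cZ : codable Z} :
  PT (fun p : X * (Z * Y) => (p.1, (p.2.2, p.2.1))).
Proof.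
apply: pt_pair; first exact: pt_fst.
by apply: pt_pair; apply: pt_comp (pt_snd _ _); [exact: pt_snd | exact: pt_fst].
Qed.

Lemma pt_foldr X Y Z {cX : codable X} {cY : codable Y} {cZ : codable Z}
    (l : X -> seq Y) (a : X -> Z) (g : X -> Y -> Z -> Z) b :
  polyb b ->
  (forall x i, csize (foldr (g x) (a x) (drop i (l x))) <= b (csize x)) ->
  PT l -> PT a -> PT (fun p : X * (Y * Z) => g p.1 p.2.1 p.2.2) ->
  PT (fun x => foldr (g x) (a x) (l x)).
Proof.
move=> pb hb hl ha hg.
apply: (@pt_ext _ _ _ _ _ _ (fun x => foldl (fun z y => g x y z) (a x) (rev (l x)))).
  by move=> x; rewrite foldl_rev.
apply: (@pt_foldl _ _ _ _ _ _ _ _ _ _ (fun x z y => g x y z) b) => //.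
- move=> x i; rewrite -[X in csize X](_ : foldr (g x) (a x) (rev (take i (rev (l x)))) = _).
    by rewrite take_rev revK.
  by rewrite -foldl_rev revK.
- exact: pt_rev.
- exact: pt_comp hg (@pt_swap3 X Y Z _ _ _).
Qed.

Lemma pt_foldr_add X Y Z {cX : codable X} {cY : codable Y} {cZ : codable Z}
    (l : X -> seq Y) (a : X -> Z) (g : X -> Y -> Z -> Z) b :
  polyb b ->
  (forall x y z, csize y <= csize (l x) -> csize (g x y z) <= csize z + b (csize x)) ->
  PT l -> PT a -> PT (fun p : X * (Y * Z) => g p.1 p.2.1 p.2.2) ->
  PT (fun x => foldr (g x) (a x) (l x)).
Proof.
move=> pb hb hl ha hg.
apply: (@pt_ext _ _ _ _ _ _ (fun x => foldl (fun z y => g x y z) (a x) (rev (l x)))).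
  by move=> x; rewrite foldl_rev.
apply: (@pt_foldl_add _ _ _ _ _ _ _ _ (fun x z y => g x y z) b) => //.
- by move=> x z y; rewrite csize_rev; exact: hb.
- exact: pt_rev.
- exact: pt_comp hg (@pt_swap3 X Y Z _ _ _).
Qed.

Section Lists2.
Context {X Y Z W : Type} {cX : codable X} {cY : codable Y} {cZ : codable Z}.

Lemma pt_map (f : X -> Y -> Z) (l : X -> seq Y) :
  PT (fun p : X * Y => f p.1 p.2) -> PT l -> PT (fun x => map (f x) (l x)).
Proof.
move=> hf hl; have [k hk] := pt_size_pow hf; have [b pb hb] := pt_size hl.
apply: (@pt_foldr_add _ _ _ _ _ _ _ _ (fun x y s => f x y :: s)
          (fun n => ((n + b n + 1) + 2) ^ k + 1)) => //.
- by polyb.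
- move=> x y z hy; rewrite csize_cons /=.
  have h := leq_trans (hk (x, y)) (_ : _ <= ((csize x + b (csize x) + 1) + 2) ^ k).
  rewrite addn1 addnS ltnS addnC leq_add2l; apply: h.
  apply: leq_expl; rewrite csize_pair; have := hb x; lia.
- exact: pt_const.
apply: pt_cons; last exact: pt_comp (pt_snd _ _) (pt_snd _ _).
apply: (pt_comp2 hf); first exact: pt_fst.
exact: pt_comp (pt_fst _ _) (pt_snd _ _).
Qed.

Lemma pt_filter (f : X -> pred Y) (l : X -> seq Y) :
  PT (fun p : X * Y => f p.1 p.2) -> PT l -> PT (fun x => filter (f x) (l x)).
Proof.
move=> hf hl; have [b pb hb] := pt_size hl.
apply: (@pt_foldr_add _ _ _ _ _ _ _ _ (fun x y s => if f x y then y :: s else s)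
          (fun n => (b n).+1)) => //.
- by polyb.
- by move=> x y z hy; case: ifP => // _; rewrite ?csize_cons; have := hb x; lia.
- exact: pt_const.
apply: pt_if.
- apply: (pt_comp2 hf); first exact: pt_fst.
  exact: pt_comp (pt_fst _ _) (pt_snd _ _).
- by apply: pt_cons; apply: pt_comp (pt_snd _ _); [exact: pt_fst | exact: pt_snd].
exact: pt_comp (pt_snd _ _) (pt_snd _ _).
Qed.

Lemma pt_has (f : X -> pred Y) (l : X -> seq Y) :
  PT (fun p : X * Y => f p.1 p.2) -> PT l -> PT (fun x => has (f x) (l x)).
Proof.
move=> hf hl; apply: (@pt_foldr _ _ _ _ _ _ _ _ (fun x y c => f x y || c) (fun=> 3)) => //.
- exact: polyb_const.
- by move=> x i; case: (foldr _ _ _).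
- exact: pt_const.
apply: pt_orb; last exact: pt_comp (pt_snd _ _) (pt_snd _ _).
apply: (pt_comp2 hf); first exact: pt_fst.
exact: pt_comp (pt_fst _ _) (pt_snd _ _).
Qed.

Lemma pt_all (f : X -> pred Y) (l : X -> seq Y) :
  PT (fun p : X * Y => f p.1 p.2) -> PT l -> PT (fun x => all (f x) (l x)).
Proof.
move=> hf hl; apply: (@pt_foldr _ _ _ _ _ _ _ _ (fun x y c => f x y && c) (fun=> 3)) => //.
- exact: polyb_const.
- by move=> x i; case: (foldr _ _ _).
- exact: pt_const.
apply: pt_andb; last exact: pt_comp (pt_snd _ _) (pt_snd _ _).
apply: (pt_comp2 hf); first exact: pt_fst.
exact: pt_comp (pt_fst _ _) (pt_snd _ _).
Qed.

Lemma pt_cat (s t : X -> seq Y) : PT s -> PT t -> PT (fun x => s x ++ t x).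
Proof.
move=> hs ht; have [b pb hb] := pt_size hs.
apply: (@pt_ext _ _ _ _ _ _ (fun x => foldr cons (t x) (s x))).
  by move=> x; elim: (s x) => //= y l ->.
apply: (@pt_foldr_add _ _ _ _ _ _ _ _ (fun=> cons) (fun n => (b n).+1)) => //.
- by polyb.
- by move=> x y z hy; rewrite csize_cons; have := hb x; lia.
by apply: pt_cons; apply: pt_comp (pt_snd _ _); [exact: pt_fst | exact: pt_snd].
Qed.

Lemma pt_size_seq (s : X -> seq Y) : PT s -> PT (fun x => size (s x)).
Proof.
move=> hs; apply: (@pt_ext _ _ _ _ _ _ (fun x => foldr (fun=> S) 0 (s x))).
  by move=> x; elim: (s x) => //= y l ->.
apply: (@pt_foldr_add _ _ _ _ _ _ _ _ (fun _ _ => S) (fun=> 2)) => //.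
- exact: polyb_const.
- by move=> x y z _; rewrite !csize_nat; lia.
- exact: pt_const.
by apply: pt_succ; exact: pt_comp (pt_snd _ _) (pt_snd _ _).
Qed.

End Lists2.

Lemma pt_flatten X Y {cX : codable X} {cY : codable Y} (l : X -> seq (seq Y)) :
  PT l -> PT (fun x => flatten (l x)).
Proof.
move=> hl; have [b pb hb] := pt_size hl.
apply: (@pt_foldr_add _ _ _ _ _ _ _ _ (fun=> cat) b) => //.
- by move=> x y z hy; have := csize_cat (cX := cY) y z; have := hb x; lia.
- exact: pt_const.
by apply: pt_cat; apply: pt_comp (pt_snd _ _); [exact: pt_fst | exact: pt_snd].
Qed.

Section Nat.
Context {X : Type} {cX : codable X}.
Implicit Types m n : X -> nat.

Lemma pt_units n : PT n -> PT (fun x => nseq (n x) tt).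
Proof. by apply: pt_recode => x; rewrite code_nseq. Qed.

Lemma pt_nseq Y {cY : codable Y} n (y : X -> Y) : PT n -> PT y -> PT (fun x => nseq (n x) (y x)).
Proof.
move=> hn hy; apply: (@pt_ext _ _ _ _ _ _ (fun x => [seq y x | _ <- nseq (n x) tt])).
  by move=> x; rewrite map_nseq.
by apply: pt_map; [exact: pt_comp hy (pt_fst _ _) | exact: pt_units].
Qed.

Lemma pt_addn m n : PT m -> PT n -> PT (fun x => m x + n x).
Proof.
move=> hm hn.
apply: (@pt_ext _ _ _ _ _ _ (fun x => size (nseq (m x) tt ++ nseq (n x) tt))).
  by move=> x; rewrite size_cat !size_nseq.
by apply/pt_size_seq/pt_cat; exact: pt_units.
Qed.

Lemma pt_muln m n : PT m -> PT n -> PT (fun x => m x * n x).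
Proof.
move=> hm hn.
apply: (@pt_ext _ _ _ _ _ _ (fun x => size (flatten (nseq (m x) (nseq (n x) tt))))).
  by move=> x; rewrite size_flatten /shape map_nseq sumn_nseq size_nseq mulnC.
by apply/pt_size_seq/pt_flatten/pt_nseq => //; exact: pt_units.
Qed.

Lemma pt_subn m n : PT m -> PT n -> PT (fun x => m x - n x).
Proof.
move=> hm hn.
apply: (@pt_ext _ _ _ _ _ _ (fun x => foldr (fun=> predn) (m x) (nseq (n x) tt))).
  by move=> x; elim: (n x) => [|k IH] /=; [rewrite subn0 | rewrite IH subnS].
apply: (@pt_foldr_add _ _ _ _ _ _ _ _ (fun _ _ => predn) (fun=> 0)) => //.
- exact: polyb_const.
- by move=> x y z _; rewrite !csize_nat; lia.
- exact: pt_units.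
apply: (@pt_ext _ _ _ _ _ _ (fun p : X * (unit * nat) => if p.2.2 is k.+1 then k else 0)).
  by case=> x [u []].
apply: (pt_case_nat (g := fun _ k => k)).
- exact: pt_comp (pt_snd _ _) (pt_snd _ _).
- exact: pt_const.
exact: pt_snd.
Qed.

Lemma pt_eqn m n : PT m -> PT n -> PT (fun x => m x == n x).
Proof.
move=> hm hn.
apply: (@pt_ext _ _ _ _ _ _ (fun x => if (m x - n x) + (n x - m x) is _.+1 then false else true)).
  by move=> x; case E: (_ + _) => [|k]; lia.
apply: (@pt_case_nat _ _ _ _ _ _ (fun _ _ => false)); try exact: pt_const.
by apply: pt_addn; apply: pt_subn.
Qed.

End Nat.

(** The list is built by a fold over units; the length of what has been built so far supplies the
    next number, and the result is reversed at the end. *)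
Lemma pt_iota X {cX : codable X} (m n : X -> nat) : PT m -> PT n -> PT (fun x => iota (m x) (n x)).
Proof.
move=> hm hn.
apply: (@pt_ext _ _ _ _ _ _
  (fun x => rev (foldr (fun _ s => (m x + size s) :: s) [::] (nseq (n x) tt)))).
  move=> x; set r := foldr _ _ _.
  have [-> _] : r = rev (iota (m x) (n x)) /\ size r = n x.
    rewrite /r; elim: (n x) => //= k [e1 e2]; rewrite e2.
    have -> : m x :: iota (m x).+1 k = rcons (iota (m x) k) (m x + k).
      by rewrite -[LHS]/(iota (m x) k.+1) -addn1 iotaD cats1.
    by rewrite rev_rcons e1.
  by rewrite revK.
apply: pt_rev; have hu := pt_units hn.
have [bm pbm hbm] := pt_size hm; have [bn pbn hbn] := pt_size hu.
pose c (j : nat) := (bm j + 2 * bn j + 1) + 1.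
apply: (@pt_foldr _ _ _ _ _ _ _ _ (fun x _ s => (m x + size s) :: s)
  (fun j : nat => bn j * c j + 1)) => //.
- by rewrite /c; polyb.
- move=> x i; set s := drop i _.
  have : size s <= bn (csize x).
    apply: leq_trans (hbn x); apply: leq_trans (csize_drop _ i); rewrite -/s.
    by apply: ltnW; exact: size_csize.
  move: (csize_nat (m x)) (hbm x); rewrite /c /=.
  move: (bm (csize x)) (bn (csize x)) => M N em hM.
  enough (h : size (foldr (fun _ s0 => m x + size s0 :: s0) [::] s) = size s /\
           (size s <= N -> csize (foldr (fun _ s0 => m x + size s0 :: s0) [::] s) <=
           size s * (M + 2 * N + 1 + 1) + 1)).
    move=> hN; apply: leq_trans (proj2 h hN) _; rewrite leq_add2r.
    by rewrite leq_mul2r hN orbT.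
  elim: s => [|y s [e IH]] //=; split; first by rewrite e.
  move=> hN; rewrite csize_cons csize_nat e mulSn.
  by have := IH (ltnW hN); lia.
- exact: pt_const.
apply: pt_cons; last exact: pt_comp (pt_snd _ _) (pt_snd _ _).
apply: pt_addn; first exact: pt_comp hm (pt_fst _ _).
by apply: pt_size_seq; exact: pt_comp (pt_snd _ _) (pt_snd _ _).
Qed.

Lemma pt_horner X {cX : codable X} (p : {poly nat}) (n : X -> nat) :
  PT n -> PT (fun x => p.[n x]%R).
Proof.
move=> hn; rewrite /horner; elim: (polyseq p) => /= [|c s IH]; first exact: pt_const.
by apply: pt_addn; [apply: pt_muln | apply: pt_const].
Qed.

End Library.

(* The low priority lets structural codes win, such as [code_bool] for [bool], which is a finite
   type too. *)
#[export] Existing Instance code_fin | 100.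

Ltac pt_hyp :=
  match goal with
  | H : @PT _ _ _ _ _ _ ?f |- @PT _ _ _ _ _ _ ?f => exact H
  | H : @PT _ _ _ _ _ _ ?f |- @PT _ _ _ _ _ _ (fun x => ?f _) =>
      eapply (pt_comp H)
  | H : @PT _ _ _ _ _ _ (fun p => ?f p.1 p.2) |- @PT _ _ _ _ _ _ (fun x => ?f _ _) =>
      eapply (pt_comp2 H)
  end.

Ltac pt_eta :=
  lazymatch goal with
  | |- @PT _ _ _ _ _ _ (fun x => @?g x) => idtac
  | |- @PT ?A ?B ?X ?Y ?cX ?cY ?f => change (@PT A B X Y cX cY (fun x => f x))
  end.

Ltac pt_step :=
  cbv beta; pt_eta;
  lazymatch goal with
  | |- @PT _ _ _ _ _ _ (fun _ => ?y) => exact (pt_const _ _ y)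
  | |- @PT _ _ _ _ _ _ id => exact (pt_id _ _)
  | |- @PT _ _ _ _ _ _ (fun x => x) => exact (pt_id _ _)
  | |- @PT _ _ _ _ _ _ fst => exact (pt_fst _ _)
  | |- @PT _ _ _ _ _ _ snd => exact (pt_snd _ _)
  | |- @PT _ _ _ _ _ _ (fun x => (_, _)) => eapply pt_pair
  | |- @PT _ _ _ _ _ _ (fun x => _.1) => eapply pt_proj1
  | |- @PT _ _ _ _ _ _ (fun x => _.2) => eapply pt_proj2
  | |- @PT _ _ _ _ _ _ (fun x => _ :: _) => eapply pt_cons
  | |- @PT _ _ _ _ _ _ (fun x => Some _) => eapply pt_some
  | |- @PT _ _ _ _ _ _ (fun x => S _) => eapply pt_succ
  | |- @PT _ _ _ _ _ _ (fun x => if _ is _ :: _ then _ else _) => eapply pt_case_seq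
  | |- @PT _ _ _ _ _ _ (fun x => if _ is Some _ then _ else _) => eapply pt_case_option
  | |- @PT _ _ _ _ _ _ (fun x => if _ is _.+1 then _ else _) => eapply pt_case_nat
  | |- @PT _ _ _ _ _ _ (fun x => andb _ _) => eapply pt_andb
  | |- @PT _ _ _ _ _ _ (fun x => orb _ _) => eapply pt_orb
  | |- @PT _ _ _ _ _ _ (fun x => negb _) => eapply pt_negb
  | |- @PT _ _ _ _ _ _ (fun x => implb _ _) => eapply pt_implyb
  | |- @PT _ _ _ _ _ _ (fun x => if _ then _ else _) => eapply pt_if
  | |- @PT _ _ _ _ _ _ (fun x => map _ _) => eapply pt_map
  | |- @PT _ _ _ _ _ _ (fun x => filter _ _) => eapply pt_filter
  | |- @PT _ _ _ _ _ _ (fun x => has _ _) => eapply pt_has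
  | |- @PT _ _ _ _ _ _ (fun x => all _ _) => eapply pt_all
  | |- @PT _ _ _ _ _ _ (fun x => _ ++ _) => eapply pt_cat
  | |- @PT _ _ _ _ _ _ (fun x => rev _) => eapply pt_rev
  | |- @PT _ _ _ _ _ _ (fun x => size _) => eapply pt_size_seq
  | |- @PT _ _ _ _ _ _ (fun x => flatten _) => eapply pt_flatten
  | |- @PT _ _ _ _ _ _ (fun x => nseq _ _) => eapply pt_nseq
  | |- @PT _ _ _ _ _ _ (fun x => iota _ _) => eapply pt_iota
  | |- @PT _ _ _ _ _ _ (fun x => addn _ _) => eapply pt_addn
  | |- @PT _ _ _ _ _ _ (fun x => muln _ _) => eapply pt_muln
  | |- @PT _ _ _ _ _ _ (fun x => subn _ _) => eapply pt_subn
  | |- @PT _ _ _ _ _ _ (fun x => horner _ _) => eapply pt_horner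
  | |- @PT _ _ _ _ _ _ (fun x => _ == _) => first [eapply pt_eqn | eapply pt_eqbool]
  | _ => fail
  end.

Ltac pt := repeat (first [pt_hyp | pt_step]).

(** * Bit strings, zips and finite case distinctions *)

Section Library2.
Variables A B : finType.
Local Notation PT := (@PT A B _ _ _ _).

(** A fold over one string whose state holds the unread part of the other and a flag. The strings
    are equal iff the flag survives and nothing is left unread. *)
Lemma pt_eqbits X {cX : codable X} (s t : X -> seq bool) :
  PT s -> PT t -> PT (fun x => s x == t x).
Proof.
move=> hs ht.
pose g (st : bool * seq bool) (b : bool) : bool * seq bool :=
  if st.2 is c :: r then (st.1 && (b == c), r) else (false, [::]).
have gE : forall u v ok, (foldl g (ok, v) u).1 && ((foldl g (ok, v) u).2 == [::]) = ok && (u == v).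
  elim=> [|b u IH] [|c v] ok //=; rewrite ?andbT ?andbF //; first by rewrite IH.
  by rewrite IH eqseq_cons andbA.
apply: (@pt_ext _ _ _ _ _ _ (fun x => (foldl g (true, t x) (s x)).1 &&
    (if (foldl g (true, t x) (s x)).2 is _ :: _ then false else true))).
  by move=> x; rewrite -[RHS]/(true && (s x == t x)) -gE; case: (foldl _ _ _) => ? [].
have h : PT (fun x => foldl g (true, t x) (s x)).
  apply: (@pt_foldl_add _ _ _ _ _ _ _ _ _ _ (fun _ => g) (fun=> 5)) => //.
  - exact: polyb_const.
  - move=> x [ok [|c r]] b _; rewrite /g /= !csize_pair ?csize_cons.
      by rewrite /tsize; case: ok; case: b.
    by move: (csize r) => n; rewrite /tsize; case: ok; case: b; case: c => /=; lia.
  - by pt.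
  by rewrite /g; pt.
by pt.
Qed.

Lemma pt_mem_bits X {cX : codable X} (s : X -> seq bool) (l : X -> seq (seq bool)) :
  PT s -> PT l -> PT (fun x => s x \in l x).
Proof.
move=> hs hl; apply: (@pt_ext _ _ _ _ _ _ (fun x => has (fun t => s x == t) (l x))).
  by move=> x; rewrite -has_pred1; apply: eq_has => t; rewrite /= eq_sym.
by pt; apply: pt_eqbits; pt.
Qed.

Lemma pt_undup_bits X {cX : codable X} (l : X -> seq (seq bool)) :
  PT l -> PT (fun x => undup (l x)).
Proof.
move=> hl; have [b pb hb] := pt_size hl.
apply: (@pt_ext _ _ _ _ _ _ (fun x => foldr
  (fun (y : seq bool) (s : seq (seq bool)) => if y \in s then s else y :: s) [::] (l x))).
  by move=> x; elim: (l x) => //= y s ->; rewrite mem_undup.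
apply: (@pt_foldr_add _ _ _ _ _ _ _ _ _ _
  (fun _ (y : seq bool) (s : seq (seq bool)) => if y \in s then s else y :: s)
          (fun n => (b n).+1)) => //.
- by polyb.
- move=> x y z hy /=; have := hb x; case: ifP => _ h; rewrite ?csize_cons; lia.
- by pt.
by pt; apply: pt_mem_bits; pt.
Qed.

Lemma pt_zip X Y Z {cX : codable X} {cY : codable Y} {cZ : codable Z}
    (s : X -> seq Y) (t : X -> seq Z) :
  PT s -> PT t -> PT (fun x => zip (s x) (t x)).
Proof.
move=> hs ht; have [b pb hb] := pt_size hs.
pose g (st : seq (Y * Z) * seq Z) (y : Y) : seq (Y * Z) * seq Z :=
  if st.2 is z :: r then ((y, z) :: st.1, r) else (st.1, [::]).
have gE : forall u v a, (foldl g (a, v) u).1 = catrev (zip u v) a.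
  elim=> [|y u IH] [|z v] a //=; last by rewrite IH.
  by rewrite IH; case: (u).
apply: (@pt_ext _ _ _ _ _ _ (fun x => rev (foldl g ([::], t x) (s x)).1)).
  by move=> x; rewrite gE catrevE cats0 revK.
have h : PT (fun x => foldl g ([::], t x) (s x)).
  apply: (@pt_foldl_add _ _ _ _ _ _ _ _ _ _ (fun _ => g) (fun n => b n + 2)) => //.
  - by polyb.
  - move=> x [a [|z r]] y hy /=; have := hb x => hx.
      by rewrite /g /= !csize_pair; lia.
    rewrite /g /= csize_pair csize_cons csize_pair.
    by rewrite (csize_pair a) csize_cons; lia.
  - by pt.
  by rewrite /g; pt.
by pt.
Qed.

(** A finite type has a fixed number of cases, so one program per element is built in, and the index
    in unary selects among them by counting down. *)
Lemma pt_fin_case X Y {cX : codable X} {cY : codable Y} (F : finType) (h : X -> F)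
    (g : F -> X -> Y) :
  PT h -> (forall a, PT (g a)) -> PT (fun x => g (h x) x).
Proof.
move=> hh hg.
case E: (enum F) => [|a0 s].
  (* Over an empty [F] the function [h] leaves no possible [x], and any program will do. *)
  exists (pact iM Nop), 0 => x.
  by have := mem_enum F (h x); rewrite E.
pose pick := fix pick (l : seq F) (n : nat) (x : X) {struct l} : Y :=
  if l is a :: l' then (if n is m.+1 then pick l' m x else g a x) else g a0 x.
apply: (@pt_ext _ _ _ _ _ _ (fun x => pick (enum F) (index (h x) (enum F)) x)).
  move=> x; have := mem_enum F (h x); rewrite inE.
  elim: (enum F) => //= a l IH; rewrite inE eq_sym.
  by case: eqP => [->|_] //= hx; exact: IH.
have hi : PT (fun x => index (h x) (enum F)) by apply: pt_recode hh.
have hp l : PT (fun p : X * nat => pick l p.2 p.1).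
  elim: l => [|a l IH] /=; first exact: pt_comp (hg a0) (pt_fst _ _).
  apply: (@pt_case_nat _ _ _ _ _ _ (fun p : X * nat => p.2) (fun p => g a p.1)
            (fun p m => pick l m p.1)).
  - by pt.
  - exact: pt_comp (hg a) (pt_fst _ _).
  by apply: (pt_comp IH (f := fun p : X * nat * nat => (p.1.1, p.2))); pt.
exact: (pt_comp (hp (enum F)) (pt_pair (pt_id _ _) hi)).
Qed.

Lemma pt_fin X Y {cX : codable X} {cY : codable Y} (F : finType) (h : X -> F) (g : F -> Y) :
  PT h -> PT (fun x => g (h x)).
Proof. by move=> hh; apply: (@pt_fin_case _ _ _ _ _ h (fun a _ => g a)) => // a; pt. Qed.

Lemma pt_flatten_fixed X Y T {cX : codable X} {cY : codable Y} (l : seq T)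
    (f : T -> X -> seq Y) :
  (forall a, PT (f a)) -> PT (fun x => flatten [seq f a x | a <- l]).
Proof. by move=> hf; elim: l => [|a l IH] /=; pt; exact: hf. Qed.

End Library2.

(** * Clauses as formulas of F *)

(* A propositional variable is a list of numbers, written in unary as the name
   of a relation symbol of arity 0. *)
Definition bits_of (v : seq nat) : seq bool :=
  flatten [seq nseq k true ++ [:: false] | k <- v].

Lemma bits_of_inj : injective bits_of.
Proof.
elim=> [|k u IH] [|l v] //=; rewrite /bits_of /=; try by [case: k | case: l].
elim: k l => [|k IHk] [|l] //=; first by case=> /IH ->.
by rewrite -!/(bits_of _) in IHk *; case=> /IHk [-> ->].
Qed.

Definition literal : Type := bool * seq nat.
Definition clause : Type := seq literal.

Definition holds (val : seq nat -> bool) (c : clause) : bool :=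
  has (fun l => val l.2 == l.1) c.

Definition atomF (v : seq nat) : formula := @Rel 0 (bits_of v) [tuple].
Definition literalF (l : literal) : formula :=
  if l.1 then atomF l.2 else Not (atomF l.2).
(** A closed valid formula standing for the empty conjunction, as the syntax has no truth
    constants. *)
Definition topF : formula := Not (And (atomF [::]) (Not (atomF [::]))).
Definition bigandF (l : seq formula) : formula := foldr And topF l.
Definition clauseF (c : clause) : formula :=
  Not (bigandF [seq literalF (~~ l.1, l.2) | l <- c]).
Definition cnfF (C : seq clause) : formula := bigandF (map clauseF C).

Lemma Free_bigandF l : (forall f, List.In f l -> Free f = [::]) ->
  Free (bigandF l) = [::].
Proof.
elim: l => //= f l IH h; rewrite h; last by left.
by rewrite IH // => g hg; apply: h; right.
Qed.

Lemma fragF_bigandF l : (forall f, List.In f l -> fragF f /\ Free f = [::]) ->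
  fragF (bigandF l).
Proof.
elim: l => [|f l IH] h /=.
  by apply: F_Not; apply: F_And; [apply: F_Rel | apply/F_Not/F_Rel | move=> x []].
apply: F_And; first by case: (h f); [left|].
  by apply: IH => g hg; apply: h; right.
by move=> x []; rewrite (proj2 (h f _)) //; left.
Qed.

Lemma literalF_frag l : fragF (literalF l) /\ Free (literalF l) = [::].
Proof. by case: l => [[] v]; split=> //=; [|apply: F_Not]; apply: F_Rel. Qed.

Lemma clauseF_frag c : fragF (clauseF c) /\ Free (clauseF c) = [::].
Proof.
have h f : List.In f [seq literalF (~~ l.1, l.2) | l <- c] -> fragF f /\ Free f = [::].
  elim: c => //= l c IH [<-|]; [exact: literalF_frag | exact: IH].
split; first by apply: F_Not; apply: fragF_bigandF.
by apply: Free_bigandF => f /h [].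
Qed.

Lemma fragF_cnfF C : fragF (cnfF C).
Proof.
apply: fragF_bigandF => f; elim: C => //= c C IH [<-|]; last exact: IH.
exact: clauseF_frag.
Qed.

Section Sat.
Variables (M : model) (s : var -> dom M).
Let val v := `[< sat s (atomF v) >].

Lemma sat_bigandF l : sat s (bigandF l) <-> (forall f, List.In f l -> sat s f).
Proof.
elim: l => [|f l IH] /=; first by split=> // _ [].
rewrite IH; split=> [[hf hl] g [<-|] //|h]; first exact: hl.
by split=> [|g hg]; apply: h; [exact: or_introl | exact: or_intror].
Qed.

Lemma sat_literalF l : sat s (literalF l) <-> val l.2 == l.1.
Proof.
case: l => [[] v] /=; first by rewrite eqb_id; split=> /asboolP.
by rewrite eqbF_neg; split=> /asboolPn.
Qed.

Lemma sat_clauseF c : sat s (clauseF c) <-> holds val c.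
Proof.
split=> [h|].
  apply: contrapT => /negP hc; apply: h; apply/sat_bigandF => f.
  elim: c hc => //= l c IH; rewrite negb_or => /andP [hl /IH {}IH] [<-|//].
  by apply/sat_literalF; move: hl => /=; case: (val _) l.1 => [] [].
move=> hc /sat_bigandF h; elim: c hc h => //= l c IH /orP [hl|hc] h.
  have /sat_literalF /= := h _ (or_introl erefl).
  by move: hl => /=; case: (val _) l.1 => [] [].
by apply: IH => // f hf; apply: h; right.
Qed.

Lemma sat_cnfF C : sat s (cnfF C) <-> all (holds val) C.
Proof.
rewrite sat_bigandF; elim: C => [|c C IH] /=; first by split=> // _ f [].
split=> [h|/andP [hc hC] f [<-|hf]].
- apply/andP; split; first by apply/sat_clauseF/h; left.
  by apply/IH => f hf; apply: h; right.
- exact/sat_clauseF.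
- exact: (proj2 IH hC).
Qed.
End Sat.

Lemma satisfiable_cnfF C :
  satisfiable (cnfF C) <-> exists val, all (holds val) C.
Proof.
split=> [[M [s]]|[val h]]; first by move/sat_cnfF; eexists; eassumption.
pose M := @Model unit (inhabits tt)
  (fun n R _ => exists2 v, R = bits_of v & val v).
exists M, (fun=> tt); apply/sat_cnfF; move: h; congr (is_true (all (holds _) C)).
apply/funext => v; apply/idP/asboolP => [h|/= [u /bits_of_inj -> //]].
by exists v.
Qed.

(** Formulas have no code as trees; the reduction therefore produces the token sequence directly,
    from clauses that are lists of numbers. *)
Definition literal_tokens (l : literal) : seq token :=
  if l.1 then TRel :: map TBit (bits_of l.2)
  else [:: TNot, TRel & map TBit (bits_of l.2)].
Definition top_tokens : seq token := [:: TNot; TAnd; TRel; TNot; TRel].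
Definition clause_tokens (c : clause) : seq token :=
  TNot :: (flatten [seq TAnd :: literal_tokens (~~ l.1, l.2) | l <- c] ++ top_tokens).
Definition cnf_tokens (C : seq clause) : seq token :=
  flatten [seq TAnd :: clause_tokens c | c <- C] ++ top_tokens.

Lemma encode_literalF l : encode (literalF l) = literal_tokens l.
Proof. by case: l => [[] v] /=; rewrite /literal_tokens /= cats0. Qed.

Lemma encode_bigandF l :
  encode (bigandF l) = flatten [seq TAnd :: encode f | f <- l] ++ top_tokens.
Proof. by elim: l => //= f l ->; rewrite catA. Qed.

Lemma encode_clauseF c : encode (clauseF c) = clause_tokens c.
Proof.
rewrite /clauseF /= encode_bigandF -map_comp /clause_tokens.
by congr (_ :: (flatten _ ++ _)); apply: eq_map => l /=; rewrite encode_literalF.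
Qed.

Lemma encode_cnfF C : encode (cnfF C) = cnf_tokens C.
Proof.
rewrite /cnfF encode_bigandF -map_comp /cnf_tokens.
by congr (flatten _ ++ _); apply: eq_map => c; congr cons; exact: encode_clauseF.
Qed.

Lemma F_SAT_cnfF C : F_SAT (encode (cnfF C)) <-> exists val, all (holds val) C.
Proof.
rewrite -satisfiable_cnfF; split=> [[phi [/encode_inj <- _ //]]|h].
by exists (cnfF C); split=> //; exact: fragF_cnfF.
Qed.

Lemma pt_cnf_tokens (A B : finType) : @PT A B (seq clause) (seq token)
  _ (@code_seq _ (code_fin token)) cnf_tokens.
Proof.
have bit : @PT A B bool token _ (code_fin token) TBit.
  apply: (@pt_ext _ _ _ _ _ _ (fun b => if b then TBit true else TBit false)); first by case.
  by pt.
rewrite /cnf_tokens /clause_tokens /literal_tokens /bits_of /=.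
by pt.
Qed.

(** * Hardness: the tableau of a computation *)

Definition imply_clause (prem : seq (seq nat)) (v : seq nat) : clause :=
  [seq (false, u) | u <- prem] ++ [:: (true, v)].

Lemma holds_imply val prem v :
  holds val (imply_clause prem v) = (all val prem ==> val v).
Proof.
rewrite /holds has_cat /= orbF eqb_id; elim: prem => //= u prem IH.
by rewrite -orbA IH eqbF_neg; case: (val u).
Qed.

Lemma holds_imply_cons val u prem v : all val prem ->
  holds val (imply_clause (u :: prem) v) = (val u ==> val v).
Proof. by rewrite holds_imply /= => ->; rewrite andbT. Qed.

Lemma holds_choice val u v w :
  holds val [:: (true, u); (true, v); (true, w)] = [|| val u, val v | val w].
Proof. by rewrite /holds /= !eqb_id orbF. Qed.

Section Tableau.
Variables (X : finType) (M : TM ((X + bool)%type : finType) bool).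
Local Notation tape := 'I_(ntapes M).+1.
Local Notation symb := (option (X + bool + bool + work M)).
Local Notation row := {ffun tape -> symb}.
Implicit Types (t j W : nat) (k : tape) (q : state M) (r : row) (a : symb).

Definition symb_in (x : X) : symb := Some (inl (inl (inl x))).
Definition symb_bit (b : bool) : symb := Some (inl (inl (inr b))).
Definition symb_out (b : bool) : symb := Some (inl (inr b)).

(* [state_var t q]: the machine is in state [q] at time [t].
   [cell_var t k j a]: at time [t], the cell of tape [k] at distance [j - W] from
   the head contains [a]; measuring from the head makes the rules uniform. *)
Definition state_var t q : seq nat := [:: t; index q (enum (state M))].
Definition cell_var t k j a : seq nat :=
  [:: t; nat_of_ord k; j; index a (enum {: symb})].

(** Halting is treated as a step that changes nothing, so that the rules hold uniformly at all
    times. *)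
Definition action_of q r : state M * {ffun tape -> symb * move} :=
  if halting q then (q, [ffun k => (r k, Stay)]) else delta q r.

(** The old index of the cell that has index [j] after the head has made the move [m]. *)
Definition shift (m : move) j : nat :=
  match m with MoveLeft => j.-1 | Stay => j | MoveRight => j.+1 end.

Definition premises q r t W : seq (seq nat) :=
  state_var t q :: [seq cell_var t k W (r k) | k <- enum {: tape}].

(** If the shifted index is [W], the cell is the one that the head was scanning, so it receives the
    written symbol; every other cell keeps its content [a]. The two border indices 0 and [2 * W] get
    no rule, as their contents may come from outside the window. *)
Definition cell_clauses q r k a t W : seq clause :=
  let b := (action_of q r).2 k in
  [seq (if shift b.2 j == W then imply_clause (premises q r t W) (cell_var t.+1 k j b.1)
        else imply_clause (cell_var t k (shift b.2 j) a :: premises q r t W)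
               (cell_var t.+1 k j a))
  | j <- iota 1 (2 * W - 1)].

Definition step_clauses (qr : state M * row) t W : seq clause :=
  imply_clause (premises qr.1 qr.2 t W) (state_var t.+1 (action_of qr.1 qr.2).1) ::
  flatten [seq flatten [seq cell_clauses qr.1 qr.2 k a t W | a <- enum {: symb}]
          | k <- enum {: tape}].

Definition all_step_clauses T W : seq clause :=
  flatten [seq flatten [seq step_clauses qr t W | qr <- enum {: state M * row}]
          | t <- iota 0 T].

Definition unit_clause v : clause := [:: (true, v)].

Lemma holds_unit val v : holds val (unit_clause v) = val v.
Proof. by rewrite /holds /unit_clause has_seq1 eqb_id. Qed.

Definition blank_clauses k (l : seq nat) : seq clause :=
  [seq unit_clause (cell_var 0 k j None) | j <- l].

(** The guess of the certificate is the only choice: each of [P] cells after the input is a bit or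
    blank. A blank forces the next cell to be blank, so what is guessed is a word of length at most
    [P]. *)
Definition start_clauses (x : seq X) P W : seq clause :=
  unit_clause (state_var 0 (start M)) ::
  flatten [seq (if k == ord0 then [::] else blank_clauses k (iota 0 (2 * W).+1))
          | k <- enum {: tape}] ++
  blank_clauses ord0 (iota 0 W) ++
  [seq unit_clause (cell_var 0 ord0 p.1 (symb_in p.2)) | p <- zip (iota W (size x)) x] ++
  [seq [:: (true, cell_var 0 ord0 j (symb_bit true)); (true, cell_var 0 ord0 j (symb_bit false));
           (true, cell_var 0 ord0 j None)] | j <- iota (W + size x) P] ++
  [seq imply_clause [:: cell_var 0 ord0 j None] (cell_var 0 ord0 j.+1 None)
  | j <- iota (W + size x) P] ++
  blank_clauses ord0 (iota (W + size x + P) ((2 * W).+1 - (W + size x + P))).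

(** A verifier writes a single truth value, so acceptance is the absence of [false] from the output
    tape at time [T]. Forbidding it at every index avoids having to know where the head is. *)
Definition accept_clauses T W : seq clause :=
  [seq [:: (false, cell_var T ord_max j (symb_out false))] | j <- iota 0 (2 * W).+1].

(** The window must hold the initial word, of length at most [size x + P]. It loses one cell at each
    end per step, and after [T] steps the head may be [T] cells away from the output cell; hence the
    summand [2 * T]. *)
Definition tableau (x : seq X) P T : seq clause :=
  let W := 2 * T + size x + P in
  start_clauses x P W ++ all_step_clauses T W ++ accept_clauses T W.

Lemma pt_map_fixed (A B : finType) (Y S : Type) (Z : Type) {cY : codable Y} {cZ : codable Z}
    (l : seq S) (f : S -> Y -> Z) :
  (forall s, PT A B (f s)) -> PT A B (fun y => [seq f s y | s <- l]).
Proof. by move=> hf; elim: l => [|s l IH] /=; pt; exact: hf. Qed.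

(** The states, rows and symbols of [M] are fixed, so loops over them are unrolled into the program;
    only [t] and [W] depend on the input. *)
Lemma pt_step_clauses (A B : finType) (Y : Type) {cY : codable Y} qr (t W : Y -> nat) :
  PT A B t -> PT A B W -> PT A B (fun y => step_clauses qr (t y) (W y)).
Proof.
move=> ht hW; rewrite /step_clauses.
have prem (Y' : Type) (cY' : codable Y') (t' W' : Y' -> nat) : PT A B t' -> PT A B W' ->
    PT A B (fun y => premises qr.1 qr.2 (t' y) (W' y)).
  move=> ht' hW'; rewrite /premises /state_var; apply: pt_cons; first by pt.
  by apply: pt_map_fixed => k; rewrite /cell_var; pt.
have imp (Y' : Type) (cY' : codable Y') (pr : Y' -> seq (seq nat)) v :
    PT A B pr -> PT A B v -> PT A B (fun y => imply_clause (pr y) (v y)).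
  by move=> hpr hv; rewrite /imply_clause; pt.
have cell (Y' : Type) (cY' : codable Y') (t' j' : Y' -> nat) k a : PT A B t' -> PT A B j' ->
    PT A B (fun y => cell_var (t' y) k (j' y) a).
  by move=> ht' hj'; rewrite /cell_var; pt.
apply: pt_cons.
  by apply: imp; [apply: prem; pt | rewrite /state_var; pt].
apply: pt_flatten_fixed => k; apply: pt_flatten_fixed => a; rewrite /cell_clauses.
move: ((action_of _ _).2 k) => b.
have sh : PT A B (fun p : Y * nat => shift b.2 p.2).
  case: b => b [] /=; pt.
  apply: (@pt_ext _ _ _ _ _ _ (fun p : Y * nat => p.2 - 1)) => [p|]; first by rewrite subn1.
  by pt.
apply: pt_map; last by pt.
apply: pt_if; first by apply: pt_eqn; pt.
  by apply: imp; [apply: prem; pt | apply: cell; pt].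
apply: imp; last by apply: cell; pt.
by apply: pt_cons; [apply: cell; pt | apply: prem; pt].
Qed.

Lemma pt_start_clauses (A B : finType) (Y : Type) {cY : codable Y} (x : Y -> seq X) (P W : Y -> nat) :
  @PT A B _ _ cY (@code_seq _ (code_fin X)) x -> PT A B P -> PT A B W ->
  PT A B (fun y => start_clauses (x y) (P y) (W y)).
Proof.
move=> hx hP hW; rewrite /start_clauses /unit_clause /state_var /imply_clause.
apply: pt_cons; first by pt.
apply: pt_cat.
  by apply: pt_flatten_fixed => k; case: eqP => _; rewrite /blank_clauses /unit_clause /cell_var; pt.
rewrite /blank_clauses /unit_clause /cell_var; pt.
- by apply: (pt_fin (fun x0 : X => index (symb_in x0) (enum {: symb}))); pt.
- by apply: pt_zip; pt.
Qed.

Lemma pt_tableau (A B : finType) (Y : Type) {cY : codable Y} (x : Y -> seq X) (P T : Y -> nat) :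
  @PT A B _ _ cY (@code_seq _ (code_fin X)) x -> PT A B P -> PT A B T ->
  PT A B (fun y => tableau (x y) (P y) (T y)).
Proof.
move=> hx hP hT; rewrite /tableau /all_step_clauses /accept_clauses /cell_var.
apply: pt_cat; first by apply: pt_start_clauses; pt.
apply: pt_cat; last by pt.
apply: pt_flatten; apply: pt_map; last by pt.
by apply: pt_flatten_fixed => qr; apply: pt_step_clauses; pt.
Qed.

(** ** From computations to assignments and back *)

Definition rel_cell (c : config M) W k j : symb :=
  ctape c k (chead c k + (Posz j - Posz W))%R.

Definition head_row (c : config M) : row := [ffun k => ctape c k (chead c k)].

Lemma action_step c : let b := action_of (cstate c) (head_row c) in
  cstate (step c) = b.1 /\
  forall k, chead (step c) k = move_head (b.2 k).2 (chead c k) /\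
    forall i, ctape (step c) k i = if i == chead c k then (b.2 k).1 else ctape c k i.
Proof.
rewrite /action_of /step; case: ifP => _ /=.
  split=> // k; rewrite !ffunE; split=> //= i.
  by case: eqP => // ->.
by rewrite -/(head_row c); case: delta => q b.
Qed.

Lemma rel_cell_step c W k j : 0 < j ->
  let b := (action_of (cstate c) (head_row c)).2 k in
  rel_cell (step c) W k j =
    if shift b.2 j == W then b.1 else rel_cell c W k (shift b.2 j).
Proof.
move=> hj; have [_ /(_ k)] := action_step c; set b := (action_of _ _).2 k => -[eh et].
rewrite /= /rel_cell et eh.
have -> : (move_head b.2 (chead c k) + (Posz j - Posz W))%R =
          (chead c k + (Posz (shift b.2 j) - Posz W))%R.
  by case: b.2 => /=; lia.
by have -> : ((chead c k + (Posz (shift b.2 j) - Posz W))%R == chead c k) =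
  (shift b.2 j == W) by lia.
Qed.

Lemma rel_cell_head c W k : rel_cell c W k W = head_row c k.
Proof. by rewrite /rel_cell GRing.subrr GRing.addr0 ffunE. Qed.

Lemma head_bound w t k : (`|chead (iter t (@step _ _ M) (init M w)) k| <= t%:Z)%R.
Proof.
elim: t => //= t IH; have [_ /(_ k) [-> _]] := action_step (iter t (@step _ _ M) (init M w)).
by case: ((action_of _ _).2 k).2 => /=; move: (chead _ _) IH => h; lia.
Qed.

Section Correct.
Variables (x : seq X) (P T : nat).
Let n := size x.
Let W := 2 * T + n + P.
Let word (u : seq bool) : seq (X + bool) := map inl x ++ map inr u.
Let conf u t : config M := iter t (@step _ _ M) (init M (word u)).

Let start_cell u k j : symb := rel_cell (init M (word u)) W k j.

Lemma start_cell_other u k j : k != ord0 -> start_cell u k j = None.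
Proof.
move=> nk; rewrite /start_cell /rel_cell /= (negPf nk).
by case: (_ + _)%R => // i; rewrite /= nth_nil.
Qed.

Lemma start_cell_left u j : j < W -> start_cell u ord0 j = None.
Proof.
move=> hj; rewrite /start_cell /rel_cell /=.
by have -> : (0 + (Posz j - Posz W))%R = Negz (W - j).-1 by lia.
Qed.

Lemma start_cell_right u i :
  start_cell u ord0 (W + i) = nth None (map (@in_cell _ _ M) (word u)) i.
Proof.
rewrite /start_cell /rel_cell /=.
by have -> : (0 + (Posz (W + i) - Posz W))%R = Posz i by lia.
Qed.

Lemma nth_word_input u i x0 : i < n ->
  nth None (map (@in_cell _ _ M) (word u)) i = symb_in (nth x0 x i).
Proof.
move=> hi; rewrite (nth_map (inl x0)); last by rewrite size_cat size_map; exact: ltn_addr.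
by rewrite nth_cat size_map hi (nth_map x0).
Qed.

Lemma nth_word_guess u i :
  nth None (map (@in_cell _ _ M) (word u)) (n + i) =
  if i < size u then symb_bit (nth false u i) else None.
Proof.
case: ltnP => hi.
  rewrite (nth_map (inr false)); last by rewrite size_cat !size_map ltn_add2l.
  by rewrite nth_cat size_map ltnNge leq_addr /= addKn (nth_map false).
by rewrite nth_default // size_map size_cat !size_map leq_add2l.
Qed.

Lemma index_enum_eq (F : finType) (a b : F) : (index a (enum F) == index b (enum F)) = (a == b).
Proof.
apply/eqP/eqP => [h|->] //.
by rewrite -(nth_index a (mem_enum F a)) h nth_index ?mem_enum.
Qed.

Lemma step_clausesP (C : clause -> Prop) :
  (forall c, c \in all_step_clauses T W -> C c) <->
  forall t q r, t < T ->
    C (imply_clause (premises q r t W) (state_var t.+1 (action_of q r).1)) /\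
    forall k a j, 0 < j < 2 * W -> let b := (action_of q r).2 k in
      C (if shift b.2 j == W then imply_clause (premises q r t W) (cell_var t.+1 k j b.1)
         else imply_clause (cell_var t k (shift b.2 j) a :: premises q r t W)
                (cell_var t.+1 k j a)).
Proof.
split=> [h t q r ht|h c /flatten_mapP [t]].
  have hc c : c \in step_clauses (q, r) t W -> C c.
    move=> hc; apply: h; apply/flatten_mapP; exists t; first by rewrite mem_iota.
    by apply/flatten_mapP; exists (q, r); rewrite ?mem_enum.
  split=> [|k a j hj b]; apply: hc; first exact: mem_head.
  rewrite inE; apply/orP; right; apply/flatten_mapP; exists k; first exact: mem_enum.
  apply/flatten_mapP; exists a; first exact: mem_enum.
  by apply/mapP; exists j; rewrite // mem_iota; lia.
rewrite mem_iota => /andP [_ ht] /flatten_mapP [[q r] _]; have [h1 h2] := h t q r ht.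
rewrite inE => /orP [/eqP -> //|/flatten_mapP [k _ /flatten_mapP [a _ /mapP [j]]]].
rewrite mem_iota => hj ->; apply: h2; lia.
Qed.

Section Complete.
Variable u : seq bool.
Hypothesis size_u : size u <= P.

Definition run_val (v : seq nat) : bool :=
  match v with
  | [:: t; q] => index (cstate (conf u t)) (enum (state M)) == q
  | [:: t; k; j; a] =>
      if insub k is Some k' then index (rel_cell (conf u t) W k' j) (enum {: symb}) == a
      else false
  | _ => false
  end.

Lemma run_val_state t q : run_val (state_var t q) = (cstate (conf u t) == q).
Proof. exact: index_enum_eq. Qed.

Lemma run_val_cell t k j a : run_val (cell_var t k j a) = (rel_cell (conf u t) W k j == a).
Proof. by rewrite /= valK index_enum_eq. Qed.

Lemma run_val_premises q r t : all run_val (premises q r t W) ->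
  cstate (conf u t) = q /\ head_row (conf u t) = r.
Proof.
move=> /andP [/[!run_val_state] /eqP <- /allP h]; split=> //; apply/ffunP=> k.
have := h (cell_var t k W (r k)) (map_f _ (mem_enum _ k)).
by rewrite run_val_cell rel_cell_head => /eqP.
Qed.

Lemma run_val_blank k l : (forall j, j \in l -> start_cell u k j = None) ->
  all (holds run_val) (blank_clauses k l).
Proof.
move=> h; apply/allP => c /mapP [j /h hj ->]; rewrite holds_unit.
by rewrite run_val_cell -[rel_cell _ _ _ _]/(start_cell u k j) hj.
Qed.

Lemma run_val_tableau : (forall i, ctape (conf u T) ord_max i != symb_out false) ->
  all (holds run_val) (tableau x P T).
Proof.
move=> acc; rewrite /tableau -/n -/W !all_cat; apply/and3P; split; last first.
- apply/allP => c /mapP [j _ ->]; rewrite /holds has_seq1 run_val_cell eqbF_neg.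
  exact: acc.
- apply/allP; apply/step_clausesP => t q r ht; split.
    rewrite holds_imply; apply/implyP => /run_val_premises [eq er].
    have [e _] := action_step (conf u t); rewrite run_val_state.
    by rewrite -eq -er -e.
  move=> k a j /andP [hj _] /=; case: eqP => es; rewrite holds_imply; apply/implyP.
    move=> /run_val_premises [eq er]; rewrite run_val_cell.
    rewrite -[conf u t.+1]/(step (conf u t)) rel_cell_step // eq er.
    by rewrite es !eqxx.
  move=> /andP [/[!run_val_cell] /eqP ha /run_val_premises [eq er]].
  rewrite -[conf u t.+1]/(step (conf u t)) rel_cell_step // eq er.
  by move/eqP/negPf: es => ->; rewrite ha.
rewrite /start_clauses -/n -/W -cat1s !all_cat all_seq1; apply/and5P; split.
- by rewrite holds_unit run_val_state.
- apply/allP => c /flatten_mapP [k _]; case: eqP => // /eqP nk.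
  by move: c; apply/allP; apply: run_val_blank => j _; exact: start_cell_other.
- by apply: run_val_blank => j; rewrite mem_iota add0n => /start_cell_left.
- apply/allP => c /mapP [[j a] hja ->]; rewrite holds_unit run_val_cell.
  have [i hi [-> ->]] : exists2 i, i < n & (j, a) = (W + i, nth a x i).
    have /(nthP (0, a)) [i] := hja; rewrite size_zip size_iota minnn => hi <-.
    by exists i; rewrite // nth_zip ?size_iota // nth_iota.
  by rewrite -[rel_cell _ _ _ _]/(start_cell u _ _) start_cell_right (nth_word_input _ a).
apply/and3P; split.
- apply/allP => c /mapP [j]; rewrite mem_iota => hj ->.
  have -> : j = W + (n + (j - (W + n))) by lia.
  rewrite holds_choice !run_val_cell -[rel_cell _ _ _ _]/(start_cell u _ _) start_cell_right nth_word_guess.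
  by case: ifP => // _; case: (nth _ _ _); rewrite ?eqxx ?orbT.
- apply/allP => c /mapP [j]; rewrite mem_iota => hj ->.
  rewrite holds_imply all_seq1 !run_val_cell.
  have -> : j.+1 = W + (n + (j - (W + n)).+1) by lia.
  have {1}-> : j = W + (n + (j - (W + n))) by lia.
  rewrite -![rel_cell _ _ _ _]/(start_cell u _ _) !start_cell_right !nth_word_guess.
  by apply/implyP; case: ifP => // h _; case: ifP => //; lia.
apply: run_val_blank => j; rewrite mem_iota => hj.
have -> : j = W + (n + (j - (W + n))) by lia.
by rewrite start_cell_right nth_word_guess; case: ifP => //; lia.
Qed.
End Complete.

(** The rules propagate true facts: inside the window, [val] makes true every variable that
    describes the run on the guessed certificate. Further true variables do no harm, as the only
    clauses without a positive literal are those of acceptance, and these exclude [false] from the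
    output cell. *)
Lemma tableau_sound val : all (holds val) (tableau x P T) ->
  exists2 u, size u <= P & ctape (conf u T) ord_max 0%R != symb_out false.
Proof.
rewrite /tableau -/n -/W !all_cat => /and3P [hs /allP /step_clausesP ht /allP ha].
move: hs; rewrite /start_clauses -/n -/W -cat1s !all_cat all_seq1.
move=> /and5P [h1 /allP h2 /allP h3 /allP h4 /and3P [/allP h5 /allP h6 /allP h7]].
pose vb i := val (cell_var 0 ord0 (W + n + i) None).
have unit_val v : holds val (unit_clause v) -> val v.
  by rewrite holds_unit.
have vbP : vb P.
  apply: unit_val; apply: h7; apply/mapP; exists (W + n + P) => //.
  by rewrite mem_iota; lia.
(* [m] is the first blank of the guessed part. By minimality every earlier cell has a bit, and the
   blank rules make the later ones blank; so the certificate has length [m]. *)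
have [m vm minm] : exists2 m, vb m & forall i, vb i -> m <= i.
  by exists (ex_minn (ex_intro _ P vbP)); case: ex_minnP.
have hm : m <= P := minm _ vbP.
have vbm i : m <= i -> i <= P -> vb i.
  elim: i => [|i IH]; first by rewrite leqn0 => /eqP <-.
  rewrite leq_eqVlt => /orP [/eqP <- //|hi] hP.
  have := h6 (imply_clause [:: cell_var 0 ord0 (W + n + i) None] (cell_var 0 ord0 (W + n + i).+1 None)).
  rewrite holds_imply all_seq1 -/(vb i) /vb addnS => /(_ _)/implyP; apply.
    by apply/mapP; exists (W + n + i) => //; rewrite mem_iota; lia.
  by apply: IH => //; exact: ltnW.
pose u := mkseq (fun i => val (cell_var 0 ord0 (W + n + i) (symb_bit true))) m.
have su : size u = m by rewrite size_mkseq.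
exists u; first by rewrite su.
have start k j : j <= 2 * W -> val (cell_var 0 k j (start_cell u k j)).
  move=> hj; have [->|nk] := eqVneq k ord0; last first.
    rewrite start_cell_other //; apply: unit_val; apply: h2; apply/flatten_mapP.
    exists k; first exact: mem_enum.
    by rewrite (negPf nk); apply/mapP; exists j => //; rewrite mem_iota.
  have [jW|Wj] := ltnP j W.
    rewrite start_cell_left //; apply: unit_val; apply: h3; apply/mapP.
    by exists j; rewrite // mem_iota.
  rewrite -(subnKC Wj) start_cell_right; set i := j - W.
  have [hi|ni] := ltnP i n.
    have x0 : X by case: (x) (hi); rewrite /n; case: (x).
    rewrite (nth_word_input _ x0) //; apply: unit_val; apply: h4; apply/mapP.
    exists (W + i, nth x0 x i) => //; apply/(nthP (0, x0)); exists i.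
      by rewrite size_zip size_iota minnn.
    by rewrite nth_zip ?size_iota // nth_iota.
  rewrite -(subnKC ni) nth_word_guess addnA su; set l := i - n.
  case: ltnP => [lm|ml].
    have := h5 [:: (true, cell_var 0 ord0 (W + n + l) (symb_bit true));
           (true, cell_var 0 ord0 (W + n + l) (symb_bit false));
           (true, cell_var 0 ord0 (W + n + l) None)].
    rewrite holds_choice nth_mkseq // => /(_ _).
    have nv : vb l = false by apply/negP => /minm; lia.
    rewrite [val (cell_var _ _ _ None)]nv orbF => hh.
    case E: (val (cell_var 0 ord0 (W + n + l) (symb_bit true))) => //.
    move: hh; rewrite E; apply.
    by apply/mapP; exists (W + n + l) => //; rewrite mem_iota; lia.
  have [lP|Pl] := leqP l P; first exact: vbm.
  apply: unit_val; apply: h7; apply/mapP; exists (W + n + l) => //.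
  by rewrite mem_iota /l /i; lia.
(* The known part of the window shrinks by one cell at either end per step, since the new content of
   an index may come from a neighbouring index. *)
have main t : t <= T -> val (state_var t (cstate (conf u t))) /\
    forall k j, t <= j -> j <= 2 * W - t ->
      val (cell_var t k j (rel_cell (conf u t) W k j)).
  elim: t => [|t IH] tT.
    split; first exact: unit_val.
    by move=> k j _; rewrite subn0; exact: start.
  have [vs vc] := IH (ltnW tT).
  have prem : all val (premises (cstate (conf u t)) (head_row (conf u t)) t W).
    apply/andP; split=> //; apply/allP => v /mapP [k _ ->].
    by rewrite -(rel_cell_head _ W); apply: vc; rewrite /W; lia.
  have [e _] := action_step (conf u t).
  have [c1 c2] := ht t (cstate (conf u t)) (head_row (conf u t)) tT.
  split.
    move: c1; rewrite holds_imply prem implyTb.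
    by rewrite -[conf u t.+1]/(step (conf u t)) e.
  move=> k j tj jW; have hj : 0 < j < 2 * W by lia.
  have := c2 k (rel_cell (conf u t) W k (shift ((action_of (cstate (conf u t)) (head_row (conf u t))).2 k).2 j)) j hj.
  rewrite -[conf u t.+1]/(step (conf u t)) rel_cell_step; last by lia.
  move: prem; set pr := premises _ _ _ _ => prem; cbv zeta.
  set b := (action_of _ _).2.
  case: ifP => es; first by rewrite holds_imply prem.
  rewrite holds_imply_cons //.
  have [s1 s2] : t <= shift (b k).2 j /\ shift (b k).2 j <= 2 * W - t.
    by clear - tj jW; case: (b k).2 => /=; lia.
  by move/implyP; apply; apply: vc.
have [_ vc] := main T (leqnn T).
have hb := head_bound (word u) T ord_max; rewrite -/(conf u T) in hb.
(* The index of cell 0, which holds the output. The head is at most [T] away and [2 * T <= W], so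
   [j] lies in the part of the window still known at time [T]. *)
pose j := `|Posz W - chead (conf u T) ord_max|%N.
have ej : (chead (conf u T) ord_max + (Posz j - Posz W) = 0)%R.
  by rewrite /j /W; move: (chead _ _) hb => h; lia.
have := vc ord_max j; rewrite /rel_cell ej => hv.
apply/negP => /eqP ef; rewrite ef in hv.
have := ha [:: (false, cell_var T ord_max j (symb_out false))].
rewrite /holds has_seq1 eqbF_neg hv.
- move/(_ _)/negP; apply => //; apply/mapP; exists j => //.
  by rewrite mem_iota /j /W; move: (chead _ _) hb => h; lia.
- by rewrite /j /W; move: (chead _ _) hb => h; lia.
- by rewrite /j /W; move: (chead _ _) hb => h; lia.
Qed.

End Correct.
End Tableau.

Lemma horner_nat_mono (p : {poly nat}) (m n : nat) : m <= n -> (p.[m] <= p.[n])%N%R.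
Proof.
move=> h; rewrite /horner; elim: (polyseq p) => //= c s IH.
by apply: leq_add => //; apply: leq_mul.
Qed.

Theorem F_SAT_hard : NP_hard F_SAT.
Proof.
move=> A L [p [V [[M [q hM]] hL]]].
pose P n : nat := p.[n]%R.
(* Certificates differ in length. The time bound for the longest one serves for all, as a polynomial
   with natural coefficients is monotone and a halted machine stays put. *)
pose T n : nat := (q.[(n + P n)%N])%R.
exists (fun x => cnf_tokens (tableau M x (P (size x)) (T (size x)))); split.
  apply: pt_polytime; apply: (pt_comp (pt_cnf_tokens _ _)).
  by apply: pt_tableau; rewrite /T /P; pt.
move=> x; rewrite -encode_cnfF F_SAT_cnfF hL.
have final u : size u <= P (size x) ->
    ctape (iter (T (size x)) (@step _ _ M) (init M (map inl x ++ map inr u))) ord_max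
      =1 @word_tape _ _ M [:: @out_cell _ _ M (V (map inl x ++ map inr u))].
  move=> hu; have := hM (map inl x ++ map inr u) => -[].
  rewrite size_cat !size_map; set T0 : nat := (q.[_])%R => halt.
  have hT : T0 <= T (size x) by apply: horner_nat_mono; rewrite leq_add2l.
  by rewrite -(subnK hT) iterD (iter_halted _ halt).
split=> [[u [hu hV]]|[val hval]].
  exists (run_val M x (P (size x)) (T (size x)) u); apply: run_val_tableau => // i.
  rewrite final // hV; case: i => [[|i]|i] //=.
  by rewrite nth_nil.
have [u hu hc] := tableau_sound hval; exists u; split=> //.
by move: hc; rewrite final //=; case: (V _).
Qed.

(** * Quantifier prefixes *)

(* A prefix lists quantified variables from the outside in; [true] stands for an
   existential quantifier. *)
Definition prefix : Type := seq (bool * var).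
Definition pvars (pre : prefix) : seq var := [seq q.2 | q <- pre].

Section Prefix.
Variable D : Type.
Implicit Types (P : (var -> D) -> Prop) (s : var -> D) (pre : prefix).

Fixpoint pq pre P s : Prop :=
  match pre with
  | [::] => P s
  | (true, x) :: pre' => exists d, pq pre' P (update s x d)
  | (false, x) :: pre' => forall d, pq pre' P (update s x d)
  end.

(** The comparison with [g] keeps the quantifiers of a literal guessed true and dualizes those of a
    literal guessed false, as negation passes through them. *)
Definition litpre (g : bool) pre : prefix := [seq (q.1 == g, q.2) | q <- pre].

Lemma pvars_litpre g pre : pvars (litpre g pre) = pvars pre.
Proof. by rewrite /pvars -map_comp. Qed.

Lemma pq_lit g pre P s :
  pq (litpre g pre) (fun s' => g <-> P s') s <-> (g <-> pq pre P s).
Proof.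
elim: pre s => //= -[b x] pre IH s /=; case: g IH => IH; case: b => /=.
- split=> [[d /IH [h _]]|[h _]]; first by split=> // _; exists d; exact: h.
  by case: (h isT) => d hd; exists d; apply/IH; split.
- split=> [h|[h _] d]; last by apply/IH; split=> // _; exact: h.
  by split=> // _ d; case/IH: (h d) => h' _; exact: h'.
- split=> [h|[_ h] d]; last by apply/IH; split=> // h'; apply: h; exists d.
  by split=> // -[d hd]; case/IH: (h d) => _; apply.
split=> [[d /IH [_ h]]|[_ h]]; first by split=> // h'; exact/h/h'.
apply: contrapT => hn; have // : false.
by apply: h => d; apply: contrapT => hd; apply: hn; exists d; apply/IH; split.
Qed.

(* The universal variables in front of [v]: the arguments of its Skolem function. *)
Definition bf pre (v : var) : seq var :=
  foldr (fun q acc => if q.2 == v then [::] else if q.1 then acc else q.2 :: acc) [::] pre.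

Lemma bf_sub pre v : {subset bf pre v <= pvars pre}.
Proof.
move=> u; elim: pre => //= -[b x] pre IH /=; rewrite inE.
case: eqP => // _; case: b; first by move/IH ->; rewrite orbT.
by rewrite inE => /orP [->|/IH ->]; rewrite ?orbT.
Qed.

(** Universal variables are arbitrary, existential ones are given by [F]. The list [acc] has the
    universal variables of an outer part of the prefix already stripped off, which remain arguments
    of the inner Skolem functions. *)
Definition skolem_inst (F : var -> seq D -> D) pre (acc : seq var) s : Prop :=
  forall v, (true, v) \in pre -> s v = F v (map s (acc ++ bf pre v)).

(** Distinctness of the bound variables ensures that no inner quantifier overwrites an argument of
    an outer Skolem function. *)
Lemma pq_of_skolem F pre acc P s : uniq (pvars pre) ->
  (forall v, v \in acc -> v \notin pvars pre) ->
  (forall s', (forall v, v \notin pvars pre -> s' v = s v) ->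
    skolem_inst F pre acc s' -> P s') ->
  pq pre P s.
Proof.
elim: pre acc s => [|[b x] pre IH] acc s /=; first by move=> _ _; apply.
case/andP=> nx un dis h.
have upd_out d v : v != x -> update s x d v = s v by rewrite /update => /negPf ->.
case: b h => h.
  exists (F x (map s acc)); apply: (IH acc) => // [v /dis|s' hs' hF].
    by rewrite inE negb_or => /andP [].
  have out v : v \notin x :: pvars pre -> s' v = s v.
    by rewrite inE negb_or => /andP [vx hv]; rewrite hs' // upd_out.
  apply: h => // v; rewrite inE => /orP [/eqP [->]|hv] /=.
    rewrite eqxx cats0 hs' // /update eqxx; congr F.
    by apply/eq_in_map => z hz; rewrite out // dis.
  have vx : x == v = false.
    by apply: contraNF nx => /eqP ->; apply/mapP; exists (true, v).
  by rewrite vx; exact: hF.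
move=> d; apply: (IH (acc ++ [:: x])) => // [v|s' hs' hF].
  by rewrite mem_cat inE => /orP [/dis|/eqP -> //]; rewrite inE negb_or => /andP [].
apply: h => [v|v].
  by rewrite inE negb_or => /andP [vx hv]; rewrite hs' // upd_out.
rewrite inE /= => hv.
have vx : x == v = false.
  by apply: contraNF nx => /eqP ->; apply/mapP; exists (true, v).
by rewrite vx; have := hF v hv; rewrite -catA.
Qed.

(** Skolemization by the axiom of choice: under a leading universal variable there are functions
    [G d] for each of its values [d], and [d] becomes their first argument. The value [s x] fills
    the case of no arguments, which then does not occur. *)
Lemma skolem_of_pq pre P s : uniq (pvars pre) -> pq pre P s ->
  exists F, forall s', (forall v, v \notin pvars pre -> s' v = s v) ->
    skolem_inst F pre [::] s' -> P s'.
Proof.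
elim: pre s => [|[b x] pre IH] s /=.
  by move=> _ hP; exists (fun=> fun=> s [::]) => s' hs' _; rewrite (_ : s' = s) //; apply/funext => v; exact: hs'.
case/andP=> nx un; case: b => /=.
  case=> d /(IH _ un) [F hF]; exists (fun v l => if v == x then d else F v l) => s' hs' hF'.
  have sx : s' x = d by rewrite (hF' x) ?mem_head // eqxx.
  apply: hF => [v hv|v hv]; rewrite /update.
    by case: eqP => [->|/eqP vx] //; rewrite hs' // inE negb_or vx.
  have := hF' v; rewrite inE hv orbT => /(_ isT) ->.
  have vx : v == x = false by apply: contraNF nx => /eqP <-; apply/mapP; exists (true, v).
  by rewrite vx /= eq_sym vx.
move=> h; have {h} [G hG] := choice (fun d => IH _ un (h d)).
exists (fun v l => if l is d :: l' then G d v l' else s x) => s' hs' hF'.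
apply: (hG (s' x)) => [v hv|v hv]; rewrite /update.
  by case: eqP => [->|/eqP vx] //; rewrite hs' // inE negb_or vx.
have := hF' v; rewrite inE hv orbT => /(_ isT) ->.
have vx : x == v = false by apply: contraNF nx => /eqP ->; apply/mapP; exists (true, v).
by rewrite /= vx.
Qed.

End Prefix.

(** * Prefixed atoms *)

(* Relation symbol ([None] for equality) and arguments, prefix, polarity. *)
Definition patom : Type := (option (seq bool) * seq var) * (prefix * bool).
Definition asym (a : patom) : option (seq bool) := a.1.1.
Definition aargs (a : patom) : seq var := a.1.2.
Definition apre (a : patom) : prefix := a.2.1.
Definition apol (a : patom) : bool := a.2.2.

Definition afree (a : patom) : seq var := [seq z <- aargs a | z \notin pvars (apre a)].

(** Preserved by [addq], which quantifies a variable only in atoms where it is free: repeated and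
    vacuous quantifiers never arise. *)
Definition wf_patom (a : patom) : Prop :=
  [/\ uniq (pvars (apre a)), {subset pvars (apre a) <= aargs a}
    & asym a = None -> size (aargs a) = 2].

Definition interpL (M : model) (R : seq bool) (l : seq (dom M)) : Prop :=
  @interp M (size l) R (in_tuple l).

Definition base_sat (M : model) (a : patom) (s : var -> dom M) : Prop :=
  if asym a is Some R then interpL R (map s (aargs a))
  else s (nth [::] (aargs a) 0) = s (nth [::] (aargs a) 1).

Definition asat (M : model) (s : var -> dom M) (a : patom) : Prop :=
  pq (apre a) (base_sat (M := M) a) s.

(* The free variables act as existential variables quantified first. *)
Definition lpre (l : patom * bool) : prefix :=
  [seq (true, z) | z <- undup (afree l.1)] ++ litpre l.2 (apre l.1).

Lemma mem_afree a z : (z \in afree a) = (z \in aargs a) && (z \notin pvars (apre a)).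
Proof. by rewrite mem_filter andbC. Qed.

Lemma pvars_lpre l z : wf_patom l.1 -> z \in pvars (lpre l) = (z \in aargs l.1).
Proof.
case=> _ sub _; rewrite /lpre [pvars _]map_cat mem_cat -map_comp map_id mem_undup.
have -> : [seq q.2 | q <- litpre l.2 (apre l.1)] = pvars (apre l.1) := pvars_litpre _ _.
rewrite mem_afree.
by case h : (z \in pvars _); [rewrite orbT (sub _ h) | rewrite orbF andbT].
Qed.

Lemma bf_lpre l z : bf (lpre l) z = if z \in afree l.1 then [::] else bf (litpre l.2 (apre l.1)) z.
Proof.
rewrite /lpre -mem_undup; elim: (undup _) => //= y s IH; rewrite inE eq_sym.
by case: eqP.
Qed.

Lemma mem_lpre l z : ((true, z) \in lpre l) =
  (z \in afree l.1) || ((true, z) \in litpre l.2 (apre l.1)).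
Proof.
by rewrite /lpre mem_cat mem_map ?mem_undup // => u v [].
Qed.

Lemma base_sat_ext M a (s s' : var -> dom M) : (asym a = None -> size (aargs a) = 2) ->
  {in aargs a, s =1 s'} -> base_sat a s <-> base_sat a s'.
Proof.
rewrite /base_sat => h2 e; case: (asym a) h2 => [R|] h2; first by have /eq_in_map -> := e.
have := h2 erefl; case: (aargs a) e => [|x [|y [|]]] //= e _.
by rewrite !e // !inE eqxx ?orbT.
Qed.

Section Literals.
Variable M : model.
Implicit Types (s : var -> dom M) (l : patom * bool).

Lemma literal_of_skolem F l s : wf_patom l.1 ->
  (forall z, z \in afree l.1 -> s z = F z [::]) ->
  (forall s', skolem_inst F (lpre l) [::] s' -> l.2 <-> base_sat l.1 s') ->
  l.2 <-> asat s l.1.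
Proof.
move=> [un sub sz] hs h; apply/pq_lit; apply: (@pq_of_skolem _ F _ [::]) => //.
  by rewrite pvars_litpre.
rewrite pvars_litpre => s' hs' hF; apply: h => v; rewrite mem_lpre bf_lpre.
case: ifP => [hv _|nv /= hv]; last exact: hF.
by rewrite hs' ?hs //; move: hv; rewrite mem_afree => /andP [].
Qed.

Lemma skolem_of_literal l s : wf_patom l.1 -> (l.2 <-> asat s l.1) ->
  exists F, forall s', skolem_inst F (lpre l) [::] s' -> l.2 <-> base_sat l.1 s'.
Proof.
move=> [un sub sz] /pq_lit; case/skolem_of_pq; first by rewrite pvars_litpre.
move=> F hF; exists (fun v u => if v \in afree l.1 then s v else F v u) => s' hs'.
(* The functions from [skolem_of_pq] work only for assignments that agree with [s] off the prefix.
   [s2] restores [s] at all variables foreign to the atom; at its free ones the Skolem constants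
   already give [s]. *)
pose s2 v := if v \in aargs l.1 then s' v else s v.
rewrite (@base_sat_ext _ _ s' s2 sz); last by move=> v hv; rewrite /s2 hv.
apply: hF => [v|v hv].
  rewrite pvars_litpre => hv; rewrite /s2; case: ifP => // hv'.
  have hf : v \in afree l.1 by rewrite mem_afree hv'.
  by rewrite hs' ?mem_lpre ?hf.
have vp : v \in pvars (apre l.1).
  by rewrite -(pvars_litpre l.2); apply/mapP; exists (true, v).
have nf : v \in afree l.1 = false by rewrite mem_afree vp andbF.
have -> : s2 v = s' v by rewrite /s2 sub.
rewrite hs' ?mem_lpre ?hv ?orbT // nf /= bf_lpre nf; congr F.
apply/eq_in_map => u /bf_sub; rewrite pvars_litpre => /sub hu.
by rewrite /s2 hu.
Qed.
End Literals.

(** * Reachability by iterated closure *)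

Section Closure.
Variables (T : eqType) (e : rel T) (N : seq T).

Definition grow (S : seq T) : seq T :=
  [seq y <- N | (y \in S) || has (fun z => e z y) S].
Definition reach (x : T) : seq T := iter (size N) grow [:: x].

Lemma count_ltn (P Q : pred T) z : subpred P Q -> z \in N -> Q z -> ~~ P z ->
  count P N < count Q N.
Proof.
move=> PQ; elim: N => //= y s IH; rewrite inE => /orP [/eqP <-|hz] Qz Pz.
  by rewrite Qz (negPf Pz) add0n add1n ltnS sub_count.
by apply: leq_ltn_trans (_ : Q y + count P s < _); rewrite ?leq_add2r ?ltn_add2l ?IH //;
  case: (P y) (PQ y) => // ->.
Qed.

Lemma iter_grow_sub k x : x \in N -> {subset iter k grow [:: x] <= N}.
Proof.
by move=> hx; case: k => [|k] z /=; [rewrite inE => /eqP -> | rewrite mem_filter => /andP []].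
Qed.

Lemma iter_grow_le k x : x \in N -> {subset iter k grow [:: x] <= iter k.+1 grow [:: x]}.
Proof.
move=> hx z hz; rewrite iterS mem_filter hz /=; exact: iter_grow_sub hz.
Qed.

Lemma reach_refl x : x \in N -> x \in reach x.
Proof.
move=> hx; rewrite /reach; elim: (size N) => [|k IH]; first exact: mem_head.
exact: iter_grow_le.
Qed.

Lemma reach_mem x y : x \in N -> y \in reach x -> y \in N.
Proof. by move=> hx; apply: iter_grow_sub. Qed.

(** A round that is not yet stable adds an element of [N], so [size N] rounds reach a fixed
    point. *)
Lemma reach_step x y z : x \in N -> y \in reach x -> e y z -> z \in N -> z \in reach x.
Proof.
move=> hx hy eyz hz; pose S k := iter k grow [:: x].
have stable : {subset S (size N).+1 <= S (size N)}.
  have h k : {subset S k.+1 <= S k} \/ k < count (mem (S k.+1)) N.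
    elim: k => [|k IH].
      have [h|h] := pselect {subset S 1 <= S 0}; [by left|right].
      by rewrite -has_count; apply/hasP; exists x => //=; exact: (iter_grow_le (k := 0)) (mem_head _ _).
    case: IH => [hs|hc].
      left=> y'; rewrite /S iterS mem_filter => /andP [/orP [//|/hasP [w /hs hw eyw]] hN].
      by rewrite /S iterS mem_filter hN andbT; apply/orP; right; apply/hasP; exists w.
    have [h|h] := pselect {subset S k.+2 <= S k.+1}; [by left|right].
    have [w hw nw] : exists2 w, w \in S k.+2 & w \notin S k.+1.
      apply: contrapT => hn; apply: h => w hw; apply: contrapT => /negP nw.
      by apply: hn; exists w.
    apply: leq_ltn_trans hc _; apply: (count_ltn (z := w)) => //.
      by move=> w'; exact: iter_grow_le.
    exact: iter_grow_sub hw.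
  case: (h (size N)) => //; have := count_size (mem (S (size N).+1)) N; lia.
apply: stable; rewrite /S iterS mem_filter hz andbT; apply/orP; right.
by apply/hasP; exists y.
Qed.

Lemma reach_ind (P : T -> Prop) x : P x ->
  (forall y z, y \in reach x -> P y -> e y z -> z \in N -> P z) ->
  x \in N -> forall y, y \in reach x -> P y.
Proof.
move=> Px h hx y.
suff H k : k <= size N -> forall y, y \in iter k grow [:: x] -> P y by exact: H.
elim: k => [_ z|k IH hk z]; first by rewrite inE => /eqP ->.
rewrite iterS mem_filter => /andP [/orP [hz|/hasP [w hw ewz]] hN].
  exact: IH (ltnW hk) _ hz.
apply: (h w) => //; last exact: IH (ltnW hk) _ hw.
rewrite /reach -(subnK (ltnW hk)); elim: (_ - _) => // j IHj.
by rewrite addSn; exact: iter_grow_le.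
Qed.

Lemma reach_trans x y z : x \in N -> y \in reach x -> z \in reach y -> z \in reach x.
Proof.
move=> hx hy; apply: (reach_ind (P := fun z => z \in reach x)) => //.
  by move=> u w _ hu euw hw; exact: reach_step euw hw.
exact: reach_mem hy.
Qed.

End Closure.

(** * Unification of two literals *)

Section Pair.
Variables a b : patom * bool.

(* Nodes are variables of the two literals; the last component tells whether a
   strict step, from an existential variable to an argument of its Skolem
   function, has been taken.  In a common instance a plain step preserves the
   value and a strict step leads to a proper subterm. *)
Definition node : Type := bool * var * bool.

Definition side (sd : bool) : patom * bool := if sd then a else b.
Definition keys : seq (bool * var) :=
  [seq (true, v) | v <- aargs a.1] ++ [seq (false, v) | v <- aargs b.1].
Definition nodes : seq node := [seq (w, false) | w <- keys] ++ [seq (w, true) | w <- keys].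
Definition existential (w : bool * var) : bool := (true, w.2) \in lpre (side w.1).
Definition step_args (w : bool * var) : seq var := bf (lpre (side w.1)) w.2.

Definition plain (w w' : bool * var) : bool :=
  (w.1 != w'.1) &&
  ((if w.1 then (w.2, w'.2) else (w'.2, w.2)) \in zip (aargs a.1) (aargs b.1)).
Definition strict (w w' : bool * var) : bool :=
  (w.1 == w'.1) && existential w && (w'.2 \in step_args w).
Definition edge (x y : node) : bool :=
  ((x.2 == y.2) && plain x.1 y.1) || (y.2 && strict x.1 y.1).

Definition clash_from (x : node) : bool :=
  has (fun y => if y.2 then y.1 == x.1 else (y.1 != x.1) && existential y.1)
      (reach edge nodes x).
Definition clash : bool :=
  has (fun w => existential w && clash_from (w, false)) keys.

Lemma mem_nodes w f : ((w, f) \in nodes) = (w \in keys).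
Proof.
rewrite mem_cat.
have inj (g : bool) : injective (fun w : bool * var => (w, g)) by move=> u v [].
case: f; [rewrite (mem_map (inj true)) | rewrite (mem_map (inj false))].
  by case h: (_ \in map _ _) => //; case/mapP: h => ? _ [].
by rewrite orbC; case h: (_ \in map _ _) => //; case/mapP: h => ? _ [].
Qed.

Lemma mem_keys sd v : ((sd, v) \in keys) = (v \in aargs (side sd).1).
Proof.
rewrite mem_cat; have inj (g : bool) : injective (fun v : var => (g, v)) by move=> u v' [].
case: sd; [rewrite (mem_map (inj true)) | rewrite (mem_map (inj false))].
  by case h: (_ \in map _ _); [case/mapP: h => ? _ [] | rewrite orbF].
by case h: (_ \in map _ _) => //; case/mapP: h => ? _ [].
Qed.

Section Sound.
Variables (F : bool -> var -> seq nat -> nat) (s : bool -> var -> nat).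
Hypothesis F_inj : forall sd sd' v v' l l', F sd v l = F sd' v' l' -> sd = sd' /\ v = v'.
Hypothesis F_gt : forall sd v l n, n \in l -> n < F sd v l.
Hypothesis instF : forall sd, skolem_inst (F sd) (lpre (side sd)) [::] (s sd).
Hypothesis common : map (s true) (aargs a.1) = map (s false) (aargs b.1).

(** The numbers play the role of terms: each determines its Skolem function and exceeds its
    arguments. Along a path the value stays the same until a strict step is made and is smaller from
    then on. A flagged return to the start would give [n < n], an unflagged arrival at another
    existential variable two functions for one value. *)
Lemma clash_no_common_instance : clash -> False.
Proof.
case/hasP=> w hw /andP [ew /hasP [y hy cy]].
pose val (w : bool * var) := s w.1 w.2.
have exF w' : existential w' -> val w' = F w'.1 w'.2 (map (s w'.1) (step_args w')).
  by move/(instF (sd := w'.1)).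
have zipP u v : (u, v) \in zip (aargs a.1) (aargs b.1) -> s true u = s false v.
  move: common; elim: (aargs a.1) (aargs b.1) => [|x l IH] [|y' l'] //= [e1 e2].
  by rewrite inE => /orP [/eqP [-> ->]|/IH]; last exact.
have inv y' : y' \in reach edge nodes (w, false) ->
    if y'.2 then val y'.1 < val w else val y'.1 == val w.
  apply: (reach_ind (P := fun y' : node => if y'.2 then val y'.1 < val w else val y'.1 == val w));
    [exact: eqxx | | by rewrite mem_nodes].
  move=> [u f] [[sd v] f'] _ hu /orP [/andP [/= /eqP <-] pl _|/andP [/= ->]] /=.
    suff -> : val (sd, v) = val u by [].
    case: u pl {hu} => sd' v'; rewrite /plain /val /=.
    by case: sd'; case: sd => //= /zipP ->.
  case/andP=> /andP [/eqP e1 exu] hv _.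
  have lt : val (sd, v) < val u.
    move: e1 => /= e1; rewrite (exF _ exu); apply: F_gt; rewrite /val /= -e1; exact: map_f.
  by apply: leq_trans lt _; case: f hu => [/ltnW|/eqP ->].
move: cy (inv y hy); case: y.2.
  by move/eqP=> ->; rewrite ltnn.
case/andP=> ne ey; rewrite (exF _ ey) (exF _ ew) => /eqP /F_inj [e1 e2].
by case/negP: ne; rewrite [y.1]surjective_pairing [w]surjective_pairing e1 e2.
Qed.
End Sound.

Section Complete.
Hypothesis wf_a : wf_patom a.1.
Hypothesis wf_b : wf_patom b.1.
Hypothesis same_size : size (aargs a.1) = size (aargs b.1).
Hypothesis no_clash : ~~ clash.
Variables (D : Type) (d0 : D) (F : bool -> var -> seq D -> D).

Let wf sd : wf_patom (side sd).1. Proof. by case: sd. Qed.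

Definition equi w w' := ((w', false) : node) \in reach edge nodes (w, false).
Definition below w w' := ((w', true) : node) \in reach edge nodes (w, false).

Lemma plain_keys w w' : plain w w' -> w' \in keys.
Proof.
case: w w' => [sd v] [sd' v'] /andP [/= ns]; rewrite mem_keys.
have zipP u l (l' : seq var) u' : (u, u') \in zip l l' -> (u \in l) && (u' \in l').
  elim: l l' => [|x l IH] [|y l'] //=; rewrite !inE => /orP [/eqP [-> ->]|/IH /andP [-> ->]].
    by rewrite !eqxx.
  by rewrite !orbT.
by case: sd ns; case: sd' => // _ /zipP /andP [].
Qed.

Lemma plain_sym w w' : plain w w' = plain w' w.
Proof. by case: w w' => [[] v] [[] v']. Qed.

Lemma strict_keys w w' : strict w w' -> w' \in keys.
Proof.
case: w w' => [sd v] [sd' v'] /andP [/andP [/eqP /= -> _]] /bf_sub.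
by rewrite pvars_lpre // mem_keys.
Qed.

Lemma edge_lift x y : edge x y -> edge (x.1, true) (y.1, true).
Proof. by case/orP=> /andP [_ h]; apply/orP; [left|right]. Qed.

Lemma reach_lift x y : x \in nodes -> y \in reach edge nodes x ->
  (y.1, true) \in reach edge nodes (x.1, true).
Proof.
move=> hx; have hx' : (x.1, true) \in nodes by rewrite mem_nodes -(mem_nodes _ x.2) -surjective_pairing.
apply: (reach_ind (P := fun y => (y.1, true) \in reach edge nodes (x.1, true))) => //.
  exact: reach_refl.
move=> u z _ hu /edge_lift euz hz; apply: reach_step euz _ => //.
by rewrite mem_nodes -(mem_nodes _ z.2) -surjective_pairing.
Qed.

Lemma equi_refl w : w \in keys -> equi w w.
Proof. by move=> hw; apply: reach_refl; rewrite mem_nodes. Qed.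

Lemma equi_mem w w' : w \in keys -> equi w w' -> w' \in keys.
Proof. by rewrite -!(mem_nodes _ false); apply: reach_mem. Qed.

Lemma equi_trans w w' w'' : w \in keys -> equi w w' -> equi w' w'' -> equi w w''.
Proof. by move=> hw; apply: reach_trans; rewrite mem_nodes. Qed.

(** A flag is never lowered and a strict step raises it. Hence an unflagged path has plain steps
    only, and these can be reversed. *)
Lemma equi_sym w w' : w \in keys -> equi w w' -> equi w' w.
Proof.
move=> hw; have hw' : (w, false) \in nodes by rewrite mem_nodes.
move=> h; suff H y : y \in reach edge nodes (w, false) -> ~~ y.2 -> equi y.1 w by exact: (H (w', false)).
apply: (reach_ind (P := fun y : node => ~~ y.2 -> equi y.1 w)) => // [_|]; first exact: equi_refl.
move=> [u f] [z f'] hu IH /= euz hz; case: f' euz hz => // euz hz _.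
have [fF pl] : f = false /\ plain u z by case/orP: euz => /andP [] // /eqP.
have uk : u \in keys by rewrite -(mem_nodes _ f); exact: reach_mem hu.
have zk : z \in keys := plain_keys pl.
apply: (equi_trans zk) (IH _); last by rewrite fF.
apply: (@reach_step _ _ _ _ (z, false)); rewrite ?mem_nodes //.
  by apply: reach_refl; rewrite mem_nodes.
by rewrite /edge /= plain_sym pl.
Qed.

Lemma below_mem w w' : w \in keys -> below w w' -> w' \in keys.
Proof. by move=> hw; rewrite -(mem_nodes w' true); apply: reach_mem; rewrite mem_nodes. Qed.

Lemma below_trans w w' w'' : w \in keys -> below w w' -> below w' w'' -> below w w''.
Proof.
move=> hw h1 h2; apply: (reach_trans _ h1); first by rewrite mem_nodes.
by apply: (@reach_lift (w', false) (w'', true)); rewrite // mem_nodes (below_mem hw).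
Qed.

Lemma equi_below w w' w'' : w \in keys -> equi w w' -> below w' w'' -> below w w''.
Proof. by move=> hw; apply: reach_trans; rewrite mem_nodes. Qed.

Lemma strict_below w w' : w \in keys -> strict w w' -> below w w'.
Proof.
move=> hw h; have hN : (w, false) \in nodes by rewrite mem_nodes.
apply: (reach_step hN (reach_refl _ hN)); rewrite ?mem_nodes; last exact: strict_keys h.
by rewrite /edge /= h.
Qed.

Lemma existential_equi w w' : w \in keys -> existential w -> existential w' ->
  equi w w' -> w' = w.
Proof.
move=> hw ew ew' h; apply: contraNeq no_clash => ne; apply/hasP; exists w; rewrite // ew.
by apply/hasP; exists (w', false); rewrite //= ne.
Qed.

(** [clash] searches only from existential variables. A flagged cycle at [w] begins with plain steps
    to some existential [e], where its first strict step starts; rotated, it becomes a cycle at [e],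
    which [clash] would have found. *)
Lemma below_irr w : w \in keys -> ~~ below w w.
Proof.
move=> hw; apply/negP => h.
have [e [u [he ee se hu]]] : exists e u, [/\ equi w e, existential e, strict e u
    & ((w, true) : node) \in reach edge nodes (u, true)].
  have H y : y \in reach edge nodes (w, false) -> if y.2 then
      exists e u, [/\ equi w e, existential e, strict e u & y \in reach edge nodes (u, true)]
      else equi w y.1.
    apply: (reach_ind (P := fun y : node => if y.2 then
      exists e u, [/\ equi w e, existential e, strict e u & y \in reach edge nodes (u, true)]
      else equi w y.1)); last by rewrite mem_nodes.
      exact: equi_refl.
    move=> [x f] [z f'] hx IH exz hz /=; case: f' exz hz => exz hz; last first.
      have [fF pl] : f = false /\ plain x z by case/orP: exz => /andP [] // /eqP.
      rewrite fF in hx; apply: reach_step hx _ hz; first by rewrite mem_nodes.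
      by rewrite /edge /= pl.
    case: f hx IH exz => hx /= IH exz.
      have [e [u [h1 h2 h3 h4]]] := IH; exists e, u; split=> //.
      apply: reach_step h4 exz hz; rewrite mem_nodes; exact: strict_keys h3.
    case/orP: exz => /andP [] //= _ st; exists x, z; split=> //.
      by case/andP: st => /andP [].
    exact: reach_refl.
  exact: (H (w, true)).
have ek := equi_mem hw he.
have : below e e.
  apply: (reach_trans _ (strict_below ek se)); first by rewrite mem_nodes.
  apply: (reach_trans _ hu); first by rewrite mem_nodes; exact: strict_keys se.
  by apply: (@reach_lift (w, false) (e, false)); rewrite // mem_nodes.
move=> hb; case/negP: no_clash; apply/hasP; exists e; rewrite // ee.
by apply/hasP; exists (e, true); rewrite //= eqxx.
Qed.

(** A measure that drops along [below]: it shows that the recursion of [value] ends before its depth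
    bound runs out. *)
Definition rank w := count (below w) keys.

Lemma below_rank w w' : w \in keys -> below w w' -> rank w' < rank w.
Proof.
move=> hw h; have hw' := below_mem hw h.
apply: (count_ltn (z := w')) => //; last exact: below_irr.
by move=> z; exact: below_trans.
Qed.

(* The value of a class of variables that must be equal: the Skolem function of
   its existential variable, if any; the first argument bounds the depth. *)
Fixpoint value (k : nat) (w : bool * var) : D :=
  if k is k'.+1 then
    if [seq e <- keys | existential e && equi w e] is e :: _ then
      F e.1 e.2 [seq value k' (e.1, u) | u <- step_args e]
    else d0
  else d0.

Lemma value_equi k w w' : w \in keys -> equi w w' -> value k w = value k w'.
Proof.
move=> hw h; case: k => //= k; have hw' := equi_mem hw h.
rewrite (@eq_in_filter _ _ (fun e => existential e && equi w' e)) // => e he.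
congr andb; apply/idP/idP => h'; last exact: equi_trans h h'.
exact: equi_trans (equi_sym hw h) h'.
Qed.

Lemma value_stable k k' w : w \in keys -> rank w < k -> rank w < k' ->
  value k w = value k' w.
Proof.
elim: k k' w => // k IH [|k'] w hw //; rewrite !ltnS => hk hk' /=.
case E: [seq _ <- _ | _] => [|e l] //.
have : e \in [seq e <- keys | existential e && equi w e] by rewrite E mem_head.
rewrite mem_filter => /andP [/andP [ee he] ek]; congr F.
apply/eq_in_map => u hu; have st : strict e (e.1, u) by rewrite /strict /= eqxx ee.
have lt : rank (e.1, u) < rank w.
  exact: below_rank (equi_below hw he (strict_below ek st)).
by apply: IH; [exact: strict_keys st | exact: leq_trans lt hk | exact: leq_trans lt hk'].
Qed.

Definition final_value sd v := value (size keys).+1 (sd, v).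

(** [F] is arbitrary on an arbitrary domain: the unifier is not built as a set of terms but
    evaluated at once with the given Skolem functions. *)
Lemma final_inst sd : skolem_inst (F sd) (lpre (side sd)) [::] (final_value sd).
Proof.
move=> v hv /=; have hk : (sd, v) \in keys.
  by rewrite mem_keys -pvars_lpre //; apply/mapP; exists (true, v).
have ex : existential (sd, v) by [].
have rk w : rank w < (size keys).+1 by rewrite ltnS count_size.
(* One more unit of depth on the left, so that unfolding [value] once leaves the arguments at the
   depth of [final_value]. *)
rewrite /final_value (@value_stable _ (size keys).+2) //; last exact: leqW.
rewrite [LHS]/=; case E: [seq _ <- _ | _] => [|e l].
  have : (sd, v) \in [seq e <- keys | existential e && equi (sd, v) e].
    by rewrite mem_filter ex equi_refl.
  by rewrite E.
have : e \in [seq e <- keys | existential e && equi (sd, v) e] by rewrite E mem_head.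
rewrite mem_filter => /andP [/andP [ee he] ek].
by have -> := existential_equi hk ex ee he.
Qed.

Lemma final_common : map (final_value true) (aargs a.1) = map (final_value false) (aargs b.1).
Proof.
apply: (@eq_from_nth _ d0) => [|i]; first by rewrite !size_map.
rewrite size_map => hi; have hi' : i < size (aargs b.1) by rewrite -same_size.
rewrite !(nth_map [::]) //; apply: value_equi; first by rewrite mem_keys mem_nth.
have kT : ((true, nth [::] (aargs a.1) i), false) \in nodes by rewrite mem_nodes mem_keys mem_nth.
apply: (reach_step kT (reach_refl _ kT)); last by rewrite mem_nodes mem_keys mem_nth.
rewrite /edge /plain /= -nth_zip // mem_nth // size_zip same_size minnn //.
Qed.

End Complete.
End Pair.

(** * Satisfiability of sets of literals *)

Lemma pq_cat D p1 p2 P (s : var -> D) : pq (p1 ++ p2) P s <-> pq p1 (pq p2 P) s.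
Proof.
elim: p1 s => //= -[[] x] p1 IH s.
  by split=> -[d /IH h]; exists d.
by split=> h d; apply/IH.
Qed.

Lemma pq_const D (d0 : D) pre (P : (var -> D) -> Prop) c s :
  (forall s, P s <-> c) -> pq pre P s <-> c.
Proof.
move=> h; elim: pre s => //= -[[] x] pre IH s; split.
- by case=> d /IH.
- by move=> hc; exists d0; apply/IH.
- by move/(_ d0)/IH.
- by move=> hc d; apply/IH.
Qed.

Lemma pq_ext D (xs : seq var) pre (P : (var -> D) -> Prop) s s' :
  (forall u u', {in xs, u =1 u'} -> P u <-> P u') ->
  (forall v, v \in xs -> v \notin pvars pre -> s v = s' v) ->
  pq pre P s <-> pq pre P s'.
Proof.
move=> hP; elim: pre s s' => [|[b x] pre IH] s s' /= h.
  by apply: hP => v hv; apply: h.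
have hu d : pq pre P (update s x d) <-> pq pre P (update s' x d).
  apply: IH => v hv nv; rewrite /update; case: eqP => // /eqP vx.
  by apply: h => //; rewrite inE negb_or vx.
by case: b; split; [case=> d /hu | case=> d /hu | move=> h' d; apply/hu | move=> h' d; apply/hu];
  first [by exists d | exact: h'].
Qed.

Lemma asat_ext M a (s s' : var -> dom M) : wf_patom a ->
  {in afree a, s =1 s'} -> asat s a <-> asat s' a.
Proof.
case=> _ _ sz h; apply: (pq_ext (xs := aargs a)).
  by move=> u u' e; exact: base_sat_ext.
by move=> v hv nv; apply: h; rewrite mem_afree hv.
Qed.

(** The default [g] of [last] is for an equation without quantifiers: its variables are free and can
    be chosen to realize the guess. *)
Definition eq_value (a : patom) (g : bool) : bool :=
  (nth [::] (aargs a) 0 == nth [::] (aargs a) 1) || last g [seq q.1 | q <- apre a].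

Section Equality.
Variables (M : model) (a : patom).
Hypothesis wf : wf_patom a.
Hypothesis eq_a : asym a = None.

(* Over a domain with two elements the innermost quantifier of an equation
   between distinct variables decides. *)
Lemma asat_eq (s : var -> dom M) (g : bool) : (exists d1 d2 : dom M, d1 <> d2) ->
  (nth [::] (aargs a) 0 != nth [::] (aargs a) 1 -> apre a = [::] -> g <-> base_sat a s) ->
  asat s a <-> eq_value a g.
Proof.
case=> d1 [d2 nd]; have [un sub /(_ eq_a) sz] := wf.
rewrite /asat /eq_value /base_sat eq_a.
case: (aargs a) sub sz => [|x [|y [|]]] //= sub _.
case: (x =P y) => [->|nxy] /=; first by move=> _; apply: (pq_const d1).
move=> h0; elim/last_ind: (apre a) un sub h0 => [|pre [b z] _] un sub h0 /=.
  by rewrite h0.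
rewrite map_rcons last_rcons -cats1 pq_cat; apply: (pq_const d1) => s'.
have : z \in [:: x; y] by apply: sub; apply/mapP; exists (b, z); rewrite // mem_rcons mem_head.
rewrite !inE; have nyx : y == x = false by apply/eqP => e; exact: nxy.
have nxy' : x == y = false by apply/eqP.
case/orP=> /eqP ->; case: (b) => /=; rewrite /update eqxx ?nyx ?nxy'; split=> //.
- by move=> _; exists (s' y).
- by move=> h; case: nd; rewrite (h d1) (h d2).
- by move=> _; exists (s' x).
- by move=> h; case: nd; rewrite -(h d1) -(h d2).
Qed.
End Equality.

Definition same_symbol (l l' : patom * bool) : bool :=
  (asym l'.1 == asym l.1) && (size (aargs l'.1) == size (aargs l.1)).

Definition check_one (L : seq (patom * bool)) : bool :=
  all (fun l => if asym l.1 is Some _ then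
                  all (fun l' => same_symbol l l' ==> (l'.2 == l.2)) L
                else l.2) L.

(** A [clash] is desired here: it says that two opposite literals do not unify, hence do not
    contradict each other. *)
Definition check_many (L : seq (patom * bool)) : bool :=
  all (fun l => if asym l.1 is Some _ then
                  all (fun l' => [&& l.2, ~~ l'.2 & same_symbol l l'] ==> clash l l') L
                else l.2 == eq_value l.1 l.2) L.

Section Consistency.
Variable L : seq (patom * bool).
Hypothesis wf_L : forall l, l \in L -> wf_patom l.1.
Let l0 : patom * bool := (((None, [::]), ([::], true)), true).
Hypothesis disjoint_L : forall i j z, i < size L -> j < size L ->
  z \in afree (nth l0 L i).1 -> z \in afree (nth l0 L j).1 -> i = j.

Definition consistent : Prop :=
  exists (M : model) (s : var -> dom M), forall l, l \in L -> l.2 <-> asat s l.1.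

Lemma check_one_complete (M : model) (s : var -> dom M) :
  (forall d d' : dom M, d = d') -> (forall l, l \in L -> l.2 <-> asat s l.1) -> check_one L.
Proof.
move=> one h.
have base l : l \in L -> l.2 <-> base_sat l.1 s.
  move=> hl; rewrite h // /asat; apply: (pq_const (s [::])) => s'.
  by rewrite (_ : s' = s) //; apply/funext => v; exact: one.
apply/allP => l hl; case E: (asym l.1) => [R|].
  apply/allP => l' hl'; apply/implyP => /andP [/eqP e1 /eqP e2].
  have e : map s (aargs l'.1) = map s (aargs l.1).
    by apply: (@eq_from_nth _ (s [::])) => [|i _]; rewrite ?size_map //; exact: one.
  have := base l' hl'; have := base l hl; rewrite /base_sat e1 E e.
  by move=> h1 h2; apply/eqP; apply/idP/idP => [/h2/h1|/h1/h2].
by apply/base => //; rewrite /base_sat E; exact: one.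
Qed.

Lemma check_one_sound : check_one L -> consistent.
Proof.
move/allP=> h.
pose M := @Model unit (inhabits tt) (fun n R _ => exists2 l, l \in L &
  [/\ asym l.1 = Some R, size (aargs l.1) = n & l.2]).
exists M, (fun=> tt) => l hl; have := h l hl.
rewrite /asat; have wf := wf_L hl.
suff hb : (if asym l.1 is Some _ then all (fun l' => same_symbol l l' ==> (l'.2 == l.2)) L
     else l.2) -> l.2 <-> base_sat (M := M) l.1 (fun=> tt).
  move=> /hb ->; symmetry; apply: (@pq_const unit tt) => s.
  by apply: base_sat_ext => [|v _]; [case: wf | case: (s v)].
rewrite /base_sat; case E: (asym l.1) => [R|]; last by move=> ->.
move/allP=> hall; rewrite /interpL /= size_map; split=> [g|[l' hl' [e1 e2 g']]].
  by exists l.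
by have := hall l' hl'; rewrite /same_symbol e1 E e2 !eqxx /= => /eqP <-.
Qed.

(** If two opposite literals did not clash, evaluating their unifier with Skolem functions from [M]
    would give one argument tuple of which the relation must both hold and fail. *)
Lemma check_many_complete (M : model) (s : var -> dom M) (d1 d2 : dom M) : d1 <> d2 ->
  (forall l, l \in L -> l.2 <-> asat s l.1) -> check_many L.
Proof.
move=> nd h; apply/allP => l hl; case E: (asym l.1) => [R|]; last first.
  have := asat_eq (wf_L hl) E (s := s) (g := l.2).
  case/(_ (ex_intro _ d1 (ex_intro _ d2 nd))) => [_ e|h1 h2].
    by rewrite h // /asat e.
  by apply/eqP; apply/idP/idP => [/(h l hl)|hv]; [exact: h1 | apply/(h l hl)/h2].
apply/allP => l' hl'; apply/implyP => /and3P [g ng /andP [/eqP e1 /eqP e2]].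
apply: contrapT => /negP nc.
have [F hF] := skolem_of_literal (wf_L hl) (h l hl).
have [F' hF'] := skolem_of_literal (wf_L hl') (h l' hl').
pose G (sd : bool) := if sd then F else F'.
have inst := final_inst (wf_L hl) (wf_L hl') nc d1 G.
have := final_common (esym e2) d1 G.
move: (hF _ (inst true)) (hF' _ (inst false)).
rewrite /base_sat E e1 E => h1 h2 e; case/negP: ng; apply/h2; rewrite -e.
exact/h1.
Qed.

(** Numbers as ground terms: the code of the list of a function symbol and its arguments. List codes
    are injective and exceed their entries, as [clash_no_common_instance] demands. The index [i]
    keeps the Skolem functions of different literals apart. *)
Definition skolem_term (i : nat) (v : var) (args : seq nat) : nat :=
  CodeSeq.code (pickle (i, v : seq bool) :: args).

Lemma skolem_term_inj i v args i' v' args' :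
  skolem_term i v args = skolem_term i' v' args' -> i = i' /\ v = v'.
Proof.
move/(can_inj CodeSeq.codeK) => [/(pcan_inj (@pickleK (nat * seq bool)%type))].
by case=> -> ->.
Qed.

Lemma skolem_term_gt i v args n : n \in args -> n < skolem_term i v args.
Proof.
move=> hn; have /allP := CodeSeq.gtn_decode (skolem_term i v args).
by rewrite CodeSeq.codeK; apply; rewrite inE hn orbT.
Qed.

Definition owner (z : var) : nat := find (fun l => z \in afree l.1) L.

Lemma owner_nth i z : i < size L -> z \in afree (nth l0 L i).1 -> owner z = i.
Proof.
move=> hi hz; have hh : has (fun l => z \in afree l.1) L.
  by apply/hasP; exists (nth l0 L i); rewrite // mem_nth.
by apply: (disjoint_L (z := z)) => //; [rewrite -has_find | exact: (nth_find l0 hh)].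
Qed.

(** The least Herbrand model of the literals guessed true: a relation holds of their Skolem
    instances only. *)
Definition term_model : model := @Model nat (inhabits 0) (fun n R tup =>
  exists i s', [/\ i < size L, asym (nth l0 L i).1 = Some R, (nth l0 L i).2,
    skolem_inst (skolem_term i) (lpre (nth l0 L i)) [::] s'
    & map s' (aargs (nth l0 L i).1) = tup]).

(** Free variables are distinct Skolem constants, which falsifies the unquantified equations guessed
    false. The free variables of an equation guessed true all get 0 instead, so that its two sides
    agree. *)
Definition term_assignment (z : var) : nat :=
  let l := nth l0 L (owner z) in
  if (asym l.1 == None) && l.2 then 0 else skolem_term (owner z) z [::].

Lemma check_many_sound : check_many L -> consistent.
Proof.
move/allP=> h; exists term_model, term_assignment => l hl; have := h l hl.
have wf := wf_L hl.
have [i hi el] : exists2 i, i < size L & nth l0 L i = l by apply/(nthP l0).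
case E: (asym l.1) => [R|]; last first.
  move/eqP=> hv; rewrite {1}hv; symmetry; apply: asat_eq => //; first by exists 0, 1.
  move=> nxy pre0; rewrite /base_sat E /term_assignment.
  have fr z : z \in aargs l.1 -> owner z = i.
    by move=> hz; apply: owner_nth => //; rewrite el mem_afree hz pre0.
  have [_ _ /(_ E) sz] := wf.
  rewrite !fr ?mem_nth ?sz // el E /=; case: l.2 => //.
  by split=> // /skolem_term_inj [_ e]; rewrite e eqxx in nxy.
move=> /allP hc; apply: (literal_of_skolem (M := term_model) (F := skolem_term i)) => //.
  move=> z hz; have oz : owner z = i by apply: owner_nth; rewrite ?el.
  by rewrite /term_assignment oz el E.
move=> s' hs'; rewrite /base_sat E /interpL /=; split=> [g|].
  by exists i, s'; split; rewrite ?el.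
case=> j [s2 [hj Ej gj hs2 e]]; apply: contrapT => /negP ng.
have hl' : nth l0 L j \in L by exact: mem_nth.
have := h _ hl'; rewrite Ej => /allP /(_ l hl) /implyP; rewrite gj ng /same_symbol E Ej eqxx.
have -> : size (aargs l.1) == size (aargs (nth l0 L j).1).
  by rewrite -(size_map s' (aargs l.1)) -(size_map s2 (aargs (nth l0 L j).1)) e.
(* The two literals have opposite values, so they are different and have different Skolem
   functions. *)
move/(_ isT); have ij : i <> j by move=> e'; rewrite -e' el (negPf ng) in gj.
apply: (@clash_no_common_instance _ _ (fun sd => skolem_term (if sd then j else i))
          (fun sd => if sd then s2 else s')).
- move=> sd sd' v v' u u' /skolem_term_inj [e1 e2]; split=> //.
  by case: sd sd' e1 => [] [] // e1; case: ij.
- by move=> sd; exact: skolem_term_gt.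
- by case.
- by rewrite e.
Qed.

Lemma consistentP : consistent <-> check_one L \/ check_many L.
Proof.
split=> [[M [s h]]|[]]; [|exact: check_one_sound|exact: check_many_sound].
have [one|two] := pselect (forall d d' : dom M, d = d').
  by left; apply: check_one_complete one h.
right; have [d1 [d2 nd]] : exists d1 d2 : dom M, d1 <> d2.
  apply: contrapT => hn; apply: two => d1 d2; apply: contrapT => nd.
  by apply: hn; exists d1, d2.
exact: check_many_complete nd h.
Qed.

End Consistency.

(** * Formulas of F as Boolean combinations of prefixed atoms *)

Definition flip (a : patom) : patom := (a.1, (a.2.1, ~~ a.2.2)).

(* Under an odd number of negations an existential quantifier reaches the atom
   as a universal one; it is dropped where its variable is not free. *)
Definition addq (x : var) (a : patom) : patom :=
  if x \in afree a then (a.1, ((a.2.2, x) :: a.2.1, a.2.2)) else a.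

(* The atoms are listed from right to left, the order in which they are met when
   the encoding is read backwards. *)
Fixpoint atoms (phi : formula) : seq patom :=
  match phi with
  | Rel _ R xs => [:: ((Some (R : seq bool), tval xs), ([::], true))]
  | Equ x y => [:: ((None, [:: x; y]), ([::], true))]
  | And p q => atoms q ++ atoms p
  | Not p => map flip (atoms p)
  | Ex x p => map (addq x) (atoms p)
  end.

Fixpoint evb (phi : formula) (k : nat) (t : nat -> bool) : bool :=
  match phi with
  | Rel _ _ _ | Equ _ _ => t k
  | And p q => evb p (k + size (atoms q)) t && evb q k t
  | Not p => ~~ evb p k t
  | Ex _ p => evb p k t
  end.

Definition atom0 : patom := ((None, [::]), ([::], true)).

Lemma mem_afree_addq x a z : (z \in afree (addq x a)) = (z \in afree a) && (z != x).
Proof.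
rewrite /addq; case: ifP => hx; rewrite !mem_afree /=.
  by rewrite inE negb_or; case: (z != x); rewrite ?andbF ?andbT.
case: eqP => [->|_]; rewrite ?andbT ?andbF //.
by move: hx; rewrite mem_afree.
Qed.

Lemma apol_addq x a : apol (addq x a) = apol a.
Proof. by rewrite /addq; case: ifP. Qed.

Lemma wf_addq x a : wf_patom a -> wf_patom (addq x a).
Proof.
case=> un sub sz; rewrite /addq; case: ifP => // hx; move: hx; rewrite mem_afree => /andP [hx nx].
split=> //=; first by rewrite nx.
by move=> z; rewrite inE => /orP [/eqP ->|/sub].
Qed.

Lemma wf_atoms phi a : a \in atoms phi -> wf_patom a.
Proof.
elim: phi a => [n R xs|x y|p IHp q IHq|p IHp|x p IHp] a /=.
- by rewrite inE => /eqP ->; split.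
- by rewrite inE => /eqP ->; split.
- by rewrite mem_cat => /orP [/IHq|/IHp].
- by case/mapP=> b /IHp wf ->; case: wf.
- by case/mapP=> b /IHp wf ->; exact: wf_addq.
Qed.

Lemma mem_Free phi z : (z \in Free phi) = has (fun a => z \in afree a) (atoms phi).
Proof.
elim: phi => [n R xs|x y|p IHp q IHq|p IHp|x p IHp] /=.
- by rewrite orbF mem_afree andbT.
- by rewrite orbF mem_afree andbT.
- by rewrite mem_cat has_cat IHp IHq orbC.
- by rewrite has_map IHp.
- rewrite mem_filter IHp has_map; elim: (atoms p) => /= [|a s IH]; first by rewrite andbF.
  by rewrite mem_afree_addq -IH andb_orr andbC.
Qed.

Lemma disjoint_atoms phi i j z : fragF phi -> i < size (atoms phi) -> j < size (atoms phi) ->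
  z \in afree (nth atom0 (atoms phi) i) -> z \in afree (nth atom0 (atoms phi) j) -> i = j.
Proof.
move=> F; elim: F i j => [n R xs|x y|p q _ IHp _ IHq dis|p _ IHp|x p _ IHp] i j /=.
- by case: i j => [|i] [|j].
- by case: i j => [|i] [|j].
- rewrite size_cat !nth_cat => hi hj.
  have no k l : k < size (atoms q) -> l < size (atoms p) ->
      z \in afree (nth atom0 (atoms q) k) -> z \in afree (nth atom0 (atoms p) l) -> i = j.
    move=> hk hl zk zl; case: (dis z); rewrite !mem_Free; split; apply/hasP.
      by exists (nth atom0 (atoms p) l); rewrite ?mem_nth.
    by exists (nth atom0 (atoms q) k); rewrite ?mem_nth.
  case: ltnP => ki; case: ltnP => kj zi zj.
  + exact: IHq.
  + by apply: no zi zj => //; lia.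
  + by apply: no zj zi => //; lia.
  + have : i - size (atoms q) = j - size (atoms q) by apply: IHp => //; lia.
    by lia.
- by rewrite size_map => hi hj; rewrite !(nth_map atom0) // => *; exact: IHp.
- rewrite size_map => hi hj; rewrite !(nth_map atom0) // !mem_afree_addq.
  by case/andP=> zi _ /andP [zj _]; exact: IHp.
Qed.

(** Each negation flips the polarity of the atoms below it, so a formula is monotone in the atoms of
    polarity [true] and antitone in the others. *)
Lemma evb_mono phi k (t t' : nat -> bool) :
  (forall i, i < size (atoms phi) ->
     if apol (nth atom0 (atoms phi) i) then t (k + i) -> t' (k + i)
     else t' (k + i) -> t (k + i)) ->
  evb phi k t -> evb phi k t'.
Proof.
elim: phi k t t' => [n R xs|x y|p IHp q IHq|p IHp|x p IHp] k t t' /= h.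
- by have := h 0 isT; rewrite addn0.
- by have := h 0 isT; rewrite addn0.
- case/andP=> hp hq; apply/andP; split.
    apply: IHp hp => i hi; have := h (size (atoms q) + i).
    rewrite size_cat ltn_add2l hi nth_cat ltnNge leq_addr /= addKn addnA; exact.
  apply: IHq hq => i hi; have := h i.
  rewrite size_cat nth_cat hi; apply; exact: ltn_addr.
- apply: contra; apply: IHp => i hi; have := h i.
  by rewrite size_map (nth_map atom0) // /apol /=; case: (_.2.2) => /=; apply.
- apply: IHp => i hi; have := h i.
  rewrite size_map (nth_map atom0) // => /(_ hi).
  by rewrite apol_addq.
Qed.

Lemma interpL_tuple M n (R : relsym n) (w : n.-tuple (dom M)) :
  @interp M n R w <-> interpL R (tval w).
Proof.
rewrite /interpL; have e := esym (size_tuple w).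
have -> : in_tuple w = tcast e w by apply: val_inj; rewrite /= val_tcast.
by case: _ / e.
Qed.

Lemma asat_addq M a x (s : var -> dom M) : x \in afree a ->
  asat s (addq x a) <->
  if apol a then exists d, asat (update s x d) a else forall d, asat (update s x d) a.
Proof. by rewrite /asat /addq => -> /=; rewrite /apol; case: a => [b [pre [] ]]. Qed.

(** At a quantifier over [x], the values [t] and those under an update of [x] can differ only at the
    one atom that has [x] free. There the quantifier added by [addq] is existential or universal
    according to polarity, which is the comparison that [evb_mono] accepts. *)
Lemma evb_sat phi M (s : var -> dom M) k (t : nat -> bool) : fragF phi ->
  (forall i, i < size (atoms phi) -> t (k + i) <-> asat s (nth atom0 (atoms phi) i)) ->
  evb phi k t <-> sat s phi.
Proof.
move=> F; elim: F s k t => [n R xs|x y|p q _ IHp _ IHq _|p _ IHp|x p Fp IHp] s k t /= h.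
- by have := h 0 isT; rewrite addn0 => ->; rewrite /asat /= interpL_tuple.
- by have := h 0 isT; rewrite addn0 => ->; rewrite /asat.
- rewrite -(IHp s (k + size (atoms q)) t) -?(IHq s k t).
  + by split=> [/andP|[-> ->]].
  + by move=> i hi; rewrite h ?size_cat ?ltn_addr // nth_cat hi.
  + by move=> i hi; rewrite -addnA h ?size_cat ?ltn_add2l // nth_cat ltnNge leq_addr /= addKn.
- rewrite -(IHp s k t) => [|i hi]; first by split=> /negP.
  by rewrite h ?size_map // (nth_map atom0).
pose td d i := `[< asat (update s x d) (nth atom0 (atoms p) (i - k)) >].
have htd d : evb p k (td d) <-> sat (update s x d) p.
  by apply: IHp => i hi; rewrite /td addKn; split=> /asboolP.
have h' i : i < size (atoms p) -> t (k + i) <-> asat s (addq x (nth atom0 (atoms p) i)).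
  by move=> hi; rewrite h ?size_map // (nth_map atom0).
have out d i : i < size (atoms p) -> x \notin afree (nth atom0 (atoms p) i) ->
    (t (k + i) : Prop) <-> td d (k + i).
  move=> hi nx; rewrite h' // /addq (negPf nx) /td addKn.
  have wf : wf_patom (nth atom0 (atoms p) i) by apply: (@wf_atoms p); exact: mem_nth.
  rewrite (@asat_ext _ _ s (update s x d) wf); first by split=> /asboolP.
  by move=> z hz; rewrite /update; case: eqP => // e; rewrite -e hz in nx.
split=> [ev|[d /htd]]; last first.
  apply: evb_mono => i hi; case hx: (x \in afree (nth atom0 (atoms p) i)); last first.
    by case: (apol _) => /(out d i hi (negbT hx)).
  have := h' i hi; rewrite asat_addq // /td addKn.
  case: (apol _) => e; first by move/asboolP=> hd; apply/e; exists d.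
  by move/e=> hd; apply/asboolP; exact: hd.
(* By [disjoint_atoms] at most one atom has [x] free, so a witness for that atom serves for all.
   Where its implication is void, or no such atom exists, the old value [s x] will do. *)
have [d hd] : exists d, forall i, i < size (atoms p) ->
    x \in afree (nth atom0 (atoms p) i) ->
    if apol (nth atom0 (atoms p) i) then t (k + i) -> td d (k + i)
    else td d (k + i) -> t (k + i).
  have [[i [hi hx]]|no] := pselect (exists i, i < size (atoms p) /\
      x \in afree (nth atom0 (atoms p) i)); last first.
    by exists (s x) => i hi hx; case: no; exists i.
  suff [d hd] : exists d, if apol (nth atom0 (atoms p) i) then t (k + i) -> td d (k + i)
      else td d (k + i) -> t (k + i).
    by exists d => j hj hxj; rewrite (disjoint_atoms Fp hj hi hxj hx).
  have := h' i hi; rewrite asat_addq // /td addKn; case: (apol _) => e.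
    case ti: (t _) e => e; last by exists (s x).
    by have [d hd] := proj1 e isT; exists d => _; exact/asboolP.
  case ti: (t _) e => e; first by exists (s x).
  apply: contrapT => hn; have // : false.
  by apply/e => d; apply: contrapT => nd; apply: hn; exists d => /asboolP.
exists d; apply/htd; apply: evb_mono ev => i hi.
case hx: (x \in afree (nth atom0 (atoms p) i)); first exact: hd.
by case: (apol _) => /(out d i hi (negbT hx)).
Qed.

Definition literals (phi : formula) (t : nat -> bool) : seq (patom * bool) :=
  mkseq (fun i => (nth atom0 (atoms phi) i, t i)) (size (atoms phi)).

Lemma satisfiable_fragF phi : fragF phi ->
  satisfiable phi <-> exists t, evb phi 0 t /\
    (check_one (literals phi t) \/ check_many (literals phi t)).
Proof.
move=> F.
have cons t : consistent (literals phi t) <->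
    (check_one (literals phi t) \/ check_many (literals phi t)).
  apply: consistentP => [l /mapP [i]|i j z].
    by rewrite mem_iota => hi ->; apply: (@wf_atoms phi); exact: mem_nth.
  rewrite size_mkseq => hi hj; rewrite !nth_mkseq //; exact: disjoint_atoms.
have lit M (s : var -> dom M) t :
    (forall l, l \in literals phi t -> l.2 <-> asat s l.1) <->
    (forall i, i < size (atoms phi) -> t (0 + i) <-> asat s (nth atom0 (atoms phi) i)).
  split=> [h i hi|h l /mapP [i]]; last by rewrite mem_iota => hi ->; exact: (h i).
  by apply: (h (nth atom0 (atoms phi) i, t i)); apply/mapP; exists i; rewrite // mem_iota.
split=> [[M [s hs]]|[t [ev /cons [M [s /lit hl]]]]]; last first.
  by exists M, s; apply/(evb_sat F hl).
pose t i := `[< asat s (nth atom0 (atoms phi) i) >].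
have ht i : i < size (atoms phi) -> t (0 + i) <-> asat s (nth atom0 (atoms phi) i).
  by move=> _; rewrite /t; split=> /asboolP.
exists t; split; first exact/(evb_sat F ht).
by apply/cons; exists M, s; apply/lit.
Qed.

(** * Reading a formula backwards *)

Definition flipL (l : patom * bool) : patom * bool := (flip l.1, l.2).
Definition addqL (x : var) (l : patom * bool) : patom * bool := (addq x l.1, l.2).

(* The value of a formula for the guessed truth values of its atoms, and these
   atoms. *)
Definition item : Type := bool * seq (patom * bool).

Definition frees (L : seq (patom * bool)) : seq var := flatten [seq afree l.1 | l <- L].
Definition disjoint_items (p q : item) : bool :=
  all (fun z => z \notin frees q.2) (frees p.2).

(* Bits and variables read since the last complete formula, the stack of complete
   formulas, and the guesses not used yet. *)
Definition rstate : Type := seq bool * (seq var * (seq item * seq bool)).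

Definition push_atom (o : option (seq bool)) (r : rstate) : rstate :=
  let g := head false r.2.2.2 in
  ([::], ([::], ((g, [:: (((o, r.2.1), ([::], true)), g)]) :: r.2.2.1, behead r.2.2.2))).

(** In prefix notation read from the right, the operands of a connective are complete when its token
    arrives. A stack then replaces recursive parsing, and every token is one case of a fold. *)
Definition read_token (t : token) (st : option rstate) : option rstate :=
  if st is Some r then
    match t with
    | TBit b => Some (b :: r.1, r.2)
    | TVar => Some ([::], (r.1 :: r.2.1, r.2.2))
    | TRel => Some (push_atom (Some r.1) r)
    | TEqu => if (size r.1 == 0) && (size r.2.1 == 2) then Some (push_atom None r) else None
    | TAnd => if (size r.1 == 0) && (size r.2.1 == 0) then
                if r.2.2.1 is p :: l then
                  if l is q :: l' then
                    if disjoint_items p q then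
                      Some ([::], ([::], ((p.1 && q.1, q.2 ++ p.2) :: l', r.2.2.2)))
                    else None
                  else None
                else None
              else None
    | TNot => if (size r.1 == 0) && (size r.2.1 == 0) then
                if r.2.2.1 is p :: l then
                  Some ([::], ([::], ((~~ p.1, map flipL p.2) :: l, r.2.2.2)))
                else None
              else None
    | TEx => if (size r.1 == 0) && (size r.2.1 == 1) then
               if r.2.2.1 is p :: l then
                 Some ([::], ([::], ((p.1, map (addqL (head [::] r.2.1)) p.2) :: l, r.2.2.2)))
               else None
             else None
    end
  else None.

Definition read (w : seq token) (ts : seq bool) : option rstate :=
  foldr read_token (Some ([::], ([::], ([::], ts)))) w.

Lemma read_cons t w ts : read (t :: w) ts = read_token t (read w ts).
Proof. by []. Qed.

Definition item_of (f : formula) (ts : seq bool) : item :=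
  (evb f 0 (nth false ts), literals f (nth false ts)).

(** Guesses are consumed from the right end of the text, so the formulas further to the right take
    theirs first. *)
Fixpoint items_of (fs : seq formula) (ts : seq bool) : seq item * seq bool :=
  if fs is f :: fs' then
    let r := items_of fs' ts in (item_of f r.2 :: r.1, drop (size (atoms f)) r.2)
  else ([::], ts).

Definition rstate_of bits vars fs ts : rstate := (bits, (vars, items_of fs ts)).

Lemma evb_shift f j k t : evb f (j + k) t = evb f j (fun i => t (i + k)).
Proof.
elim: f j k t => //= [p IHp q IHq|p IHp] j k t; last by rewrite IHp.
by rewrite addnAC IHp IHq.
Qed.

Lemma nth_drop_fun (ts : seq bool) n :
  nth false (drop n ts) = (fun i => nth false ts (i + n)).
Proof. by apply/funext => i; rewrite nth_drop addnC. Qed.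

Lemma literals_and f g ts : literals (And f g) (nth false ts) =
  literals g (nth false ts) ++ literals f (nth false (drop (size (atoms g)) ts)).
Proof.
rewrite /literals /mkseq /= size_cat iotaD map_cat; congr cat.
  by apply/eq_in_map => i; rewrite mem_iota => /andP [_ hi]; rewrite nth_cat hi.
rewrite -[0 + _]addn0 iotaDl -map_comp; apply: eq_map => i /=.
by rewrite add0n nth_cat ltnNge leq_addr /= addKn nth_drop.
Qed.

Lemma literals_not f t : literals (Not f) t = map flipL (literals f t).
Proof.
rewrite /literals /mkseq /= size_map -map_comp; apply/eq_in_map => i.
by rewrite mem_iota => hi /=; rewrite (nth_map atom0).
Qed.

Lemma literals_ex x f t : literals (Ex x f) t = map (addqL x) (literals f t).
Proof.
rewrite /literals /mkseq /= size_map -map_comp; apply/eq_in_map => i.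
by rewrite mem_iota => hi /=; rewrite (nth_map atom0).
Qed.

Lemma mem_frees f t z : (z \in frees (literals f t)) = (z \in Free f).
Proof.
rewrite mem_Free; apply/flatten_mapP/hasP => [[l /mapP [i]]|[a ha hz]].
  rewrite mem_iota => hi -> hz; exists (nth atom0 (atoms f) i) => //; exact: mem_nth.
have [i hi e] := nthP atom0 ha; exists (a, t i) => //.
by apply/mapP; exists i; rewrite ?mem_iota // e.
Qed.

Lemma disjoint_itemsP f g ts ts' :
  disjoint_items (item_of f ts) (item_of g ts') <->
  (forall x, ~ (x \in Free f /\ x \in Free g)).
Proof.
split=> [/allP h x [hf hg]|h].
  by have := h x; rewrite !mem_frees hf hg => /(_ isT).
by apply/allP => z; rewrite !mem_frees => hz; apply/negP => hg; exact: (h z).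
Qed.

Lemma read_rel bits vars fs ts :
  push_atom (Some bits) (rstate_of bits vars fs ts) =
  rstate_of [::] [::] (Rel (n := size vars) bits (in_tuple vars) :: fs) ts.
Proof. by rewrite /push_atom /rstate_of /= /item_of /= drop1 -nth0. Qed.

Lemma read_equ x y fs ts :
  push_atom None (rstate_of [::] [:: x; y] fs ts) = rstate_of [::] [::] (Equ x y :: fs) ts.
Proof. by rewrite /push_atom /rstate_of /= /item_of /= drop1 -nth0. Qed.

Lemma item_and f g ts :
  ((item_of f (drop (size (atoms g)) ts)).1 && (item_of g ts).1,
   (item_of g ts).2 ++ (item_of f (drop (size (atoms g)) ts)).2) = item_of (And f g) ts.
Proof. by rewrite /item_of literals_and /= evb_shift nth_drop_fun. Qed.

Lemma item_not f ts : (~~ (item_of f ts).1, map flipL (item_of f ts).2) = item_of (Not f) ts.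
Proof. by rewrite /item_of literals_not. Qed.

Lemma item_ex x f ts : ((item_of f ts).1, map (addqL x) (item_of f ts).2) = item_of (Ex x f) ts.
Proof. by rewrite /item_of literals_ex. Qed.

(** Every reachable state is a partial parse of the suffix read so far, which is what the induction
    on tokens carries along. The test at [TAnd] is the only restriction of the fragment, so
    membership in it is established on the way. *)
Lemma read_sound w ts r : read w ts = Some r -> exists bits vars fs,
  [/\ List.Forall fragF fs,
      w = map TBit bits ++ flatten (map encode_var vars) ++ flatten (map encode fs)
    & r = rstate_of bits vars fs ts].
Proof.
elim: w r => [|t w IH] r; first by case=> <-; exists [::], [::], [::]; split.
rewrite read_cons; case E: (read w ts) => [r0|] //.
have [bits [vars [fs [hF -> er]]]] := IH _ E; rewrite er /=.
case: t => [||||||b].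
- case=> <-; exists [::], [::], (Rel (n := size vars) bits (in_tuple vars) :: fs).
  by rewrite read_rel /= -catA; split=> //; constructor; first exact: F_Rel.
- by case=> <-; exists [::], (bits :: vars), fs; split; rewrite //= -catA.
- case: bits er => //= er; case: vars er => [|x [|y [|]]] //= er [<-].
  exists [::], [::], (Equ x y :: fs); rewrite read_equ; split=> //=.
    by constructor; first exact: F_Equ.
  by rewrite cats0 -!catA.
- case: bits er => //= er; case: vars er => //= er; case: fs hF er => [|f [|g fs]] //= hF er.
  case: ifP => // /disjoint_itemsP dis [<-]; exists [::], [::], (And f g :: fs).
  inversion_clear hF as [|? ? Ff hF']; inversion_clear hF' as [|? ? Fg hF].
  split; first by constructor => //; exact: F_And.
    by rewrite /= catA.
  rewrite /rstate_of /= -item_and /=.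
  by rewrite drop_drop size_cat addnC.
- case: bits er => //= er; case: vars er => //= er; case: fs hF er => [|f fs] //= hF er [<-].
  inversion_clear hF; exists [::], [::], (Not f :: fs).
  split=> //=; first by constructor => //; exact: F_Not.
  by rewrite /rstate_of /= -item_not /= size_map.
- case: bits er => //= er; case: vars er => [|x [|]] //= er; case: fs hF er => [|f fs] //= hF er [<-].
  inversion_clear hF; exists [::], [::], (Ex x f :: fs).
  split=> //=; first by constructor => //; exact: F_Ex.
    by rewrite cats0 -!catA.
  by rewrite /rstate_of /= -item_ex /= size_map.
by case=> <-; exists (b :: bits), vars, fs.
Qed.

Lemma read_cat w w' ts : read (w ++ w') ts = foldr read_token (read w' ts) w.
Proof. by rewrite /read foldr_cat. Qed.

Lemma read_bits bits w ts r : read w ts = Some r ->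
  read (map TBit bits ++ w) ts = Some (bits ++ r.1, r.2).
Proof.
move=> e; rewrite read_cat e; elim: bits => [|b bits IH] /=; first by case: r {e}.
by rewrite IH.
Qed.

Lemma read_vars vars w fs ts : read w ts = Some (rstate_of [::] [::] fs ts) ->
  read (flatten (map encode_var vars) ++ w) ts = Some (rstate_of [::] vars fs ts).
Proof.
move=> e; elim: vars => // x vars IH.
by rewrite [flatten _]/= cat_cons -catA read_cons (read_bits x IH) /= cats0.
Qed.

Lemma read_complete f w fs ts : fragF f -> read w ts = Some (rstate_of [::] [::] fs ts) ->
  read (encode f ++ w) ts = Some (rstate_of [::] [::] (f :: fs) ts).
Proof.
move=> F; elim: F w fs => [n R xs|x y|p q Fp IHp Fq IHq dis|p Fp IHp|x p Fp IHp] w fs h.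
- have := read_bits R (read_vars xs h); move=> e.
  rewrite [encode _]/= cat_cons -catA read_cons e /= cats0 read_rel.
  congr (Some (rstate_of _ _ (_ :: _) _)).
- have e := read_vars [:: x; y] h; rewrite [flatten _]/= cats0 in e.
  by rewrite [encode _]/= cat_cons read_cons e /= read_equ.
- have e := IHp _ _ (IHq _ _ h); rewrite [encode _]/= cat_cons -catA read_cons e /=.
  have -> : disjoint_items (item_of p (drop (size (atoms q)) (items_of fs ts).2))
      (item_of q (items_of fs ts).2) by apply/disjoint_itemsP.
  by rewrite /rstate_of /= -item_and /= drop_drop size_cat addnC.
- have e := IHp _ _ h; rewrite [encode _]/= cat_cons read_cons e /=.
  by rewrite /rstate_of /= -item_not /= size_map.
- have e := read_vars [:: x] (IHp _ _ h); rewrite [flatten _]/= cats0 cat_cons in e.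
  rewrite [encode _]/= !cat_cons -catA read_cons e /=.
  by rewrite /rstate_of /= -item_ex /= size_map.
Qed.

(** * The verifier runs in polynomial time *)

Section VerifierPT.
Variables A B : finType.
Local Notation PT := (@PT A B _ _ _ _).

(** The quantification over parameter types allows the test to be used under binders, as in
    [pt_has]. *)
Definition pteq (E : eqType) {cE : codable E} : Prop :=
  forall X (cX : codable X) (a b : X -> E), PT a -> PT b -> PT (fun x => a x == b x).
Arguments pteq E {cE}.

Lemma pteq_pair (E1 E2 : eqType) (c1 : codable E1) (c2 : codable E2) :
  pteq E1 -> pteq E2 -> pteq (E1 * E2)%type.
Proof.
move=> h1 h2 X cX a b ha hb.
apply: (@pt_ext _ _ _ _ _ _ (fun x => ((a x).1 == (b x).1) && ((a x).2 == (b x).2))) => //.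
by apply: pt_andb; [apply: h1 | apply: h2]; pt.
Qed.

Lemma pteq_bool : pteq bool. Proof. by move=> *; apply: pt_eqbool. Qed.
Lemma pteq_bits : pteq (seq bool). Proof. by move=> *; apply: pt_eqbits. Qed.

Lemma pteq_obits : pteq (option (seq bool)).
Proof.
move=> X cX a b ha hb.
apply: (@pt_ext _ _ _ _ _ _ (fun x => if a x is Some u then (if b x is Some v then u == v else false)
    else (if b x is Some _ then false else true))).
  by move=> x; case: (a x) (b x) => [u|] [v|].
by pt; apply: pt_eqbits; pt.
Qed.

Lemma pt_mem (E : eqType) (cE : codable E) X (cX : codable X) (a : X -> E) (s : X -> seq E) :
  pteq E -> PT a -> PT s -> PT (fun x => a x \in s x).
Proof.
move=> hE ha hs; apply: (@pt_ext _ _ _ _ _ _ (fun x => has (fun t => t == a x) (s x))).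
  by move=> x; rewrite -has_pred1.
by apply: pt_has => //; apply: hE; pt.
Qed.

Lemma csize_filter Y {cY : codable Y} (p : pred Y) (s : seq Y) : csize (filter p s) <= csize s.
Proof.
elim: s => //= y s IH; case: (p y); rewrite !csize_cons; first by lia.
by apply: leq_trans IH _; lia.
Qed.

Lemma iter_foldr Y Z (f : Z -> Z) z (s : seq Y) :
  foldr (fun=> f) z s = iter (size s) f z.
Proof. by elim: s => //= y s ->. Qed.

(** Each round returns a sublist of [N], so intermediate results stay small whatever the number of
    rounds; a fold over [N] itself provides the count. *)
Lemma pt_reach (E : eqType) (cE : codable E) X (cX : codable X)
    (e : X -> rel E) (N : X -> seq E) (a : X -> E) :
  pteq E -> PT (fun p : X * (E * E) => e p.1 p.2.1 p.2.2) -> PT N -> PT a ->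
  PT (fun x => reach (e x) (N x) (a x)).
Proof.
move=> hE he hN ha; have [bN pbN hbN] := pt_size hN; have [ba pba hba] := pt_size ha.
apply: (@pt_ext _ _ _ _ _ _ (fun x => foldr (fun _ => grow (e x) (N x)) [:: a x] (N x))).
  by move=> x; rewrite iter_foldr.
apply: (@pt_foldr _ _ _ _ _ _ _ _ _ _ (fun x _ => grow (e x) (N x)) (fun n => bN n + (ba n + 2))) => //.
- by polyb.
- move=> x i; case: (drop i (N x)) => [|y s] /=.
    by rewrite csize_cons csize_nil; have := hba x; lia.
  by apply: leq_trans (csize_filter _ _) _; have := hbN x; lia.
- by pt.
rewrite /grow; apply: pt_filter; last by pt.
apply: pt_orb; first by apply: pt_mem; pt.
apply: pt_has; last by pt.
by apply: (pt_comp he (f := fun p : X * (E * seq E) * E * E => (p.1.1.1, (p.2, p.1.2)))); pt.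
Qed.

Section Atoms.
Context {X : Type} {cX : codable X}.
Implicit Types (a : X -> patom) (l : X -> patom * bool).

Lemma pt_asym a : PT a -> PT (fun x => asym (a x)).
Proof. by move=> ha; rewrite /asym; pt. Qed.
Lemma pt_aargs a : PT a -> PT (fun x => aargs (a x)).
Proof. by move=> ha; rewrite /aargs; pt. Qed.
Lemma pt_apre a : PT a -> PT (fun x => apre (a x)).
Proof. by move=> ha; rewrite /apre; pt. Qed.

End Atoms.

Lemma pt_afree X {cX : codable X} (a : X -> patom) : PT a -> PT (fun x => afree (a x)).
Proof.
move=> ha; rewrite /afree /pvars; apply: pt_filter; last exact: pt_aargs.
by apply: pt_negb; apply: pt_mem_bits; pt; apply: pt_apre; pt.
Qed.

Lemma pt_lpre X {cX : codable X} (l : X -> patom * bool) : PT l -> PT (fun x => lpre (l x)).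
Proof.
move=> hl; rewrite /lpre /litpre; pt; last by apply: pt_apre; pt.
by apply: pt_undup_bits; apply: pt_afree; pt.
Qed.

Lemma pt_bf X {cX : codable X} (pre : X -> seq (bool * seq bool)) (v : X -> seq bool) :
  PT pre -> PT v -> PT (fun x => bf (pre x) (v x)).
Proof.
move=> hp hv; have [b pb hb] := pt_size hp; rewrite /bf.
pose g x (q : bool * seq bool) (acc : seq (seq bool)) :=
  if q.2 == v x then [::] else if q.1 then acc else q.2 :: acc.
apply: (@pt_foldr_add _ _ _ _ _ _ _ _ _ _ g (fun n => b n + 1)) => //.
- by polyb.
- move=> x [c y] z hy; rewrite csize_pair in hy.
  have hz : 0 < csize z by exact: tsize_gt0.
  have hx := hb x; rewrite /g; cbv beta.
  by case: ifP => _ /=; [rewrite csize_nil | case: c hy => hy /=; rewrite ?csize_cons];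
    unfold var in *; lia.
- by pt.
by rewrite /g; pt; apply: pt_eqbits; pt.
Qed.

Lemma pt_clash X {cX : codable X} (a b : X -> patom * bool) :
  PT a -> PT b -> PT (fun x => clash (a x) (b x)).
Proof.
move=> ha hb.
have side (Y : Type) (cY : codable Y) (a' b' : Y -> patom * bool) (sd : Y -> bool) :
    PT a' -> PT b' -> PT sd -> PT (fun y => side (a' y) (b' y) (sd y)).
  by move=> *; rewrite /side; pt.
have ex (Y : Type) (cY : codable Y) (a' b' : Y -> patom * bool) (w : Y -> bool * var) :
    PT a' -> PT b' -> PT w -> PT (fun y => existential (a' y) (b' y) (w y)).
  move=> *; rewrite /existential; apply: pt_mem; last by apply: pt_lpre; apply: side; pt.
    exact: (pteq_pair pteq_bool pteq_bits).
  by pt.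
have keysP (Y : Type) (cY : codable Y) (a' b' : Y -> patom * bool) :
    PT a' -> PT b' -> PT (fun y => keys (a' y) (b' y)).
  by move=> *; rewrite /keys; pt; apply: pt_aargs; pt.
have keyE : pteq (bool * seq bool)%type := pteq_pair pteq_bool pteq_bits.
rewrite /clash; apply: pt_has; last by apply: keysP; pt.
apply: pt_andb; first by apply: ex; pt.
rewrite /clash_from; apply: pt_has.
  apply: pt_if; first by pt.
    by apply: keyE; pt.
  by apply: pt_andb; [apply: pt_negb; apply: keyE; pt | apply: ex; pt].
apply: pt_reach; last by pt.
- exact: pteq_pair keyE pteq_bool.
- rewrite /edge; apply: pt_orb; apply: pt_andb.
  + by pt.
  + rewrite /plain; apply: pt_andb; first by pt.
    apply: pt_mem; [exact: (pteq_pair pteq_bits pteq_bits) | by pt |].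
    by apply: pt_zip; apply: pt_aargs; pt.
  + by pt.
  rewrite /strict; apply: pt_andb; first by apply: pt_andb; [pt | apply: ex; pt].
  rewrite /step_args; apply: pt_mem_bits; first by pt.
  by apply: pt_bf; [apply: pt_lpre; apply: side; pt | pt].
by rewrite /nodes; pt; apply: keysP; pt.
Qed.

End VerifierPT.

Section ChecksPT.
Variables A B : finType.
Local Notation PT := (@PT A B _ _ _ _).

Lemma pt_head X Y {cX : codable X} {cY : codable Y} (d : X -> Y) (s : X -> seq Y) :
  PT d -> PT s -> PT (fun x => head (d x) (s x)).
Proof. by move=> hd hs; apply: pt_case_seq => //; pt. Qed.

Lemma pt_behead X Y {cX : codable X} {cY : codable Y} (s : X -> seq Y) :
  PT s -> PT (fun x => behead (s x)).
Proof.
by move=> hs; apply: (pt_case_seq (f := fun=> [::]) (g := fun _ _ l => l)) => //; pt.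
Qed.

Lemma pt_last X Y {cX : codable X} {cY : codable Y} (d : X -> Y) (s : X -> seq Y) :
  PT d -> PT s -> PT (fun x => last (d x) (s x)).
Proof.
move=> hd hs; apply: (@pt_ext _ _ _ _ _ _ (fun x => head (d x) (rev (s x)))).
  by move=> x; case/lastP: (s x) => // u y; rewrite rev_rcons last_rcons.
by apply: pt_head; pt.
Qed.

Section Checks.
Context {X : Type} {cX : codable X}.

Lemma pt_same_symbol (l l' : X -> patom * bool) :
  PT l -> PT l' -> PT (fun x => same_symbol (l x) (l' x)).
Proof.
move=> hl hl'; rewrite /same_symbol; apply: pt_andb.
  by apply: pteq_obits; apply: pt_asym; pt.
by apply: pt_eqn; apply: pt_size_seq; apply: pt_aargs; pt.
Qed.

Lemma pt_eq_value (a : X -> patom) (g : X -> bool) :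
  PT a -> PT g -> PT (fun x => eq_value (a x) (g x)).
Proof.
move=> ha hg; rewrite /eq_value; apply: pt_orb; last first.
  by apply: pt_last => //; pt; apply: pt_apre; pt.
apply: (@pt_ext _ _ _ _ _ _ (fun x => head [::] (aargs (a x)) == head [::] (behead (aargs (a x))))).
  by move=> x; case: (aargs (a x)) => [|u [|v s]].
apply: pt_eqbits; apply: pt_head; try exact: pt_const; first exact: pt_aargs.
by apply: pt_behead; exact: pt_aargs.
Qed.
End Checks.

Lemma pt_check_one X {cX : codable X} (L : X -> seq (patom * bool)) :
  PT L -> PT (fun x => check_one (L x)).
Proof.
move=> hL; rewrite /check_one; apply: pt_all => //.
apply: pt_case_option; [by apply: pt_asym; pt | by pt |].
apply: pt_all; last by pt.
by apply: pt_implyb; [apply: pt_same_symbol; pt | pt].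
Qed.

Lemma pt_check_many X {cX : codable X} (L : X -> seq (patom * bool)) :
  PT L -> PT (fun x => check_many (L x)).
Proof.
move=> hL; rewrite /check_many; apply: pt_all => //.
apply: pt_case_option; first by apply: pt_asym; pt.
  by apply: pt_eqbool; [pt | apply: pt_eq_value; pt].
apply: pt_all; last by pt.
apply: pt_implyb; last by apply: pt_clash; pt.
by apply: pt_andb; first pt; apply: pt_andb; [pt | apply: pt_same_symbol; pt].
Qed.

Lemma pt_frees X {cX : codable X} (L : X -> seq (patom * bool)) :
  PT L -> PT (fun x => frees (L x)).
Proof. by move=> hL; rewrite /frees; pt; apply: pt_afree; pt. Qed.

Lemma pt_addqL X {cX : codable X} (v : X -> var) (l : X -> patom * bool) :
  PT v -> PT l -> PT (fun x => addqL (v x) (l x)).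
Proof.
move=> hv hl; rewrite /addqL /addq; pt.
by apply: pt_mem_bits; [pt | apply: pt_afree; pt].
Qed.

Lemma pt_push_atom X {cX : codable X} (o : X -> option (seq bool)) (r : X -> rstate) :
  PT o -> PT r -> PT (fun x => push_atom (o x) (r x)).
Proof.
move=> ho hr; rewrite /push_atom; cbv zeta.
have hh : PT (fun x => head false (r x).2.2.2) by apply: pt_head; pt.
have hb : PT (fun x => behead (r x).2.2.2) by apply: pt_behead; pt.
by pt.
Qed.

Lemma pt_read_token t : PT (read_token t).
Proof.
have bitn X (cX : codable X) (r : X -> rstate) k : PT r ->
    PT (fun x => (size (r x).1 == 0) && (size (r x).2.1 == k)).
  by move=> hr; apply: pt_andb; apply: pt_eqn; pt.
rewrite /read_token; apply: pt_case_option; [by pt | by pt |].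
case: t => [||||||b].
- by apply: pt_some; apply: pt_push_atom; pt.
- by pt.
- apply: pt_if; [by apply: bitn; pt | | by pt].
  by apply: pt_some; apply: pt_push_atom; pt.
- apply: pt_if; [by apply: bitn; pt | | by pt].
  apply: pt_case_seq; [by pt | by pt |]; apply: pt_case_seq; [by pt | by pt |].
  apply: pt_if; [ | by pt | by pt].
  rewrite /disjoint_items; apply: pt_all; last by apply: pt_frees; pt.
  by apply: pt_negb; apply: pt_mem_bits; [pt | apply: pt_frees; pt].
- apply: pt_if; [by apply: bitn; pt | | by pt].
  by apply: pt_case_seq; [pt | pt |]; rewrite /flipL /flip; pt.
- apply: pt_if; [by apply: bitn; pt | | by pt].
  apply: pt_case_seq; [by pt | by pt |]; apply: pt_some.
  apply: pt_pair; first by pt.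
  apply: pt_pair; first by pt.
  apply: pt_pair; last by pt.
  apply: pt_cons; last by pt.
  apply: pt_pair; first by pt.
  apply: pt_map; last by pt.
  by apply: pt_addqL; [apply: pt_head; pt | pt].
- by pt.
Qed.

End ChecksPT.

(** * Size of the state while a formula is read *)

Lemma csize_some Y {cY : codable Y} (y : Y) : csize (Some y) = csize y + 2.
Proof. by rewrite -[code (Some y)]/(Node (code y) Leaf) tsize_node addn2 addn1. Qed.

Lemma csize_bool (b : bool) : csize b <= 3. Proof. by case: b. Qed.

Lemma csize_map_add Y Z {cY : codable Y} {cZ : codable Z} (f : Y -> Z) c (s : seq Y) :
  (forall y, csize (f y) <= csize y + c) -> csize (map f s) <= csize s + c * size s.
Proof.
move=> h; elim: s => //= y s IH; rewrite !csize_cons mulnS.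
by have := h y; lia.
Qed.

Lemma csize_behead Y {cY : codable Y} (s : seq Y) : csize (behead s) <= csize s.
Proof. by case: s => //= y s; rewrite csize_cons; lia. Qed.

Lemma csize_head (l : seq var) : csize (head [::] l) <= csize l.
Proof. by case: l => // x l; rewrite csize_cons; apply: leqW; exact: leq_addr. Qed.

Definition natoms (l : seq item) : nat := sumn [seq size p.2 | p <- l].

Lemma natoms_cons p l : natoms (p :: l) = size p.2 + natoms l.
Proof. by []. Qed.

(* Controls the growth of the state: reading a quantifier extends the prefixes
   of all the atoms of a formula. *)
Definition weight (st : option rstate) : nat :=
  if st is Some r then csize r.1 + csize r.2.1 + natoms r.2.2.1 else 0.

Lemma csize_rstate (r : rstate) : csize (Some r) =
  csize r.1 + csize r.2.1 + csize r.2.2.1 + csize r.2.2.2 + 5.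
Proof.
case: r => bits [vars [its ts]]; rewrite csize_some !csize_pair /=; lia.
Qed.

Lemma csize_state bits vars its ts : csize (Some (bits, (vars, (its, ts))) : option rstate) =
  csize bits + csize (vars : seq var) + csize (its : seq item) + csize ts + 5.
Proof. exact: csize_rstate. Qed.

Lemma csize_items b L its : csize ((b, L) :: its : seq item) =
  csize b + csize L + csize (its : seq item) + 2.
Proof. by rewrite csize_cons csize_pair; lia. Qed.

Lemma weight_read_token t st : weight (read_token t st) <= weight st + 5.
Proof.
case: st => [[bits [vars [its ts]]]|] //.
have hb : 0 < csize bits by exact: tsize_gt0.
have hv : 0 < csize vars by exact: tsize_gt0.
have push o : weight (Some (push_atom o (bits, (vars, (its, ts))))) <=
    weight (Some (bits, (vars, (its, ts)))) + 5.
  by rewrite /weight /push_atom /= !csize_nil natoms_cons /=; lia.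
case: t => [||||||b]; rewrite /read_token.
- exact: push.
- by rewrite /weight /= csize_nil csize_cons; unfold var in *; lia.
- by case: ifP => // _; exact: push.
- case: ifP => // _; case: its {push} => [|p [|q its]] //=; case: ifP => // _.
  set n1 := (X in _ + X <= _).
  have -> : n1 = size q.2 + size p.2 + natoms its by rewrite -size_cat.
  by rewrite !natoms_cons !csize_nil; lia.
- case: ifP => // _; case: its {push} => [|p its] //=.
  set n1 := (X in _ + X <= _).
  have -> : n1 = size p.2 + natoms its by rewrite -(size_map flipL p.2).
  by rewrite !natoms_cons !csize_nil; lia.
- case: ifP => // _; case: its {push} => [|p its] //=.
  set n1 := (X in _ + X <= _).
  have -> : n1 = size p.2 + natoms its by rewrite -(size_map (addqL (head [::] vars)) p.2).
  by rewrite !natoms_cons !csize_nil; lia.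
by rewrite /weight /= csize_cons; have := csize_bool b; lia.
Qed.

Lemma csize_flipL l : csize (flipL l) <= csize l + 2.
Proof.
case: l => [[[o xs] [pre pol]] g]; rewrite /flipL /flip !csize_pair /=.
have h1 : 0 < csize pol by exact: tsize_gt0.
have h2 := csize_bool (~~ pol); unfold var in *; lia.
Qed.

Lemma csize_literal o xs pre pol g : csize ((((o, xs), (pre, pol)) : patom), g) =
  csize o + csize xs + csize (pre : prefix) + csize pol + csize (g : bool) + 4.
Proof. by rewrite !csize_pair; lia. Qed.

Lemma csize_addqL x l : csize (addqL x l) <= csize l + (csize x + 5).
Proof.
case: l => [[[o xs] [pre pol]] g]; have h := csize_bool pol.
rewrite -[addqL _ _]/(addq x ((o, xs), (pre, pol)), g) /addq.
case: ifP => _; last by lia.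
apply: leq_trans (eq_leq (csize_literal o xs ((pol, x) :: pre) pol g)) _.
have e : csize ((pol, x) :: pre : prefix) = ((csize pol + csize x).+1 + csize pre).+1.
  by rewrite -csize_pair -csize_cons.
by rewrite e csize_literal; lia.
Qed.

(** A negation or a quantifier changes every atom of the top formula, a quantifier by the length of
    its variable. The number of atoms and this length are both bounded by the weight; hence the
    square. *)
Lemma csize_read_token t st :
  csize (read_token t st) <= csize st + ((weight st + 6) * (weight st + 6) + 40).
Proof.
case: st => [[bits [vars [its ts]]]|] //.
have none : csize (@None rstate) = 1 by [].
have none0 : csize (@None (seq bool)) = 1 by [].
have hb : 0 < csize bits by exact: tsize_gt0.
have hv : 0 < csize vars by exact: tsize_gt0.
have push o : csize o <= csize bits + 2 -> csize (Some (push_atom o (bits, (vars, (its, ts))))) <=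
    csize (Some (bits, (vars, (its, ts))) : option rstate) + 40.
  move=> ho; set g := head false ts.
  rewrite -[Some (push_atom _ _)]/(Some ([::],
    ([::], ((g, [:: (((o, vars), ([::], true)), g)]) :: its, behead ts)))).
  rewrite !csize_state csize_items.
  have e : csize [:: (((o, vars), ([::], true)), g)] =
      csize ((((o, vars), ([::], true)) : patom), g) + 2 by rewrite csize_cons csize_nil addn1 addn2.
  rewrite e csize_literal !csize_nil; have := csize_behead (cY := code_bool) ts; have := csize_bool g.
  by have := csize_bool true; lia.
set W := weight _.
case: t => [||||||b]; rewrite /read_token.
- by apply: leq_trans (push (Some bits) _) _; rewrite ?csize_some ?leq_add2l ?leq_addl.
- by rewrite !csize_rstate /= csize_nil csize_cons; unfold var in *; lia.
- case: ifP => _; last by rewrite none; nia.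
  by apply: leq_trans (push None _) _; rewrite ?none0 ?leq_add2l ?leq_addl //; lia.
- case: ifP => _; last by rewrite none; nia.
  case: its {push} @W => [|p [|q its]] W /=; try by rewrite none; nia.
  case: ifP => _; last by rewrite none; nia.
  case: p q @W => [v L] [u K] W; have := csize_bool (v && u).
  have : csize (K ++ L) + 1 = csize K + csize L by exact: csize_cat.
  have : 0 < csize v by exact: tsize_gt0.
  by rewrite !csize_state !csize_items csize_nil; cbn [fst snd]; lia.
- case: ifP => _; last by rewrite none; nia.
  case: its {push} @W => [|p its] W /=; first by rewrite none; nia.
  case: p @W => [v L] W; have := csize_map_add L csize_flipL; have := csize_bool (~~ v).
  have : 2 * size L <= (W + 6) * (W + 6).
    apply: leq_mul; first by lia.
    by rewrite -[W]/(csize bits + csize vars + (size L + natoms its)); lia.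
  have : 0 < csize v by exact: tsize_gt0.
  by rewrite !csize_state !csize_items csize_nil; cbn [fst snd]; lia.
- case: ifP => /= hx; last by rewrite none; nia.
  case: its {push} @W => [|p its] W; first by rewrite none; nia.
  case: p @W => [v L] W; have := csize_map_add L (csize_addqL (head [::] vars)).
  have : csize (head [::] vars) + 5 <= W + 6.
    have := csize_head vars; rewrite -[W]/(csize bits + csize vars + natoms _); lia.
  have : size L <= W + 6.
    by rewrite -[W]/(csize bits + csize vars + (size L + natoms its)); lia.
  move=> h1 h2; have := leq_mul h2 h1.
  rewrite !csize_state !csize_items csize_nil; cbn [fst snd].
  by set Q := (W + 6) * _; set M := (_ + 5) * size L; set m := csize (map _ _); lia.
by rewrite !csize_state csize_cons; have := csize_bool b; cbn [fst snd]; lia.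
Qed.

(** The weight starts at 2 and gains at most 5 per token, so [5 * size w + 8] bounds the factor
    [weight + 6] of each step. *)
Lemma csize_read w ts :
  csize (read w ts) <= csize ts + 20 + size w * ((5 * size w + 8) * (5 * size w + 8) + 40).
Proof.
have start : csize (read [::] ts) = csize ts + 8 by rewrite csize_rstate /= !csize_nil; lia.
enough (H : forall n v, size v <= n -> weight (read v ts) <= 5 * size v + 2 /\
    csize (read v ts) <= csize ts + 20 + size v * ((5 * n + 8) * (5 * n + 8) + 40)).
  by case: (H (size w) w (leqnn _)).
move=> n; elim=> [_|t v IH hv]; first by rewrite start; split; [|lia].
rewrite read_cons; have [h1 h2] := IH (ltnW hv).
have h3 := weight_read_token t (read v ts); have h4 := csize_read_token t (read v ts).
move: hv; rewrite /= => hv; split; first by lia.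
have h5 : (weight (read v ts) + 6) * (weight (read v ts) + 6) <= (5 * n + 8) * (5 * n + 8).
  by apply: leq_mul; lia.
by rewrite mulSn; lia.
Qed.

Section ReadPT.
Variables A B : finType.
Local Notation PT := (@PT A B _ _ _ _).

Lemma pt_read X {cX : codable X} (w : X -> seq token) (ts : X -> seq bool) :
  PT w -> PT ts -> PT (fun x => read (w x) (ts x)).
Proof.
move=> hw hts; have [b pb hb] := pt_size hw; have [b' pb' hb'] := pt_size hts.
pose bound n := b' n + 20 + b n * ((5 * b n + 8) * (5 * b n + 8) + 40).
apply: (pt_foldr (l := w) (a := fun x => Some ([::], ([::], ([::], ts x))))
  (g := fun _ => read_token) (b := bound)).
- by rewrite /bound; polyb.
- move=> x i; apply: leq_trans (csize_read (drop i (w x)) (ts x)) _.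
  have hs : size (drop i (w x)) <= b (csize x).
    rewrite size_drop; apply: leq_trans (leq_subr _ _) _.
    exact: leq_trans (ltnW (size_csize _)) (hb x).
  apply: leq_add; first by rewrite leq_add2r.
  apply: leq_mul => //; rewrite leq_add2r.
  by apply: leq_mul; rewrite leq_add2r leq_mul2l.
- exact: hw.
- by pt.
apply: (@pt_fin_case _ _ _ _ _ _ _ (fun p : X * (token * option rstate) => p.2.1)
   (fun t p => read_token t p.2.2)); first by pt.
by move=> t; apply: (pt_comp (pt_read_token _ _ t)); pt.
Qed.

End ReadPT.

(** * The verifier and membership in NP *)

Definition accepts (x : seq token) (u : seq bool) : bool :=
  if u is one :: ts then
    if read x ts is Some r then
      if r.2.2.1 is p :: l then
        [&& size r.1 == 0, size r.2.1 == 0, size l == 0, p.1 &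
          if one then check_one p.2 else check_many p.2]
      else false
    else false
  else false.

Definition lefts (A B : Type) (w : seq (A + B)) : seq A :=
  flatten [seq if a is inl x then [:: x] else [::] | a <- w].
Definition rights (A B : Type) (w : seq (A + B)) : seq B :=
  flatten [seq if a is inr x then [:: x] else [::] | a <- w].

Lemma lefts_cat (A B : Type) (x : seq A) (u : seq B) : lefts (map inl x ++ map inr u) = x.
Proof.
rewrite /lefts map_cat flatten_cat -!map_comp; elim: x => //= [|a x ->] //.
by elim: u.
Qed.

Lemma rights_cat (A B : Type) (x : seq A) (u : seq B) : rights (map inl x ++ map inr u) = u.
Proof.
rewrite /rights map_cat flatten_cat -!map_comp; elim: x => //=.
by elim: u => //= b u ->.
Qed.

Definition verifier (w : seq (token + bool)) : bool := accepts (lefts w) (rights w).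

Lemma verifier_polytime : polytime_decidable verifier.
Proof.
have ha : @PT (token + bool)%type bool _ _ _ _ (fun w : seq (token + bool) => lefts w).
  apply: pt_flatten; apply: pt_map; last exact: pt_id.
  exact: (pt_fin (h := snd) (fun a : token + bool => if a is inl x then [:: x] else [::]) (pt_snd _ _)).
have hb : @PT (token + bool)%type bool _ _ _ _ (fun w : seq (token + bool) => rights w).
  apply: pt_flatten; apply: pt_map; last exact: pt_id.
  exact: (pt_fin (h := snd) (fun a : token + bool => if a is inr x then [:: x] else [::]) (pt_snd _ _)).
apply: pt_polytime.
(* Output letters must carry the code by index rather than [code_bool]; branching between two
   constant words makes the conversion. *)
apply: (@pt_ext _ _ _ _ _ (@code_seq _ (code_fin bool))
  (fun w : seq (token + bool) => if verifier w then [:: true] else [:: false])).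
  by move=> w; case: (verifier w).
apply: pt_if; [|exact: pt_const|exact: pt_const].
rewrite /verifier /accepts; apply: pt_case_seq; [exact: hb | exact: pt_const |].
apply: pt_case_option; last 1 first.
- apply: pt_case_seq; [by pt | by pt |].
  apply: pt_andb; first by apply: pt_eqn; pt.
  apply: pt_andb; first by apply: pt_eqn; pt.
  apply: pt_andb; first by apply: pt_eqn; pt.
  apply: pt_andb; first by pt.
  by apply: pt_if; [pt | apply: pt_check_one; pt | apply: pt_check_many; pt].
- by apply: pt_read; pt.
- exact: pt_const.
Qed.

Lemma size_atoms f : size (atoms f) <= size (encode f).
Proof. by elim: f => //= [p hp q hq|p|x p]; rewrite ?size_map ?size_cat /= ?size_cat; lia. Qed.

Lemma eq_evb f k t t' : (forall i, i < size (atoms f) -> t (k + i) = t' (k + i)) ->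
  evb f k t = evb f k t'.
Proof.
move=> h; have mono u v : (forall i, i < size (atoms f) -> u (k + i) = v (k + i)) ->
    evb f k u -> evb f k v.
  by move=> e; apply: evb_mono => i hi; rewrite e //; case: ifP.
by apply/idP/idP; apply: mono => // i hi; rewrite h.
Qed.

Lemma F_SAT_in_NP : in_NP F_SAT.
Proof.
(* One bit chooses between the two tests, and one bit is spent on each atom, of which there are at
   most as many as tokens. *)
exists ('X + 1%:R%:P)%R, verifier; split; first exact: verifier_polytime.
move=> x; rewrite hornerD hornerX hornerC; split=> [[f [-> Ff]]|[u [_]]].
  move=> /(satisfiable_fragF Ff) [t [ht hc]].
  pose one := check_one (literals f t); pose ts := mkseq t (size (atoms f)).
  have et i : i < size (atoms f) -> nth false ts i = t i by move=> hi; rewrite nth_mkseq.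
  exists (one :: ts); rewrite [size (_ :: _)]/= size_mkseq; split.
    by rewrite -[(size (encode f) + _)%R]/(size (encode f) + 1) addn1 ltnS size_atoms.
  rewrite /verifier lefts_cat rights_cat /accepts.
  have := @read_complete f [::] [::] ts Ff (erefl _); rewrite cats0 => -> /=.
  have -> : literals f (nth false ts) = literals f t.
    by apply/eq_in_map => i; rewrite mem_iota => hi; rewrite et.
  rewrite (@eq_evb _ _ _ t) // ht /= /one.
  by case E: (check_one _) => //; case: hc => // hc; rewrite E in hc.
rewrite /verifier lefts_cat rights_cat /accepts; case: u => // one ts.
case E: (read x ts) => [r|] //; have [bits [vars [fs [Ffs ex er]]]] := read_sound E.
rewrite er /=; case: fs Ffs ex {er E} => //= f fs Ffs ex.
case/and5P => /eqP/size0nil hb /eqP/size0nil hv hs he hc.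
case: fs Ffs ex hs he hc => // Ffs ex _ he hc.
have Ff : fragF f by inversion_clear Ffs.
exists f; split=> //; first by rewrite ex hb hv /= cats0.
(* A certificate that is too short is completed by [false], in agreement with [head false] in
   [push_atom]. *)
apply/(satisfiable_fragF Ff); exists (nth false ts); split=> //.
by case: one hc; [left | right].
Qed.

Theorem lemma5p6 : NP_complete F_SAT.
Proof. by split; [exact: F_SAT_in_NP | exact: F_SAT_hard]. Qed.
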